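(* For the quantum group $\mathfrak{D}$ at $\mathbb{S}_3$ attached to the 12-dimensional Fomin–Kirillov algebra, the nonzero proper $\mathfrak{D}$-submodules of the Verma module $\mathsf{M}(\tau,0)$ are $\mathsf{S}(\tau,0)\subset\mathsf{X}(\tau,0)$, where (i) $\mathsf{X}(\tau,0)=\mathfrak{D}\mathsf{J}$ is a highest-weight submodule of weight $(\sigma,-)$; (ii) $\mathsf{S}(\tau,0)=\mathfrak{D}\mathsf{G}$ is a highest-weight submodule of weight $(e,\rho)$. Here $\mathsf{J}\subset\mathsf{M}^{-1}(\tau,0)$ is the $\mathfrak{D}(\mathbb{S}_3)$-submodule of weight $(\sigma,-)$ with basis $\mathsf{j}_i=(1-\sigma\tau^i)x_{\sigma\tau^{i+2}}|\tau\rangle$, $i=0,1,2$, and $\mathsf{G}\subset\mathsf{M}^{-2}(\tau,0)$ is the $\mathfrak{D}(\mathbb{S}_3)$-submodule of weight $(e,\rho)$ with basis $\mathsf{g}=(x_{(13)}x_{(23)}-\zeta^2x_{(12)}x_{(13)})|\tau\rangle+(x_{(13)}x_{(12)}-\zeta^2x_{(12)}x_{(23)})|\tau^{-1}\rangle$ and $\sigma\mathsf{g}$. Therefore the composition factors of $\mathsf{M}(\tau,0)$, counted with multiplicity, are $\mathsf{L}(\tau,0),\mathsf{L}(\sigma,-),\mathsf{L}(e,\rho)$.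
   Context: $\Bbbk$ is an algebraically closed field of characteristic zero, $\zeta\in\Bbbk$ a fixed primitive cube root of $1$; $\sigma=(12)$, $\tau=(123)$ in $\mathbb{S}_3$, permutations composed right to left, so $\sigma\tau=(23)$, $\sigma\tau^2=(13)$. $V=\Bbbk\{x_{(12)},x_{(23)},x_{(13)}\}$ is the Yetter–Drinfeld module over $\Bbbk\mathbb{S}_3$ with $g\cdot x_{(ij)}=\mathrm{sgn}(g)x_{g(ij)g^{-1}}$ and coaction $x_{(ij)}\mapsto(ij)\otimes x_{(ij)}$; $x_{\sigma\tau^t}$ means $x_{(ij)}$ for $(ij)=\sigma\tau^t$. Its Nichols algebra $\mathfrak{B}(V)=\bigoplus_{n=0}^4\mathfrak{B}^n(V)$ is the 12-dimensional Fomin–Kirillov algebra. $\mathfrak{D}$ is the Drinfeld double of the bosonization $\mathfrak{B}(V)\#\Bbbk\mathbb{S}_3$. Explicitly, $\mathfrak{D}$ is the algebra generated by $x_{(ij)}$, $y_{(ij)}$ (transpositions $(ij)$) and $g,\delta_g$ ($g\in\mathbb{S}_3$), where the $g$ multiply as in $\mathbb{S}_3$, the $\delta_g$ are orthogonal idempotents with sum $1$, and, for distinct $i,j,k$ and $g,h\in\mathbb{S}_3$: $x_{(ij)}^2=0$, $x_{(ij)}x_{(ik)}+x_{(jk)}x_{(ij)}+x_{(ik)}x_{(jk)}=0$; the same relations for the $y$'s; $\delta_hg=g\delta_{g^{-1}hg}$; $gx_{(ij)}=\mathrm{sgn}(g)x_{g(ij)g^{-1}}g$; $\delta_hx_{(ij)}=x_{(ij)}\delta_{(ij)h}$;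 $\delta_gy_{(ij)}=y_{(ij)}\delta_{(ij)g}$; $y_{(ij)}g=\mathrm{sgn}(g)\,g\,y_{g^{-1}(ij)g}$; $y_{(ij)}x_{(ij)}+x_{(ij)}y_{(ij)}=1+(ij)(\delta_{(ij)}-\delta_e)$; $y_{(ik)}x_{(ij)}+x_{(ij)}y_{(jk)}=(ij)(\delta_{(ik)}-\delta_{(ik)(ij)})$. The $g,\delta_g$ generate the Drinfeld double $\mathfrak{D}(\mathbb{S}_3)$ of $\Bbbk\mathbb{S}_3$; $\overline V=\Bbbk\{y_{(ij)}\}$ generates $\mathfrak{B}(\overline V)$; multiplication $\mathfrak{B}(V)\otimes\mathfrak{D}(\mathbb{S}_3)\otimes\mathfrak{B}(\overline V)\to\mathfrak{D}$ is a linear isomorphism. Simple $\mathfrak{D}(\mathbb{S}_3)$-modules relevant here (''degree $h$'' means $\delta_h$ acts as identity and other $\delta$'s by $0$): $M(e,\rho)$, the 2-dimensional irreducible $\mathbb{S}_3$-module in degree $e$; $M(\sigma,-)$ with basis $|12\rangle,|23\rangle,|13\rangle$, $|ij\rangle$ of degree $(ij)$, $g|ij\rangle=\mathrm{sgn}(g)|g(ij)g^{-1}\rangle$; $M(\tau,0)$ with basis $|\tau\rangle,|\tau^{-1}\rangle$, $|\tau^{\pm1}\rangle$ of degree $\tau^{\pm1}$, $\tau^t|\tau^{\pm1}\rangle=|\tau^{\pm1}\rangle$, $\sigma\tau^t|\tau^{\pm1}\rangle=|\tau^{\mp1}\rangle$. A $\mathfrak{D}(\mathbb{S}_3)$-module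 is of weight $(g,\varrho)$ if it is isomorphic to $M(g,\varrho)$. Let $\mathfrak{D}^{\ge0}$ be the subalgebra generated by $\mathfrak{D}(\mathbb{S}_3)$ and $\overline V$; a simple $\mathfrak{D}(\mathbb{S}_3)$-module $M(g,\varrho)$ is a $\mathfrak{D}^{\ge0}$-module with $\overline V$ acting by $0$. The Verma module is $\mathsf{M}(g,\varrho)=\mathfrak{D}\otimes_{\mathfrak{D}^{\ge0}}M(g,\varrho)=\mathfrak{B}(V)\otimes M(g,\varrho)$, graded with $\mathsf{M}^n(g,\varrho)=\mathfrak{B}^{-n}(V)\otimes M(g,\varrho)$, $n\le0$; write $x|h\rangle$ for $x\otimes|h\rangle$. $\mathsf{X}(g,\varrho)$ is its unique maximal $\mathfrak{D}$-submodule, $\mathsf{L}(g,\varrho)$ its head and $\mathsf{S}(g,\varrho)$ its socle. A $\mathfrak{D}$-module is a highest-weight module of weight $(g,\varrho)$ if it is generated by a $\mathfrak{D}(\mathbb{S}_3)$-submodule $M$ of weight $(g,\varrho)$ with $\overline VM=0$. *)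

(* Defs.v *)
From HB Require Import structures.
From mathcomp Require Import all_boot all_order all_fingroup all_algebra.
From mathcomp Require Import boolp classical_sets.

Set Implicit Arguments.
Unset Strict Implicit.
Unset Printing Implicit Defensive.

Import GRing.Theory.
Local Open Scope ring_scope.
Local Open Scope quotient_scope.

Local Notation repr := generic_quotient.repr.

(* Permutations are composed from right to left here, whereas [permM] composes
   from left to right; inverses and powers agree.  The points 1, 2, 3 are the
   ordinals 0, 1, 2 of ['I_3]. *)
Definition mul3 (g h : 'S_3) : 'S_3 := (h * g)%g.
Notation "g ** h" := (mul3 g h) (at level 40, left associativity).

Definition inv3 (g : 'S_3) : 'S_3 := g^-1%g.
Definition conj3 (g h : 'S_3) : 'S_3 := g ** h ** inv3 g.

(* The odd elements of S_3 are exactly its transpositions. *)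
Definition transp : Type := {t : 'S_3 | odd_perm t}.

Lemma odd_tr (i j : 'I_3) (h : i != j) : odd_perm (tperm i j).
Proof. by rewrite odd_tperm. Qed.
Definition tr (i j : 'I_3) (h : i != j) : transp := exist _ (tperm i j) (odd_tr h).

Lemma odd_conj3 (g : 'S_3) (t : transp) : odd_perm (conj3 g (val t)).
Proof. by rewrite /conj3 /mul3 /inv3 !odd_permM odd_permV (valP t) addbC addbK. Qed.
Definition conjT (g : 'S_3) (t : transp) : transp := exist _ (conj3 g (val t)) (odd_conj3 g t).

Definition p1 : 'I_3 := inord 0.
Definition p2 : 'I_3 := inord 1.
Definition p3 : 'I_3 := inord 2.
Fact p12 : p1 != p2. Proof. by rewrite -val_eqE /= !inordK. Qed.
Fact p23 : p2 != p3. Proof. by rewrite -val_eqE /= !inordK. Qed.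
Fact p13 : p1 != p3. Proof. by rewrite -val_eqE /= !inordK. Qed.
Definition t12 : transp := tr p12.
Definition t23 : transp := tr p23.
Definition t13 : transp := tr p13.

Definition sigma : 'S_3 := val t12.
(* tau = (123) sends 1 to 2, 2 to 3 and 3 to 1: it is i |-> 1 + i in Z/3. *)
Definition tau : 'S_3 := perm (@addrI 'I_3 1).

Fact odd_tau : odd_perm tau = false.
Proof.
have tau3 : (tau ^+ 3)%g = 1%g.
  apply/permP => i; rewrite !expgS expg0 mulg1 !permM perm1 !permE.
  by apply: val_inj; case: i => [[|[|[|]]]].
have : odd_perm (tau ^+ 3)%g = false by rewrite tau3 odd_perm1.
by rewrite !expgS expg0 mulg1 !odd_permM; case: (odd_perm tau).
Qed.

Lemma odd_sigtau i : odd_perm (sigma ** (tau ^+ i)%g).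
Proof.
rewrite /mul3 odd_permM /sigma (valP t12) addbT.
elim: i => [|i IHi]; first by rewrite expg0 odd_perm1.
by rewrite expgS odd_permM odd_tau.
Qed.
Definition sigtau (i : nat) : transp := exist _ (sigma ** (tau ^+ i)%g) (odd_sigtau i).

Lemma sigtauE : [/\ sigtau 0 = t12, sigtau 1 = t23 & sigtau 2 = t13].
Proof.
split; apply: val_inj; apply/permP => i; rewrite /= /mul3 ?expgS ?expg0 ?mulg1;
  rewrite ?mul1g ?permM ?permE /= -?val_eqE /= ?inordK //;
  by apply: val_inj; case: i => [[|[|[|]]]] //= ?; rewrite ?inordK.
Qed.

Section Double.
Variable K : fieldType.

(* Noncommutative polynomial expressions over [K] in the generators. *)
Inductive expr : Type :=
| EX of transp
| EY of transp
| EG of 'S_3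
| ED of 'S_3
| EC of K
| EAdd of expr & expr
| EMul of expr & expr.

HB.instance Definition _ := gen_eqMixin expr.
HB.instance Definition _ := gen_choiceMixin expr.

Declare Scope expr_scope.
Delimit Scope expr_scope with E.
Bind Scope expr_scope with expr.
Local Notation "u + v" := (EAdd u v) : expr_scope.
Local Notation "u * v" := (EMul u v) : expr_scope.
Local Notation "c %:C" := (EC c) (at level 2, left associativity, format "c %:C") : expr_scope.
Local Notation "- u" := (EMul (EC (-1)) u) : expr_scope.
Local Notation "u - v" := (EAdd u (- v)%E) : expr_scope.
Local Notation "0" := (EC 0) : expr_scope.
Local Notation "1" := (EC 1) : expr_scope.
Local Notation sgn g := (EC ((-1) ^+ odd_perm g)).

Inductive drel : expr -> expr -> Prop :=
| RG1 : drel (EG 1%g) 1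
| RG g h : drel (EG g * EG h) (EG (g ** h))
| RD g h : drel (ED g * ED h) (if g == h then ED g else 0%E)
| RD1 : drel (\big[EAdd/EC 0]_(h : 'S_3) ED h) 1
| RDG g h : drel (ED h * EG g) (EG g * ED (inv3 g ** h ** g))
| RXX t : drel (EX t * EX t) 0
| RXquad i j k (ij : i != j) (ik : i != k) (jk : j != k) :
    drel (EX (tr ij) * EX (tr ik) + EX (tr jk) * EX (tr ij)
         + EX (tr ik) * EX (tr jk)) 0
| RYY t : drel (EY t * EY t) 0
| RYquad i j k (ij : i != j) (ik : i != k) (jk : j != k) :
    drel (EY (tr ij) * EY (tr ik) + EY (tr jk) * EY (tr ij)
         + EY (tr ik) * EY (tr jk)) 0
| RGX g t : drel (EG g * EX t) (sgn g * EX (conjT g t) * EG g)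
| RDX h t : drel (ED h * EX t) (EX t * ED (val t ** h))
| RDY h t : drel (ED h * EY t) (EY t * ED (val t ** h))
| RYG g t : drel (EY t * EG g) (sgn g * EG g * EY (conjT (inv3 g) t))
| RYXdiag t : drel (EY t * EX t + EX t * EY t) (1 + EG (val t) * (ED (val t) - ED 1%g))
| RYX i j k (ij : i != j) (ik : i != k) (jk : j != k) :
    drel (EY (tr ik) * EX (tr ij) + EX (tr ij) * EY (tr jk))
        (EG (val (tr ij)) *
           (ED (val (tr ik)) - ED (val (tr ik) ** val (tr ij)))).

(* The least congruence that contains [drel] and makes the quotient of [expr]
   an associative unital [K]-algebra; the quotient is thus the free algebra on
   the generators modulo the two-sided ideal of the relations. *)
Inductive eqv : expr -> expr -> Prop :=
| QRel u v : drel u v -> eqv u v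
| QRefl u : eqv u u
| QSym u v : eqv u v -> eqv v u
| QTrans u v w : eqv u v -> eqv v w -> eqv u w
| QAdd u u' v v' : eqv u u' -> eqv v v' -> eqv (u + v) (u' + v')
| QMul u u' v v' : eqv u u' -> eqv v v' -> eqv (u * v) (u' * v')
| QAddA u v w : eqv (u + (v + w)) (u + v + w)
| QAddC u v : eqv (u + v) (v + u)
| QAdd0 u : eqv (0 + u) u
| QAddN u : eqv (- u + u) 0
| QMulA u v w : eqv (u * (v * w)) (u * v * w)
| QMul1l u : eqv (1 * u) u
| QMul1r u : eqv (u * 1) u
| QMulDl u v w : eqv ((u + v) * w) (u * w + v * w)
| QMulDr u v w : eqv (u * (v + w)) (u * v + u * w)
| QCAdd a b : eqv (EC (a + b)) (a%:C + b%:C)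
| QCMul a b : eqv (EC (a * b)) (a%:C * b%:C)
| QCcomm a u : eqv (a%:C * u) (u * a%:C).

Definition eqvb (u v : expr) : bool := `[< eqv u v >].
Lemma eqvb_refl : reflexive eqvb.
Proof. by move=> u; apply/asboolP/QRefl. Qed.
Lemma eqvb_sym : symmetric eqvb.
Proof. by move=> u v; apply/asboolP/asboolP => /QSym. Qed.
Lemma eqvb_trans : transitive eqvb.
Proof. by move=> v u w /asboolP uv /asboolP vw; apply/asboolP/(QTrans uv). Qed.
Definition eqv_rel := EquivRel eqvb eqvb_refl eqvb_sym eqvb_trans.

Definition DD := {eq_quot eqv_rel}.
HB.instance Definition _ := Choice.on DD.
HB.instance Definition _ := EqQuotient.on DD.

Definition cls (u : expr) : DD := \pi_DD u.
Lemma clsE u v : cls u = cls v <-> eqv u v.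
Proof. by split=> [/eqmodP/asboolP|/asboolP uv] //; apply/eqmodP. Qed.
Lemma cls_repr (a : DD) : cls (repr a) = a.
Proof. exact: reprK. Qed.
Lemma eqv_repr u : eqv (repr (cls u)) u.
Proof. by apply/clsE; rewrite cls_repr. Qed.

Definition DDadd (a b : DD) := cls (repr a + repr b).
Definition DDopp (a : DD) := cls (- repr a).
Definition DDmul (a b : DD) := cls (repr a * repr b).
Definition DDscale (c : K) (a : DD) := cls (c%:C * repr a).

Lemma clsD u v : cls (u + v) = DDadd (cls u) (cls v).
Proof. by apply/clsE/QAdd; apply/QSym/eqv_repr. Qed.
Lemma clsM u v : cls (u * v) = DDmul (cls u) (cls v).
Proof. by apply/clsE/QMul; apply/QSym/eqv_repr. Qed.
Lemma clsN u : cls (- u) = DDopp (cls u).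
Proof. by apply/clsE/QMul; [apply: QRefl|apply/QSym/eqv_repr]. Qed.
Lemma clsZ c u : cls (c%:C * u) = DDscale c (cls u).
Proof. by apply/clsE/QMul; [apply: QRefl|apply/QSym/eqv_repr]. Qed.

Lemma clsP (P : DD -> Prop) : (forall u, P (cls u)) -> forall a, P a.
Proof. by move=> Pu a; rewrite -(cls_repr a). Qed.

Fact DDaddA : associative DDadd.
Proof.
elim/clsP => u; elim/clsP => v; elim/clsP => w.
by rewrite -!clsD; apply/clsE/QAddA.
Qed.
Fact DDaddC : commutative DDadd.
Proof. by elim/clsP => u; elim/clsP => v; rewrite -!clsD; apply/clsE/QAddC. Qed.
Fact DDadd0 : left_id (cls 0) DDadd.
Proof. by elim/clsP => u; rewrite -!clsD; apply/clsE/QAdd0. Qed.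
Fact DDaddN : left_inverse (cls 0) DDopp DDadd.
Proof. by elim/clsP => u; rewrite -clsN -!clsD; apply/clsE/QAddN. Qed.
HB.instance Definition _ :=
  GRing.isZmodule.Build DD DDaddA DDaddC DDadd0 DDaddN.

Fact DDmulA : associative DDmul.
Proof.
elim/clsP => u; elim/clsP => v; elim/clsP => w.
by rewrite -!clsM; apply/clsE/QMulA.
Qed.
Fact DDmul1l : left_id (cls 1) DDmul.
Proof. by elim/clsP => u; rewrite -clsM; apply/clsE/QMul1l. Qed.
Fact DDmul1r : right_id (cls 1) DDmul.
Proof. by elim/clsP => u; rewrite -clsM; apply/clsE/QMul1r. Qed.
Fact DDmulDl : left_distributive DDmul DDadd.
Proof.
elim/clsP => u; elim/clsP => v; elim/clsP => w.
by rewrite -[DDadd (cls u) (cls v)]clsD -!clsM -clsD; apply/clsE/QMulDl.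
Qed.
Fact DDmulDr : right_distributive DDmul DDadd.
Proof.
elim/clsP => u; elim/clsP => v; elim/clsP => w.
by rewrite -[DDadd (cls v) (cls w)]clsD -!clsM -clsD; apply/clsE/QMulDr.
Qed.
HB.instance Definition _ :=
  GRing.Zmodule_isPzRing.Build DD DDmulA DDmul1l DDmul1r DDmulDl DDmulDr.

(* The counit of D, which shows that D is not the zero ring. *)
Fixpoint counit (u : expr) : K :=
  match u with
  | EX _ | EY _ => 0
  | EG _ => 1
  | ED h => (h == 1%g)%:R
  | EC c => c
  | EAdd u v => counit u + counit v
  | EMul u v => counit u * counit v
  end.

Lemma counit_rel u v : drel u v -> counit u = counit v.
Proof.
have tN1 (t : transp) : (val t == 1%g) = false.
  by apply/negP => /eqP E; have := valP t; rewrite /= E odd_perm1.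
case=> /=.
- by [].
- by move=> *; rewrite mulr1.
- move=> g h; case: (eqVneq g h) => [<-|gh] /=.
    by case: (g == 1%g); rewrite ?mulr0 ?mulr1.
  case: (eqVneq g 1%g) => [E|_]; last by rewrite mul0r.
  by rewrite E in gh; rewrite eq_sym (negPf gh) mulr0.
- rewrite (big_morph counit (id1 := 0) (op1 := +%R)) //.
  by rewrite (bigD1 1%g) //= eqxx big1 ?addr0 // => h /negPf ->.
- move=> g h; rewrite mul1r mulr1 /mul3 /inv3.
  congr (nat_of_bool _)%:R; apply/eqP/eqP => [->|E]; first by rewrite mul1g mulgV.
  by apply: (mulIg g^-1%g); apply: (mulgI g); rewrite E mul1g mulgV.
- by move=> t; rewrite mulr0.
- by move=> *; rewrite !mulr0 !addr0.
- by move=> t; rewrite mulr0.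
- by move=> *; rewrite !mulr0 !addr0.
- by move=> *; rewrite ?mulr0 ?mul0r.
- by move=> *; rewrite ?mulr0 ?mul0r.
- by move=> *; rewrite ?mulr0 ?mul0r.
- by move=> *; rewrite ?mulr0 ?mul0r.
- by move=> t; rewrite (tN1 t) eqxx !mulr0 ?mul0r mul1r !add0r mulr1 subrr.
- move=> i j k ij ik jk; rewrite !mulr0 ?mul0r (tN1 (tr ik)) mul1r !add0r.
  suff -> : (tperm i k ** tperm i j == 1%g) = false by rewrite mulr0.
  apply/negP => /eqP /permP /(_ j); rewrite permM tpermR tpermL perm1 => E.
  by rewrite E eqxx in jk.
Qed.

Lemma counit_eqv u v : eqv u v -> counit u = counit v.
Proof.
elim=> {u v} /=; rewrite ?mul1r //.
- exact: counit_rel.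
- by move=> u v w _ -> _ ->.
- by move=> u u' v v' _ -> _ ->.
- by move=> u u' v v' _ -> _ ->.
- by move=> *; rewrite addrA.
- by move=> *; rewrite addrC.
- by move=> *; rewrite add0r.
- by move=> *; rewrite mulN1r addNr.
- by move=> *; rewrite mulrA.
- by move=> *; rewrite mul1r.
- by move=> *; rewrite mulr1.
- by move=> *; rewrite mulrDl.
- by move=> *; rewrite mulrDr.
- by move=> *; rewrite mulrC.
Qed.

Fact DD_neq0 : (1 : DD) != 0.
Proof.
by apply/eqP => /clsE /counit_eqv /= /eqP; rewrite oner_eq0.
Qed.
HB.instance Definition _ := GRing.PzSemiRing_isNonZero.Build DD DD_neq0.

Fact DDscaleA c d (a : DD) : DDscale c (DDscale d a) = DDscale (c * d) a.
Proof.
elim/clsP: a => u; rewrite -!clsZ; apply/clsE.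
by apply: QTrans (QMulA _ _ _) _; apply: QMul (QSym (QCMul _ _)) (QRefl _).
Qed.
Fact DDscale1 : left_id 1 DDscale.
Proof. by elim/clsP => u; rewrite -clsZ; apply/clsE/QMul1l. Qed.
Fact DDscaleDr : right_distributive DDscale +%R.
Proof.
move=> c; elim/clsP => u; elim/clsP => v.
by rewrite -[cls u + cls v]clsD -!clsZ -[RHS]clsD; apply/clsE/QMulDr.
Qed.
Fact DDscaleDl (a : DD) : {morph DDscale^~ a : c d / c + d}.
Proof.
elim/clsP: a => u c d; rewrite -!clsZ -[RHS]clsD; apply/clsE.
exact: QTrans (QMul (QCAdd _ _) (QRefl _)) (QMulDl _ _ _).
Qed.
HB.instance Definition _ :=
  GRing.Zmodule_isLmodule.Build K DD DDscaleA DDscale1 DDscaleDr DDscaleDl.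

Fact DDscaleAl (c : K) (a b : DD) : c *: (a * b) = c *: a * b.
Proof.
elim/clsP: a => u; elim/clsP: b => v.
rewrite -[cls u * cls v]clsM -[c *: cls u]clsZ -[LHS]clsZ -[RHS]clsM.
exact/clsE/QMulA.
Qed.
HB.instance Definition _ := GRing.Lmodule_isLalgebra.Build K DD DDscaleAl.
Fact DDscaleAr (c : K) (a b : DD) : c *: (a * b) = a * (c *: b).
Proof.
elim/clsP: a => u; elim/clsP: b => v.
rewrite -[cls u * cls v]clsM -[c *: cls v]clsZ -[LHS]clsZ -[RHS]clsM; apply/clsE.
apply: QTrans (QMulA _ _ _) _.
apply: QTrans (QMul (QCcomm _ _) (QRefl _)) _.
exact: QSym (QMulA _ _ _).
Qed.
HB.instance Definition _ := GRing.Lalgebra_isAlgebra.Build K DD DDscaleAr.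

Definition xx (t : transp) : DD := cls (EX t).
Definition yy (t : transp) : DD := cls (EY t).
Definition gg (g : 'S_3) : DD := cls (EG g).
Definition dd (h : 'S_3) : DD := cls (ED h).

End Double.

Section Modules.
Variable R : nzRingType.
Implicit Types (V U : lmodType R).

(* The submodule [R S] generated by the set [S]. *)
Definition gen V (S : set V) : {pred V} :=
  fun v => `[< forall A : submodClosed V, (forall s, S s -> s \in A) -> v \in A >].

Fact gen_closed V (S : set V) : submod_closed (gen S).
Proof.
split=> [|a u v /asboolP Su /asboolP Sv]; apply/asboolP => A SA.
  exact: rpred0.
by apply: rpredD; [apply: rpredZ; apply: Su | apply: Sv].
Qed.
HB.instance Definition _ V (S : set V) :=
  GRing.isSubmodClosed.Build R V (gen S) (gen_closed S).

Definition submod V (A : submodClosed V) : Type := {v : V | v \in A}.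
HB.instance Definition _ V (A : submodClosed V) := [isSub of submod A for sval].
HB.instance Definition _ V (A : submodClosed V) := [Choice of submod A by <:].
HB.instance Definition _ V (A : submodClosed V) :=
  [SubChoice_isSubLmodule of submod A by <:].

Section Quotient.
Variables (V : lmodType R) (N : submodClosed V).

Definition qrel (u v : V) : bool := u - v \in N.
Lemma qrel_refl : reflexive qrel.
Proof. by move=> u; rewrite /qrel subrr rpred0. Qed.
Lemma rpredN1 (u : V) : u \in N -> - u \in N.
Proof. by move=> Nu; rewrite -scaleN1r rpredZ. Qed.
Lemma qrel_sym : symmetric qrel.
Proof. by move=> u v; apply/idP/idP => /rpredN1; rewrite opprB. Qed.
Lemma qrel_trans : transitive qrel.
Proof. by move=> v u w uv vw; rewrite /qrel -(subrKA v) rpredD. Qed.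
Definition qeqv := EquivRel qrel qrel_refl qrel_sym qrel_trans.

Definition quo := {eq_quot qeqv}.
HB.instance Definition _ := Choice.on quo.
HB.instance Definition _ := EqQuotient.on quo.

Definition qpi (v : V) : quo := \pi_quo v.
Lemma qpiE u v : qpi u = qpi v <-> u - v \in N.
Proof. by split=> [/eqmodP|uv] //; apply/eqmodP. Qed.
Lemma qpi_repr (a : quo) : qpi (repr a) = a.
Proof. exact: reprK. Qed.
Lemma qrepr v : repr (qpi v) - v \in N.
Proof. by apply/qpiE; rewrite qpi_repr. Qed.

Definition qadd (a b : quo) := qpi (repr a + repr b).
Definition qopp (a : quo) := qpi (- repr a).
Definition qscale (c : R) (a : quo) := qpi (c *: repr a).

Lemma qpiD u v : qpi (u + v) = qadd (qpi u) (qpi v).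
Proof.
apply/esym/qpiE; rewrite opprD addrACA.
by apply: rpredD; apply: qrepr.
Qed.
Lemma qpiN u : qpi (- u) = qopp (qpi u).
Proof. by apply/esym/qpiE; rewrite -opprD; apply/rpredN1/qrepr. Qed.
Lemma qpiZ c u : qpi (c *: u) = qscale c (qpi u).
Proof. by apply/esym/qpiE; rewrite -scalerBr; apply/rpredZ/qrepr. Qed.

Lemma qpiP (P : quo -> Prop) : (forall u, P (qpi u)) -> forall a, P a.
Proof. by move=> Pu a; rewrite -(qpi_repr a). Qed.

Fact qaddA : associative qadd.
Proof.
elim/qpiP => u; elim/qpiP => v; elim/qpiP => w.
by rewrite -[qadd (qpi v) _]qpiD -[qadd (qpi u) (qpi v)]qpiD -[LHS]qpiD -[RHS]qpiD addrA.
Qed.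
Fact qaddC : commutative qadd.
Proof. by elim/qpiP => u; elim/qpiP => v; rewrite -[LHS]qpiD -[RHS]qpiD addrC. Qed.
Fact qadd0 : left_id (qpi 0) qadd.
Proof. by elim/qpiP => u; rewrite -qpiD add0r. Qed.
Fact qaddN : left_inverse (qpi 0) qopp qadd.
Proof. by elim/qpiP => u; rewrite -qpiN -qpiD addNr. Qed.
HB.instance Definition _ := GRing.isZmodule.Build quo qaddA qaddC qadd0 qaddN.

Fact qscaleA c d (a : quo) : qscale c (qscale d a) = qscale (c * d) a.
Proof. by elim/qpiP: a => u; rewrite -[qscale d _]qpiZ -[LHS]qpiZ -qpiZ scalerA. Qed.
Fact qscale1 : left_id 1 qscale.
Proof. by elim/qpiP => u; rewrite -qpiZ scale1r. Qed.
Fact qscaleDr : right_distributive qscale +%R.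
Proof.
move=> c; elim/qpiP => u; elim/qpiP => v.
by rewrite -[qpi u + qpi v]qpiD -!qpiZ -[RHS]qpiD scalerDr.
Qed.
Fact qscaleDl (a : quo) : {morph qscale^~ a : c d / c + d}.
Proof. by elim/qpiP: a => u c d; rewrite -!qpiZ -[RHS]qpiD scalerDl. Qed.
HB.instance Definition _ :=
  GRing.Zmodule_isLmodule.Build R quo qscaleA qscale1 qscaleDr qscaleDl.
End Quotient.

Definition isomorphic V U : Prop := exists f : {linear V -> U}, bijective f.

(* The subquotient A / (A :&: B); it is A / B when B is contained in A. *)
Fact inter_closed V (A B : submodClosed V) :
  submod_closed [pred v : submod A | val v \in B].
Proof.
split=> [|a u v /= Bu Bv]; rewrite inE /=; first exact: rpred0.
by rewrite rpredD ?rpredZ.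
Qed.
Definition inter V (A B : submodClosed V) : {pred submod A} :=
  [pred v : submod A | val v \in B].
Arguments inter {V} A B.
HB.instance Definition _ V (A B : submodClosed V) :=
  GRing.isSubmodClosed.Build R (submod A) (inter A B) (@inter_closed V A B).
Definition subquo V (A B : submodClosed V) : lmodType R := quo (inter A B).

Definition is_nonzero V (A : submodClosed V) := exists2 v, v \in A & v != 0.
Definition is_proper V (A : submodClosed V) := exists v, v \notin A.

Definition simple_module V : Prop :=
  (exists v : V, v != 0) /\
  forall A : submodClosed V, is_nonzero A -> ~ is_proper A.

Definition maximal V (A : submodClosed V) : Prop :=
  is_proper A /\
  forall B : submodClosed V, {subset A <= B} -> is_proper B -> {subset B <= A}.

Definition unique_maximal V (A : submodClosed V) : Prop :=
  maximal A /\ forall B : submodClosed V, maximal B -> B =i A.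

(* The socle is the sum of all simple submodules. *)
Definition socle V : {pred V} :=
  gen [set v : V | exists2 A : submodClosed V, simple_module (submod A) & v \in A].

(* The head is the quotient by the radical, the intersection of all maximal
   submodules. *)
Definition radical V : {pred V} :=
  fun v => `[< forall A : submodClosed V, maximal A -> v \in A >].
Fact radical_closed V : submod_closed (@radical V).
Proof.
split=> [|a u v /asboolP Ru /asboolP Rv]; apply/asboolP => A mA.
  exact: rpred0.
by apply: rpredD; [apply: rpredZ; apply: Ru | apply: Rv].
Qed.
HB.instance Definition _ V :=
  GRing.isSubmodClosed.Build R V (@radical V) (@radical_closed V).
Definition head_module V : lmodType R := quo (@radical V).

(* [V] has a composition series whose factors, up to order and isomorphism,
   are the terms of the family [L]. *)
Definition composition_factors n V (L : 'I_n -> lmodType R) : Prop :=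
  exists (A : nat -> submodClosed V) (s : 'S_n),
    [/\ A 0%N =i pred1 0, A n =i predT,
        forall i : 'I_n, {subset A i <= A i.+1} &
        forall i : 'I_n, simple_module (subquo (A i.+1) (A i))
                      /\ isomorphic (subquo (A i.+1) (A i)) (L (s i))].

End Modules.

Section Verma.
Variable K : fieldType.
Local Notation D := (DD K).

(* A finite-dimensional module over D(S_3), carried by the column vectors. *)
Record dmodule := DModule {
  ddim : nat;
  actg : 'S_3 -> 'M[K]_ddim;
  actd : 'S_3 -> 'M[K]_ddim;
  actg1 : actg 1%g = 1%:M;
  actgM : forall g h, actg (g ** h) = actg g *m actg h;
  actdM : forall g h, actd g *m actd h = if g == h then actd g else 0;
  actd1 : \sum_h actd h = 1%:M;
  actdg : forall g h, actd h *m actg g = actg g *m actd (inv3 g ** h ** g) }.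

(* The module with one basis vector |h> of degree h for each term h of the
   family [d], which enumerates a conjugacy class, and
   g|h> = sgn(g)^b |g h g^-1>. *)
Section ClassModule.
Variables (b : bool) (n : nat) (d : 'I_n -> 'S_3).
Hypothesis d_inj : injective d.
Hypothesis d_conj : forall g i, exists j, d j = conj3 g (d i).

Definition class_g (g : 'S_3) : 'M[K]_n :=
  \matrix_(i, j) ((-1) ^+ (b && odd_perm g) * (d i == conj3 g (d j))%:R).
Definition class_d (h : 'S_3) : 'M[K]_n :=
  \matrix_(i, j) ((i == j) && (d j == h))%:R.

Fact class_g1 : class_g 1%g = 1%:M.
Proof.
apply/matrixP => i j; rewrite !mxE odd_perm1 andbF mul1r.
by rewrite /conj3 /mul3 /inv3 invg1 mul1g mulg1 (inj_eq d_inj).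
Qed.
Fact class_gM g h : class_g (g ** h) = class_g g *m class_g h.
Proof.
apply/matrixP => i j; rewrite !mxE.
have [k dk] := d_conj h j.
rewrite (bigD1 k) //= big1 => [|l lk]; last first.
  by rewrite !mxE -dk (inj_eq d_inj) (negPf lk) !mulr0.
rewrite !mxE dk eqxx mulr1 addr0 mulrAC -signr_addb.
have -> : conj3 g (conj3 h (d j)) = conj3 (g ** h) (d j).
  by rewrite /conj3 /mul3 /inv3 invMg !mulgA.
by rewrite /mul3 odd_permM -andb_addr addbC.
Qed.
Fact class_dM g h :
  class_d g *m class_d h = if g == h then class_d g else 0.
Proof.
apply/matrixP => i j; rewrite !mxE.
rewrite (bigD1 j) //= big1 => [|l lk]; last by rewrite !mxE (negPf lk) mulr0.
rewrite !mxE eqxx addr0 /=; case: (eqVneq g h) => [->|gh].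
  by rewrite !mxE; case: (d j == h); rewrite ?andbF ?mulr0 ?mulr1.
rewrite mxE; case: (eqVneq (d j) h) => [->|_]; last by rewrite mulr0.
by rewrite [h == g]eq_sym (negPf gh) andbF mul0r.
Qed.
Fact class_d1 : \sum_h class_d h = 1%:M.
Proof.
apply/matrixP => i j; rewrite summxE !mxE (bigD1 (d j)) //= big1.
  by rewrite !mxE eqxx andbT addr0.
by move=> h; rewrite mxE eq_sym => /negPf ->; rewrite andbF.
Qed.
Fact class_dg g h :
  class_d h *m class_g g = class_g g *m class_d (inv3 g ** h ** g).
Proof.
apply/matrixP => i j; rewrite !mxE.
rewrite (bigD1 i) //= big1 => [|l]; last first.
  by rewrite !mxE eq_sym => /negPf ->; rewrite mul0r.
rewrite [RHS](bigD1 j) //= [X in _ = _ + X]big1 => [|l lj]; last first.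
  by rewrite !mxE (negPf lj) mulr0.
rewrite !mxE !eqxx !addr0 /= [LHS]mulrCA -[RHS]mulrA; congr (_ * _).
rewrite -!natrM !mulnb andbC; congr (nat_of_bool _)%:R.
case: eqP => //= ->; rewrite /conj3 /mul3 /inv3.
apply/eqP/eqP => [<-|->]; first by rewrite !mulgA mulgV mul1g mulgK.
by rewrite !mulgA mulVg mul1g mulgKV.
Qed.

Definition class_module : dmodule :=
  DModule class_g1 class_gM class_dM class_d1 class_dg.
End ClassModule.


(* M(sigma,-), with basis |12>, |23>, |13>. *)
Definition dsigma (i : 'I_3) : 'S_3 := val (sigtau i).

Fact I3P (i : 'I_3) : [\/ i = p1, i = p2 | i = p3].
Proof.
by case: i => [[|[|[|]]]] // h; [constructor 1|constructor 2|constructor 3];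
  apply: val_inj; rewrite /= inordK.
Qed.
Fact dsigmaE :
  [/\ dsigma p1 = tperm p1 p2, dsigma p2 = tperm p2 p3 & dsigma p3 = tperm p1 p3].
Proof. by rewrite /dsigma !inordK //; case: sigtauE => -> -> ->. Qed.
Fact dsigma_inj : injective dsigma.
Proof.
have [E1 E2 E3] := dsigmaE.
have e2 : tperm p2 p3 p1 = p1 by rewrite tpermD // eq_sym ?p12 ?p13.
have n12 := negPf p12; have n13 := negPf p13; have n23 := negPf p23.
move=> i j; case: (I3P i) => ->; case: (I3P j) => ->;
  rewrite ?E1 ?E2 ?E3 // => /permP /(_ p1) /eqP;
  by rewrite ?tpermL ?e2 ?n12 ?n13 ?n23 // eq_sym ?n12 ?n13 ?n23.
Qed.
Fact dsigma_conj g i : exists j, dsigma j = conj3 g (dsigma i).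
Proof.
have [E1 E2 E3] := dsigmaE.
have tE x y : x != y -> exists j, dsigma j = tperm x y.
  case: (I3P x) => ->; case: (I3P y) => ->; rewrite ?eqxx // => _;
  by [exists p1|exists p2|exists p3|exists p1; rewrite tpermC
     |exists p2; rewrite tpermC|exists p3; rewrite tpermC].
have cE x y : conj3 g (tperm x y) = tperm (g x) (g y).
  by rewrite -tpermJ conjgE.
by case: (I3P i) => ->; rewrite ?E1 ?E2 ?E3 cE; apply: tE;
  rewrite (inj_eq perm_inj) ?p12 ?p23 ?p13.
Qed.
Definition Msigma : dmodule := class_module true dsigma_inj dsigma_conj.

(* M(tau,0), with basis |tau>, |tau^-1>. *)
Definition dtau (i : 'I_2) : 'S_3 := if i == 0 then tau else inv3 tau.

Fact I2P (i : 'I_2) : i = 0 \/ i = 1.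
Proof. by case: i => [[|[|]]] // ?; [left|right]; apply: val_inj. Qed.
Fact dtau_inj : injective dtau.
Proof.
have tN : tau <> inv3 tau.
  move/(congr1 (fun s : 'S_3 => (tau ** s) 0)).
  by rewrite /mul3 /inv3 mulVg perm1 permM !permE => /(congr1 val).
by move=> i j; case: (I2P i) => ->; case: (I2P j) => ->; rewrite /dtau //= => /esym.
Qed.
Fact dtau_conj g i : exists j, dtau j = conj3 g (dtau i).
Proof.
have key : exists j, dtau j = conj3 g tau.
  have g_inj := @perm_inj _ g.
  have z3 : 1 + (1 + 1) = 0 :> 'I_3 by apply: val_inj.
  have n01 : g 0 != g 1 by rewrite (inj_eq g_inj).
  have n12 : g 1 != g (1 + 1) by rewrite (inj_eq g_inj).
  have n02 : g 0 != g (1 + 1) by rewrite (inj_eq g_inj).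
  pose up := [&& g 1 == 1 + g 0, g (1 + 1) == 1 + g 1 & g 0 == 1 + g (1 + 1)].
  pose dn := [&& g 0 == 1 + g 1, g 1 == 1 + g (1 + 1) & g (1 + 1) == 1 + g 0].
  have /orP[/and3P[/eqP u0 /eqP u1 /eqP u2]|/and3P[/eqP u0 /eqP u1 /eqP u2]] : up || dn.
    rewrite /up /dn; move: n01 n12 n02.
    by case: (g 0) => [[|[|[|]]] ?] //; case: (g 1) => [[|[|[|]]] ?] //;
       case: (g (1 + 1)) => [[|[|[|]]] ?].
  - exists 0; rewrite /dtau eqxx; apply: (mulgI g); rewrite /conj3 /mul3 /inv3 mulKVg.
    apply/permP => k; rewrite !permM !permE.
    have : [\/ k = 0, k = 1 | k = 1 + 1].
      by case: k => [[|[|[|]]]] // h; [constructor 1|constructor 2|constructor 3]; apply: val_inj.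
    by case=> ->; [rewrite addr0 u0|rewrite u1|rewrite z3 u2].
  - exists 1; rewrite /dtau /=; apply: (mulgI g); rewrite /conj3 /mul3 /inv3 mulKVg.
    apply: (mulIg tau); rewrite mulgKV.
    apply/permP => k; rewrite !permM !permE.
    have : [\/ k = 0, k = 1 | k = 1 + 1].
      by case: k => [[|[|[|]]]] // h; [constructor 1|constructor 2|constructor 3]; apply: val_inj.
    by case=> ->; [rewrite addr0 -u0|rewrite -u1|rewrite z3 -u2].
have conjV (s : 'S_3) : conj3 g (inv3 s) = inv3 (conj3 g s).
  by rewrite /conj3 /mul3 /inv3 !invMg invgK !mulgA.
case: key => j Ej; case: (I2P i) => ->; first by exists j.
case: (I2P j) Ej => -> Ej; [exists 1|exists 0];
  by rewrite [RHS]conjV -Ej /dtau /= /inv3 ?invgK.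
Qed.
Definition Mtau : dmodule := class_module false dtau_inj dtau_conj.

(* M(e,rho): the permutation action on the vectors of K^3 with coordinate sum
   zero, in the basis e_1 - e_3, e_2 - e_3, concentrated in degree e. *)
Definition w2 (k : 'I_2) : 'I_3 := widen_ord (leqnSn 2) k.
Definition rho_g (g : 'S_3) : 'M[K]_2 :=
  \matrix_(k, j) ((g (w2 j) == w2 k)%:R - (g ord_max == w2 k)%:R).
Definition rho_d (h : 'S_3) : 'M[K]_2 := if h == 1%g then 1%:M else 0.

Fact rho_g1 : rho_g 1%g = 1%:M.
Proof.
apply/matrixP => i j; rewrite !mxE !perm1.
by case: (I2P i) => ->; case: (I2P j) => ->; rewrite /= subr0.
Qed.
Fact rho_gM g h : rho_g (g ** h) = rho_g g *m rho_g h.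
Proof.
apply/matrixP => k j; rewrite !mxE /mul3 !permM.
pose F (a : 'I_3) : K := (g a == w2 k)%:R - (g ord_max == w2 k)%:R.
have sumF b : \sum_a F a * (b == a)%:R = F b.
  rewrite (bigD1 b) //= eqxx mulr1 big1 ?addr0 // => a.
  by rewrite eq_sym => /negPf ->; rewrite mulr0.
transitivity (\sum_a F a * ((h (w2 j) == a)%:R - (h ord_max == a)%:R)).
  under eq_bigr do rewrite mulrBr.
  by rewrite sumrB !sumF /F opprB addrA subrK.
rewrite big_ord_recr /= {2}/F subrr mul0r addr0.
by apply: eq_bigr => l _; rewrite !mxE.
Qed.
Fact rho_dM g h : rho_d g *m rho_d h = if g == h then rho_d g else 0.
Proof.
rewrite /rho_d; case: (eqVneq g h) => [->|gh].
  by case: eqP => _; rewrite ?mulmx1 ?mulmx0.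
case: (eqVneq g 1%g) => [E|_]; last by rewrite mul0mx.
by rewrite E eq_sym in gh; rewrite (negPf gh) mulmx0.
Qed.
Fact rho_d1 : \sum_h rho_d h = 1%:M.
Proof.
rewrite (bigD1 1%g) //= /rho_d eqxx big1 ?addr0 // => h.
by move=> /negPf ->.
Qed.
Fact rho_dg g h : rho_d h *m rho_g g = rho_g g *m rho_d (inv3 g ** h ** g).
Proof.
rewrite /rho_d.
have -> : (inv3 g ** h ** g == 1%g) = (h == 1%g).
  rewrite /mul3 /inv3; apply/eqP/eqP => [E|->]; last by rewrite mul1g mulgV.
  by apply: (mulIg g^-1%g); apply: (mulgI g); rewrite E mul1g mulgV.
by case: eqP => _; rewrite ?mulmx1 ?mul1mx ?mul0mx ?mulmx0.
Qed.
Definition Merho : dmodule := DModule rho_g1 rho_gM rho_dM rho_d1 rho_dg.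

(* The graph of the representation of D^{>=0} on [W] with the [yy t] acting
   by zero: D^{>=0} consists of the first components. *)
Inductive acts (W : dmodule) : D -> 'M[K]_(ddim W) -> Prop :=
| acts_scalar c : acts (c%:A) (c%:M)
| acts_g g : acts (gg K g) (actg W g)
| acts_d h : acts (dd K h) (actd W h)
| acts_y t : acts (yy K t) 0
| acts_add a b A B : acts a A -> acts b B -> acts (a + b) (A + B)
| acts_mul a b A B : acts a A -> acts b B -> acts (a * b) (A *m B).

(* D (x)_K W is the free left D-module of rank dim W, and d (x) m is [tens]. *)
Definition tens (W : dmodule) (d : D) (m : 'cV[K]_(ddim W)) : 'rV[D]_(ddim W) :=
  \row_j (m j 0 *: d).
Definition verma_rel (W : dmodule) : set 'rV[D]_(ddim W) :=
  [set r | exists d a A m,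
     acts a A /\ r = tens (d * a) m - tens d (A *m m)].
Definition Verma (W : dmodule) : lmodType D := quo (gen (verma_rel (W := W))).
Definition vt (W : dmodule) (d : D) (m : 'cV[K]_(ddim W)) : Verma W :=
  qpi (gen (verma_rel (W := W))) (tens d m).

Definition L (W : dmodule) : lmodType D := head_module (Verma W).

(* The piece of degree -n, that is B^n(V) (x) W. *)
Definition Verma_deg (W : dmodule) (n : nat) : set (Verma W) :=
  [set v | exists s : seq (n.-tuple transp * 'cV[K]_(ddim W)),
     v = \sum_(p <- s) vt (\prod_(t <- p.1) xx K t) p.2].

Section Submodules.
(* A scalar [c] of [K] acts on a D-module as [c%:A]. *)
Variable V : lmodType D.

Definition kspan n (b : 'I_n -> V) : set V :=
  [set v | exists c : 'I_n -> K, v = \sum_i (c i)%:A *: b i].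
Definition kfree n (b : 'I_n -> V) : Prop :=
  forall c : 'I_n -> K, \sum_i (c i)%:A *: b i = 0 -> forall i, c i = 0.

(* [N] is a D(S_3)-submodule of [V] isomorphic to [W]. *)
Definition has_weight (W : dmodule) (N : set V) : Prop :=
  exists f : 'cV[K]_(ddim W) -> V,
    [/\ forall c m m', f (c *: m + m') = c%:A *: f m + f m',
        forall g m, f (actg W g *m m) = gg K g *: f m,
        forall h m, f (actd W h *m m) = dd K h *: f m,
        injective f & N = range f].

(* [A] is a highest-weight module of weight [W], generated by its
   D(S_3)-submodule [N] of highest weight. *)
Definition highest_weight (W : dmodule) (N : set V) (A : submodClosed V) : Prop :=
  [/\ has_weight W N, forall t v, N v -> yy K t *: v = 0 & A =i gen N].

End Submodules.

Local Notation x_ := (xx K).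

Definition ket_tau : Verma Mtau := vt (W := Mtau) 1 (delta_mx 0 0).
Definition ket_tauV : Verma Mtau := vt (W := Mtau) 1 (delta_mx 1 0).

Definition jvec (i : 'I_3) : Verma Mtau :=
  ((1 - gg K (val (sigtau i))) * x_ (sigtau (i + 2)%N)) *: ket_tau.
Definition J : set (Verma Mtau) := kspan jvec.

Definition gvec (zeta : K) : Verma Mtau :=
    (x_ t13 * x_ t23 - zeta ^+ 2 *: (x_ t12 * x_ t13)) *: ket_tau
  + (x_ t13 * x_ t12 - zeta ^+ 2 *: (x_ t12 * x_ t23)) *: ket_tauV.
Definition gbasis (zeta : K) (i : 'I_2) : Verma Mtau :=
  if i == 0 then gvec zeta else gg K sigma *: gvec zeta.
Definition G (zeta : K) : set (Verma Mtau) := kspan (gbasis zeta).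

End Verma.

Arguments J : clear implicits.
Arguments G {K} zeta _.
Arguments jvec : clear implicits.
Arguments gbasis {K} zeta _.

(* Main.v *)
(* Moving the y's to the right shows that a Verma module is spanned by the words
   in the x's applied to its top.  Words of length 5 vanish, so that by Nakayama
   every proper submodule lies in negative degrees; hence there is a greatest
   proper submodule, and L(W) is isomorphic to every simple subquotient that is
   generated by a highest-weight copy of W.

   The module M(tau,0) maps onto a module given by integral matrices that satisfy
   the defining relations of D, and 24 words that span it go to independent
   vectors, so that this map is bijective.  Let A be a submodule of M(tau,0).
   If A is nonzero, then the x's carry some element of A to a nonzero vector that
   all x's kill; such vectors have degree -4, and each of them generates S(tau,0).
   If A contains S(tau,0) and an element of X(tau,0) outside S(tau,0), then modulo
   S(tau,0) the y's carry it to a nonzero vector of X(tau,0) that all y's kill;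
   such vectors lie in J, and each of them generates X(tau,0) modulo S(tau,0).
   If A is not contained in X(tau,0), then modulo X(tau,0) the y's carry some
   element of A to a nonzero vector of the top, whence A is M(tau,0). *)
From HB Require Import structures.
Require Import Defs.
From mathcomp Require Import all_boot all_order all_fingroup all_algebra.
From mathcomp Require Import boolp classical_sets ring.

Set Implicit Arguments.
Unset Strict Implicit.
Unset Printing Implicit Defensive.

Import GRing.Theory.
Local Open Scope ring_scope.

Local Notation repr := generic_quotient.repr.

(** * Submodules and subquotients *)

Section Submodules.
Variable R : nzRingType.
Implicit Types V U : lmodType R.

(** [DD K] is a quotient by a congruence that evaluation cannot decide, so nothing can be computed
    directly in D or in its Verma modules. The dimension 24 is therefore pinched: normal words bound
    it from above, a matrix representation from below. The study of submodules is then reduced to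
    two finite questions about integral matrices: which coordinates of a vector must vanish, and
    which basis vectors a submodule must contain. Both are settled by solving for one unknown at a
    time with a nonzero integer as pivot, which is invertible in characteristic zero. The basis is
    rational: zeta is absent from the matrices and enters only through the 2 by 2 matrix that
    expresses g and sigma g in two vectors of that basis. *)

Lemma asbool_submod_closed V (P : V -> Prop) :
  P 0 -> (forall a u v, P u -> P v -> P (a *: u + v)) ->
  submod_closed (fun v => `[< P v >]).
Proof.
move=> P0 PD; split=> [|a u v /asboolP Pu /asboolP Pv]; apply/asboolP => //.
exact: PD.
Qed.

Lemma ex_submod V (P : V -> Prop) :
  P 0 -> (forall a u v, P u -> P v -> P (a *: u + v)) ->
  exists A : submodClosed V, forall v, v \in A <-> P v.
Proof.
move=> P0 PD; have cl := asbool_submod_closed P0 PD.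
pose p : {pred V} := fun v => `[< P v >].
pose A : submodClosed V := HB.pack p (GRing.isSubmodClosed.Build R V p cl).
by exists A => v; split=> /asboolP.
Qed.

Lemma in_gen V (S : set V) s : S s -> s \in gen S.
Proof. by move=> Ss; apply/asboolP => A; apply. Qed.

Lemma gen_sub V (S : set V) (A : submodClosed V) :
  (forall s, S s -> s \in A) -> {subset gen S <= A}.
Proof. by move=> SA v /asboolP; apply. Qed.

Lemma gen_ind V (S : set V) (P : V -> Prop) :
  P 0 -> (forall a u v, P u -> P v -> P (a *: u + v)) ->
  (forall s, S s -> P s) -> forall v, v \in gen S -> P v.
Proof.
move=> P0 PD PS v; have [A AE] := ex_submod P0 PD.
by move/(@gen_sub V S A) => vA; apply/AE/vA => s /PS /AE.
Qed.

(** The preimage in [V] of a submodule of the subquotient lies between [B] and [A], so simplicity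
    can be tested on submodules of [V] alone. *)
Lemma subquo_simple V (A B : submodClosed V) :
  {subset B <= A} -> ~ {subset A <= B} ->
  (forall C : submodClosed V, {subset B <= C} -> {subset C <= A} ->
     ~ {subset C <= B} -> {subset A <= C}) ->
  simple_module (subquo A B).
Proof.
move=> BA AB CP; pose q := @qpi R (submod A) (@inter R V A B).
have q0 a : (q a = 0) <-> (val a \in B).
  by rewrite -[0]/(q 0) qpiE subr0.
split.
  apply: contra_notP AB => /forallNP h v vA.
  by have /negP/negPn/eqP/q0 := h (q (Sub v vA)); rewrite SubK.
move=> C [c cC c0] [v vC]; apply: (negP vC) => {vC}.
pose P w := exists2 a : submod A, val a = w & q a \in C.
have PB w : w \in B -> P w.
  move=> wB; exists (Sub w (BA _ wB)); first by rewrite SubK.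
  have /q0 -> : val (Sub w (BA _ wB) : submod A) \in B by rewrite SubK.
  exact: rpred0.
have [|a u w|E EP] := @ex_submod V P; first by apply/PB/rpred0.
  move=> [u' <- uC] [w' <- wC]; exists (a *: u' + w'); first by rewrite linearP.
  by rewrite /q qpiD qpiZ; apply: rpredD => //; apply: rpredZ.
have AE : {subset A <= E}.
  apply: CP.
  - by move=> w /PB /EP.
  - by move=> w /EP [a <- _]; apply: valP.
  - elim/qpiP: c cC c0 => c cC c0 /(_ (val c)) h.
    by apply: (negP c0); apply/eqP/q0/h/EP; exists c.
elim/qpiP: v => v.
have /AE /EP [a av aC] := valP v.
by have -> : v = a by apply: val_inj.
Qed.

(** The isomorphism theorem for [F] as a map of [U] onto [A], with [N] the preimage of [B]. The
    class of an element of [A] is sent to the class of a chosen preimage. *)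
Lemma subquo_iso V U (A B : submodClosed V) (F : {linear U -> V}) (N : submodClosed U) :
  (forall u, F u \in A) -> (forall v, v \in A -> exists u, F u = v) ->
  (forall u, (u \in N) <-> (F u \in B)) ->
  isomorphic (subquo A B) (quo N).
Proof.
move=> FA Fs FN.
have /boolp.choice[h hP] (a : submod A) : exists u, F u = val a by exact: Fs (valP a).
pose q := @qpi R (submod A) (@inter R V A B).
pose f (x : subquo A B) : quo N := qpi N (h (repr x)).
(* Independence of the choices: every preimage of every representative gives the same class. *)
have fq a u : F u = val a -> f (q a) = qpi N u.
  move=> Fu; apply/qpiE/FN; rewrite raddfB /= hP Fu.
  exact: (@qrepr R (submod A) (@inter R V A B) a).
have fl : linear f.
  move=> a; elim/qpiP => u; elim/qpiP => v.
  have -> : a *: qpi (@inter R V A B) u + qpi (@inter R V A B) v = q (a *: u + v).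
    by rewrite /q qpiD qpiZ.
  rewrite (@fq _ (a *: h u + h v)) ?linearP /= ?hP //.
  by rewrite (@fq _ (h u)) ?hP // (@fq _ (h v)) ?hP // qpiD qpiZ.
pose f' : {linear subquo A B -> quo N} := HB.pack f (GRing.isLinear.Build _ _ _ _ f fl).
exists f'.
exists (fun y => q (Sub (F (repr y)) (FA _))).
- elim/qpiP => a; rewrite /= -[qpi _ a]/(q a) (@fq _ (h a)) ?hP //.
  have /FN : repr (qpi N (h a)) - h a \in N by apply: qrepr.
  by rewrite linearB hP => FB; apply/qpiE; rewrite inE linearB.
- elim/qpiP => u; rewrite /= (@fq _ (repr (qpi N u))) //.
  exact: qpi_repr.
Qed.

End Submodules.

(** * The double and its Verma modules *)

Section Relations.
Variable K : fieldType.
Local Notation D := (DD K).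
Local Notation x_ := (xx K).
Local Notation y_ := (yy K).
Local Notation g_ := (gg K).
Local Notation d_ := (dd K).

Lemma cls_rel (u v : expr K) : drel u v -> cls u = cls v.
Proof. by move=> uv; apply/clsE/QRel. Qed.

Lemma cls_add (u v : expr K) : cls (EAdd u v) = cls u + cls v.
Proof. exact: clsD. Qed.

Lemma cls_mul (u v : expr K) : cls (EMul u v) = cls u * cls v.
Proof. exact: clsM. Qed.

Lemma cls_const (c : K) : cls (EC c) = c%:A.
Proof.
have -> : c%:A = DDscale c (cls (EC 1)) by [].
by rewrite -clsZ; apply/clsE/QSym/QMul1r.
Qed.

Lemma cls_opp (u : expr K) : cls (EMul (EC (-1)) u) = - cls u.
Proof. by rewrite cls_mul cls_const scaleN1r mulN1r. Qed.

Definition clsS := (cls_add, cls_opp, cls_mul, cls_const).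

Lemma xx_sq t : x_ t * x_ t = 0.
Proof. by rewrite -cls_mul (cls_rel (RXX K t)). Qed.

Lemma xx_quad i j k (ij : i != j) (ik : i != k) (jk : j != k) :
  x_ (tr ij) * x_ (tr ik) + x_ (tr jk) * x_ (tr ij) + x_ (tr ik) * x_ (tr jk) = 0.
Proof. by have := cls_rel (RXquad K ij ik jk); rewrite !cls_add !cls_mul. Qed.

Lemma gg_xx g t : g_ g * x_ t = (-1) ^+ odd_perm g *: (x_ (conjT g t) * g_ g).
Proof.
rewrite -cls_mul (cls_rel (RGX K g t)) !clsS.
by rewrite -mulrA mulr_algl.
Qed.

Lemma dd_xx h t : d_ h * x_ t = x_ t * d_ (val t ** h).
Proof. by rewrite -!cls_mul (cls_rel (RDX K h t)). Qed.

Lemma yy_xx_diag t :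
  y_ t * x_ t = - (x_ t * y_ t) + (1 + g_ (val t) * (d_ (val t) - d_ 1%g)).
Proof.
have := cls_rel (RYXdiag K t); rewrite !clsS scale1r => <-.
by rewrite addrCA addNr addr0.
Qed.

Lemma yy_xx i j k (ij : i != j) (ik : i != k) (jk : j != k) :
  y_ (tr ik) * x_ (tr ij) = - (x_ (tr ij) * y_ (tr jk)) +
    g_ (val (tr ij)) * (d_ (val (tr ik)) - d_ (val (tr ik) ** val (tr ij))).
Proof.
have := cls_rel (RYX K ij ik jk); rewrite !clsS => <-.
by rewrite addrCA addNr addr0.
Qed.

Lemma D_ind (P : D -> Prop) :
  (forall t, P (x_ t)) -> (forall t, P (y_ t)) -> (forall g, P (g_ g)) ->
  (forall h, P (d_ h)) -> (forall c, P c%:A) ->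
  (forall a b, P a -> P b -> P (a + b)) -> (forall a b, P a -> P b -> P (a * b)) ->
  forall a, P a.
Proof.
move=> PX PY PG PD PC Padd Pmul; elim/clsP; elim.
- exact: PX.
- exact: PY.
- exact: PG.
- exact: PD.
- by move=> c; rewrite cls_const.
- by move=> u Pu v Pv; rewrite cls_add; apply: Padd.
- by move=> u Pu v Pv; rewrite cls_mul; apply: Pmul.
Qed.

Lemma scal_comm (V : lmodType D) (c : K) (a : D) (v : V) : c%:A *: (a *: v) = a *: (c%:A *: v).
Proof. by rewrite !scalerA mulr_algl mulr_algr. Qed.

End Relations.

Section VermaTheory.
Variables (K : fieldType) (W : dmodule K).
Local Notation D := (DD K).
Local Notation cV := 'cV[K]_(ddim W).
Implicit Types (m : cV) (d : D).

Lemma vt_scale a d m : vt (a * d) m = a *: vt d m.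
Proof.
rewrite -[RHS]qpiZ; congr qpi; apply/rowP => j.
by rewrite !mxE -scalerAr.
Qed.

Lemma vtE d m : vt d m = d *: vt 1 m.
Proof. by rewrite -vt_scale mulr1. Qed.

Lemma vt_lin (d : D) (c : K) m m' : vt d (c *: m + m') = c%:A *: vt d m + vt d m'.
Proof.
rewrite -vt_scale -[RHS]qpiD; congr qpi; apply/rowP => j.
by rewrite !mxE mulr_algl scalerDl scalerA mulrC.
Qed.

Lemma vt0 d : vt (W := W) d 0 = 0.
Proof. by have := vt_lin d 1 0 0; rewrite !scale1r addr0 -{1}[vt d 0]addr0 => /addrI. Qed.

Lemma vtD d m m' : vt d (m + m') = vt d m + vt d m'.
Proof. by have := vt_lin d 1 m m'; rewrite !scale1r. Qed.

Lemma vtZ d (c : K) m : vt d (c *: m) = c%:A *: vt d m.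
Proof. by have := vt_lin d c m 0; rewrite vt0 !addr0. Qed.

Lemma vt_sum d (I : Type) (r : seq I) (F : I -> cV) :
  vt d (\sum_(i <- r) F i) = \sum_(i <- r) vt d (F i).
Proof. exact: (big_morph _ (vtD d) (vt0 d)). Qed.

Lemma vt_acts a A d m : acts a A -> vt (d * a) m = vt d (A *m m).
Proof. by move=> aA; apply/qpiE; apply: in_gen; exists d, a, A, m. Qed.

Lemma vt_gg g m : gg K g *: vt 1 m = vt 1 (actg W g *m m).
Proof. by rewrite -vtE -[gg K g]mul1r; apply/vt_acts/acts_g. Qed.

Lemma vt_dd h m : dd K h *: vt 1 m = vt 1 (actd W h *m m).
Proof. by rewrite -vtE -[dd K h]mul1r; apply/vt_acts/acts_d. Qed.

Lemma vt_yy t m : yy K t *: vt (W := W) 1 m = 0.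
Proof. by rewrite -vtE -[yy K t]mul1r (vt_acts _ _ (acts_y W t)) mul0mx vt0. Qed.

Lemma qpi_vt (r : 'rV[D]_(ddim W)) :
  qpi (gen (verma_rel (W := W))) r = \sum_j r 0 j *: vt 1 (delta_mx j 0) :> Verma W.
Proof.
rewrite [r in LHS]row_sum_delta.
rewrite (big_morph _ (@qpiD _ _ _) (erefl : qpi (gen (verma_rel (W := W))) 0 = 0)).
apply: eq_bigr => j _; rewrite -vtE; congr qpi; apply/rowP => i.
rewrite !mxE !eqxx /= eq_sym.
by case: (_ == _); rewrite ?mulr1 ?scale1r ?mulr0 ?scale0r.
Qed.

(** Frobenius reciprocity: [f] commutes with D^{>=0}, by induction on [acts], so its extension to
    the free module kills [verma_rel] and descends. *)
Lemma verma_univ (U : lmodType D) (f : cV -> U) :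
  (forall c m m', f (c *: m + m') = c%:A *: f m + f m') ->
  (forall g m, f (actg W g *m m) = gg K g *: f m) ->
  (forall h m, f (actd W h *m m) = dd K h *: f m) ->
  (forall t m, yy K t *: f m = 0) ->
  exists F : {linear Verma W -> U}, forall d m, F (vt d m) = d *: f m.
Proof.
move=> fl fg fd fy.
have f0 : f 0 = 0.
  by have := fl 1 0 0; rewrite !scale1r addr0 -{1}[f 0]addr0 => /addrI.
have fD m m' : f (m + m') = f m + f m' by have := fl 1 m m'; rewrite !scale1r.
have fZ c m : f (c *: m) = c%:A *: f m by have := fl c m 0; rewrite f0 !addr0.
have fa a A : acts a A -> forall m, f (A *m m) = a *: f m.
  elim=> {a A} [c|g|h|t|a b A B _ IHa _ IHb|a b A B _ IHa _ IHb] m //.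
  - by rewrite mul_scalar_mx fZ.
  - by rewrite mul0mx fy f0.
  - by rewrite mulmxDl fD IHa IHb scalerDl.
  - by rewrite -mulmxA IHa IHb scalerA.
pose p (r : 'rV[D]_(ddim W)) : U := \sum_j r 0 j *: f (delta_mx j 0).
have pl a r s : p (a *: r + s) = a *: p r + p s.
  rewrite /p scaler_sumr -big_split /=; apply: eq_bigr => j _.
  by rewrite !mxE scalerDl scalerA.
have pt d m : p (tens d m) = d *: f m.
  rewrite {2}[m]matrix_sum_delta exchange_big big_ord1 /=.
  rewrite (big_morph f fD f0) scaler_sumr; apply: eq_bigr => j _.
  by rewrite mxE fZ scalerA mulr_algr.
have p0 r : r \in gen (verma_rel (W := W)) -> p r = 0.
  move: r; apply: (@gen_ind _ _ _ (fun r => p r = 0)) => [|a u v pu pv|_ [d [a [A [m [aA ->]]]]]].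
  - by rewrite /p big1 // => j _; rewrite mxE scale0r.
  - by rewrite pl pu pv scaler0 addr0.
  - by rewrite addrC -scaleN1r pl !pt (fa _ _ aA) -(scalerA d a) scaleN1r addNr.
pose F (v : Verma W) : U := p (repr v).
have Fq r : F (qpi _ r) = p r.
  apply/eqP; rewrite -subr_eq0 -scaleN1r addrC -pl; apply/eqP/p0.
  by rewrite scaleN1r addrC qrepr.
have Fl : linear F.
  move=> a; elim/qpiP => r; elim/qpiP => s.
  by rewrite -[a *: _]qpiZ -[_ + _]qpiD !Fq pl.
pose F' : {linear Verma W -> U} := HB.pack F (GRing.isLinear.Build _ _ _ _ F Fl).
exists F'.
by move=> d m /=; rewrite -[F]/F Fq pt.
Qed.

End VermaTheory.

(** * Permutations of three points and words in the Fomin-Kirillov algebra *)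

(** One-line notation on the points 0, 1, 2. Lists evaluate whereas permutations do not, so a
    property of all permutations becomes a boolean check over [codes]. *)
Definition pcode (g : 'S_3) : seq nat := [seq val (g i) | i <- enum 'I_3].
Definition cmul (s r : seq nat) : seq nat := [seq nth 0%N s i | i <- r].
Definition cinv (s : seq nat) : seq nat := [seq index i s | i <- iota 0 3].
Definition cconj (s r : seq nat) : seq nat := cmul (cmul s r) (cinv s).
Definition ctperm (i j : nat) : seq nat :=
  [seq if k == i then j else if k == j then i else k | k <- iota 0 3].
(** The order is 1, tau, tau^2, and sigma, sigma tau, sigma tau^2 in [oddc]; the matrix lists [Gs],
    [Xs], [Ys] and the index of [sigtau] agree with it. *)
Definition evenc : seq (seq nat) := [:: [:: 0; 1; 2]; [:: 1; 2; 0]; [:: 2; 0; 1]]%N.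
Definition oddc : seq (seq nat) := [:: [:: 1; 0; 2]; [:: 0; 2; 1]; [:: 2; 1; 0]]%N.
Definition codes : seq (seq nat) := evenc ++ oddc.

Lemma nth_pcode g (i : 'I_3) : nth 0%N (pcode g) i = g i.
Proof. by rewrite (nth_map i) ?size_enum_ord // nth_ord_enum. Qed.

Lemma pcodeM g h : pcode (g ** h) = cmul (pcode g) (pcode h).
Proof.
rewrite /cmul -map_comp; apply: eq_map => i /=.
by rewrite nth_pcode /mul3 permM.
Qed.

Lemma pcodeV g : pcode (inv3 g) = cinv (pcode g).
Proof.
rewrite /cinv -val_enum_ord -map_comp; apply: eq_map => i /=.
have gI : injective (fun j => val (g j)) by move=> j k /val_inj /perm_inj.
have -> : val i = (fun j => val (g j)) (g^-1%g i) by rewrite /= permKV.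
by rewrite (index_map gI) index_enum_ord.
Qed.

Lemma pcode_conj g h : pcode (conj3 g h) = cconj (pcode g) (pcode h).
Proof. by rewrite /conj3 !pcodeM pcodeV. Qed.

Lemma pcode_inj : injective pcode.
Proof.
move=> g h gh; apply/permP => i; apply: val_inj.
by rewrite -[LHS]nth_pcode gh nth_pcode.
Qed.

Lemma pcode1 : pcode 1%g = [:: 0; 1; 2]%N.
Proof.
rewrite -[RHS](val_enum_ord 3); apply: eq_map => i /=.
by rewrite perm1.
Qed.

Lemma pcode_tperm (i j : 'I_3) : pcode (tperm i j) = ctperm i j.
Proof.
rewrite /ctperm -val_enum_ord -map_comp; apply: eq_map => k /=.
by rewrite permE /= -!val_eqE; case: ifP => // _; case: ifP.
Qed.

Lemma pcode_tau : pcode tau = [:: 1; 2; 0]%N.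
Proof.
rewrite -[RHS]/[seq (i.+1 %% 3)%N | i <- iota 0 3] -val_enum_ord -map_comp.
by apply: eq_map => i /=; rewrite permE /= add1n.
Qed.

Lemma pcode_t12 : pcode (val t12) = [:: 1; 0; 2]%N.
Proof. by rewrite pcode_tperm !inordK. Qed.
Lemma pcode_t23 : pcode (val t23) = [:: 0; 2; 1]%N.
Proof. by rewrite pcode_tperm !inordK. Qed.
Lemma pcode_t13 : pcode (val t13) = [:: 2; 1; 0]%N.
Proof. by rewrite pcode_tperm !inordK. Qed.

Lemma pcode_codes g : pcode g \in codes.
Proof.
have := @perm_inj _ g; move: (erefl (pcode g)); rewrite {1}/pcode.
have -> : enum 'I_3 = [:: p1; p2; p3].
  by apply: (inj_map val_inj); rewrite val_enum_ord /= !inordK.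
move=> <- gI; rewrite /=.
have : val (g p1) != val (g p2) by rewrite val_eqE (inj_eq gI) p12.
have : val (g p1) != val (g p3) by rewrite val_eqE (inj_eq gI) p13.
have : val (g p2) != val (g p3) by rewrite val_eqE (inj_eq gI) p23.
by case: (g p1) => [[|[|[|?]]] ?] //; case: (g p2) => [[|[|[|?]]] ?] //;
  case: (g p3) => [[|[|[|?]]] ?].
Qed.

Lemma pcode_odd g : odd_perm g = (pcode g \in oddc).
Proof.
have Et h : pcode g = pcode h -> odd_perm g = odd_perm h by move/pcode_inj->.
have := pcode_codes g; rewrite !inE.
case/or4P=> [/eqP E|/eqP E|/eqP E|/or3P[] /eqP E]; rewrite E.
- by rewrite (Et 1%g) ?odd_perm1 // E pcode1.
- by rewrite (Et tau) ?odd_tau // E pcode_tau.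
- by rewrite (Et (inv3 tau)) ?odd_permV ?odd_tau // E pcodeV pcode_tau.
- by rewrite (Et (val t12)) ?(valP t12) // E pcode_t12.
- by rewrite (Et (val t23)) ?(valP t23) // E pcode_t23.
- by rewrite (Et (val t13)) ?(valP t13) // E pcode_t13.
Qed.

Lemma transpP (t : transp) : [\/ t = t12, t = t23 | t = t13].
Proof.
have := valP t; rewrite /= pcode_odd !inE -pcode_t12 -pcode_t23 -pcode_t13.
by case/or3P=> /eqP /pcode_inj E; [constructor 1|constructor 2|constructor 3];
  apply: val_inj.
Qed.

Lemma sigtau_mod3 i : sigtau (i %% 3) = sigtau i.
Proof.
have tau3 : (tau ^+ 3)%g = 1%g.
  by apply: pcode_inj; rewrite pcode1 !expgS expg0 mulg1 -[(_ * _)%g]/(tau ** tau ** tau)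
     !pcodeM pcode_tau.
apply: val_inj; rewrite /= {2}(divn_eq i 3) mulnC expgD expgM tau3.
by rewrite (expg1n _ (i %/ 3)) mul1g.
Qed.

Lemma transp_sigtau (t : transp) : exists2 i, (i < 3)%N & t = sigtau i.
Proof.
have [E0 E1 E2] := sigtauE.
by case: (transpP t) => ->; [exists 0%N|exists 1%N|exists 2%N].
Qed.

(** * Normal words in the Fomin-Kirillov algebra *)

Section Words.
Variable K : fieldType.
Local Notation D := (DD K).
Local Notation x_ := (xx K).
Local Notation y_ := (yy K).
Local Notation a := (x_ t12).
Local Notation b := (x_ t23).
Local Notation c := (x_ t13).

Fact p21 : p2 != p1. Proof. by rewrite eq_sym p12. Qed.
Fact p32 : p3 != p2. Proof. by rewrite eq_sym p23. Qed.
Fact p31 : p3 != p1. Proof. by rewrite eq_sym p13. Qed.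

Lemma trC i j (ij : i != j) (ji : j != i) : tr ij = tr ji.
Proof. by apply: val_inj; rewrite /= tpermC. Qed.

(** The common shape of all relations between a y and an x, which is all that moving the y's to the
    right requires. *)
Lemma yy_xx_ex s t : exists s' e g h h',
  y_ s * x_ t = - (x_ t * y_ s') + ((nat_of_bool e)%:R + gg K g * (dd K h - dd K h')).
Proof.
have [->|st] := eqVneq s t.
  by exists t, true, (val t), (val t), 1%g; rewrite yy_xx_diag.
suff [s' [g [h [h' E]]]] : exists s' g h h',
    y_ s * x_ t = - (x_ t * y_ s') + gg K g * (dd K h - dd K h').
  by exists s', false, g, h, h'; rewrite E /= add0r.
(* [yy_xx] takes the point common to both transpositions as its first index, hence the changes of
   orientation by [trC]. *)
case: (transpP s) (transpP t) st => -> [] ->; rewrite ?eqxx // => _.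
- by rewrite /t12 /t23 (trC p12 p21); do 4 eexists; apply: yy_xx p23 p21 p31.
- by rewrite /t12 /t13; do 4 eexists; apply: (yy_xx K p13 p12 p32).
- by rewrite /t12 /t23 (trC p12 p21); do 4 eexists; apply: (yy_xx K p21 p23 p13).
- by rewrite /t23 /t13 (trC p13 p31) (trC p23 p32); do 4 eexists; apply: (yy_xx K p31 p32 p12).
- by do 4 eexists; apply: (yy_xx K p12 p13 p23).
- by rewrite /t23 /t13 (trC p13 p31) (trC p23 p32); do 4 eexists; apply: (yy_xx K p32 p31 p21).
Qed.

(** The two quadratic relations are oriented so that c moves to the right; the longer rules come
    from their overlaps with the squares and with one another. Products are nested to the right, as
    [foldr] presents words. *)
Lemma fk_aa z : a * (a * z) = 0.
Proof. by rewrite mulrA xx_sq mul0r. Qed.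
Lemma fk_bb z : b * (b * z) = 0.
Proof. by rewrite mulrA xx_sq mul0r. Qed.
Lemma fk_cc : c * c = 0.
Proof. exact: xx_sq. Qed.

Lemma fk_ca : c * a = - (a * b) - b * c.
Proof.
have := xx_quad K p21 p23 p13; rewrite -(trC p12 p21) => E.
by apply: (addrI (a * b)); apply: (addIr (b * c)); rewrite addrA subrr sub0r addNr; apply: E.
Qed.
Lemma fk_cb : c * b = - (b * a) - a * c.
Proof.
have := xx_quad K p23 p21 p31; rewrite -(trC p12 p21) -(trC p13 p31) => E.
by apply: (addrI (b * a)); apply: (addIr (a * c)); rewrite addrA subrr sub0r addNr; apply: E.
Qed.

Lemma fk_cab : c * (a * b) = b * (a * c).
Proof.
rewrite mulrA fk_ca mulrBl mulNr -!mulrA xx_sq mulr0 oppr0 sub0r fk_cb.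
by rewrite mulrBr mulrN fk_bb oppr0 sub0r opprK.
Qed.
Lemma fk_cba : c * (b * a) = a * (b * c).
Proof.
rewrite mulrA fk_cb mulrBl mulNr -!mulrA xx_sq mulr0 oppr0 sub0r fk_ca.
by rewrite mulrBr mulrN fk_aa oppr0 sub0r opprK.
Qed.
(** The braid relation results from expanding c b b = 0 and reducing c b once more. *)
Lemma fk_bab : b * (a * b) = a * (b * a).
Proof.
have h1 : b * (a * b) = - (a * (c * b)).
  have E : c * b * b = 0 by rewrite -mulrA xx_sq mulr0.
  move/eqP: E; rewrite {1}fk_cb mulrBl mulNr -!mulrA.
  by rewrite addr_eq0 opprK => /eqP <-; rewrite opprK.
by rewrite h1 fk_cb mulrBr mulrN fk_aa subr0 opprK.
Qed.
Lemma fk_caba : c * (a * (b * a)) = - (a * (b * (a * c))).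
Proof.
rewrite -fk_bab mulrA fk_cb mulrBl mulNr -!mulrA.
have -> : c * (a * b) = b * (a * c) by exact: fk_cab.
have -> : b * (a * (a * b)) = 0 by rewrite fk_aa mulr0.
by rewrite oppr0 sub0r.
Qed.
Lemma fk_babc : b * (a * (b * c)) = a * (b * (a * c)).
Proof. by have := congr1 (fun z => z * c) fk_bab; rewrite -!mulrA. Qed.
Lemma fk_cac : c * (a * c) = - (a * (b * c)).
Proof.
have := congr1 (fun z => z * c) fk_ca.
by rewrite mulrBl mulNr -!mulrA fk_cc mulr0 subr0.
Qed.
Lemma fk_cbc : c * (b * c) = - (b * (a * c)).
Proof.
have := congr1 (fun z => z * c) fk_cb.
by rewrite mulrBl mulNr -!mulrA fk_cc mulr0 subr0.
Qed.
Lemma fk_cabc : c * (a * (b * c)) = 0.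
Proof. by have := congr1 (fun z => z * c) fk_cab; rewrite -!mulrA fk_cc !mulr0. Qed.
Lemma fk_cbac : c * (b * (a * c)) = 0.
Proof. by have := congr1 (fun z => z * c) fk_cba; rewrite -!mulrA fk_cc !mulr0. Qed.
Lemma fk_cabac : c * (a * (b * (a * c))) = 0.
Proof.
have := congr1 (fun z => z * c) fk_caba.
by rewrite mulNr -!mulrA fk_cc !mulr0 oppr0.
Qed.
Lemma fk_baba : b * (a * (b * a)) = 0.
Proof. by rewrite -fk_bab fk_bb. Qed.
Lemma fk_babac : b * (a * (b * (a * c))) = 0.
Proof. by have := congr1 (fun z => z * c) fk_baba; rewrite -!mulrA mul0r. Qed.

Definition xword (w : seq nat) : D := \prod_(i <- w) x_ (sigtau i).

(* The relations make the x's generate {1, a, b, ab, ba, aba} {1, c}, the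
   nil-Coxeter algebra of a and b times the span of 1 and c. *)
Definition bwords : seq (seq nat) :=
  [:: [::]; [:: 0]; [:: 1]; [:: 2]; [:: 0; 1]; [:: 1; 0]; [:: 0; 2]; [:: 1; 2];
      [:: 0; 1; 0]; [:: 0; 1; 2]; [:: 1; 0; 2]; [:: 0; 1; 0; 2]]%N.

Definition wspan (k : nat) (d : D) : Prop :=
  exists f : seq nat -> K, d = \sum_(w <- bwords | size w == k) f w *: xword w.

Lemma wspan0 k : wspan k 0.
Proof. by exists (fun=> 0); rewrite big1 // => w _; rewrite scale0r. Qed.

Lemma wspanD k d e : wspan k d -> wspan k e -> wspan k (d + e).
Proof.
move=> [f ->] [g ->]; exists (fun w => f w + g w).
by rewrite -big_split; apply: eq_bigr => w _; rewrite scalerDl.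
Qed.

Lemma wspanZ k (r : K) d : wspan k d -> wspan k (r *: d).
Proof.
move=> [f ->]; exists (fun w => r * f w).
by rewrite scaler_sumr; apply: eq_bigr => w _; rewrite scalerA.
Qed.

Lemma wspanN k d : wspan k d -> wspan k (- d).
Proof. by rewrite -scaleN1r => /(wspanZ (-1)). Qed.

Lemma wspan_xword w : w \in bwords -> wspan (size w) (xword w).
Proof.
move=> wB; exists (fun u => (u == w)%:R).
rewrite -big_filter (bigD1_seq w) ?filter_uniq ?mem_filter ?eqxx //=.
by rewrite ?eqxx scale1r big1 ?addr0 // => u /negPf ->; rewrite scale0r.
Qed.

(** Each letter times each of the twelve normal words is reduced by the rules; these are
    homogeneous, so the length grows by exactly one. *)
Lemma wspan_mul k i d : (i < 3)%N -> wspan k d -> wspan k.+1 (x_ (sigtau i) * d).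
Proof.
have [E0 E1 E2] := sigtauE.
move=> i3 [f ->]; rewrite mulr_sumr big_seq_cond.
elim/big_ind: _ => [|? ?|w /andP[wB /eqP <-]]; [exact: wspan0|exact: wspanD|].
rewrite -scalerAr; apply: wspanZ => {f k}.
have xwE u : xword u = foldr (fun i z => x_ (sigtau i) * z) 1 u.
  by elim: u => [|j u IHu]; rewrite /xword ?big_nil ?big_cons //= -IHu.
have B u : u \in bwords -> wspan (size u) (foldr (fun i z => x_ (sigtau i) * z) 1 u).
  by move/wspan_xword; rewrite xwE.
(* The memberships of all twelve words enter the context in nested form, where the final [by []]
   finds them. *)
have {B} L : all (fun u => `[< wspan (size u) (foldr (fun i z => x_ (sigtau i) * z) 1 u) >]) bwords.
  by apply/allP => u /B /asboolP.
move: L => /=; rewrite !E0 !E1 !E2 !mulr1 andbT.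
do 11![case/andP => /asboolP ?]; move=> /asboolP ?.
have fkE := (fk_aa, fk_bb, xx_sq, mulr0, fk_cac, fk_cbc, fk_cabc, fk_cbac, fk_cabac, fk_cab,
  fk_cba, fk_caba, fk_ca, fk_cb, fk_babac, fk_baba, fk_babc, fk_bab).
rewrite xwE; case: i i3 => [|[|[|//]]] _; rewrite ?E0 ?E1 ?E2; move: wB;
rewrite !inE; do 11?[case/orP]; move=> /eqP -> /=; rewrite ?E0 ?E1 ?E2 ?mulr1 ?fkE;
repeat first [exact: wspan0 | apply: wspanN | apply: wspanD | by []].
Qed.

End Words.

(** * The filtration by word length *)

Section Filtration.
Variables (K : fieldType) (W : dmodule K).
Local Notation D := (DD K).
Local Notation V := (Verma W).
Local Notation x_ := (xx K).
Local Notation xprod s := (\prod_(t <- s) x_ t).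

Lemma wspan_prod (s : seq transp) : wspan (size s) (xprod s).
Proof.
elim: s => [|t s IHs]; first by have := @wspan_xword K [::] isT; rewrite /xword !big_nil.
have [i i3 ->] := transp_sigtau t.
by rewrite big_cons; apply: wspan_mul.
Qed.

(** No normal word is longer than 4, so the sum that expresses the product is empty. *)
Lemma xprod_long (s : seq transp) : (4 < size s)%N -> xprod s = 0.
Proof.
move=> s5; have [f ->] := wspan_prod s.
by rewrite -big_filter; case: (size s) s5 => [|[|[|[|[|k]]]]] // _; rewrite big_nil.
Qed.

(** The degrees -k and below. Scalars are absorbed into the vector [m], so the additive closure is
    already a K-subspace. *)
Inductive low (k : nat) : V -> Prop :=
| low0 : low k 0
| lowD u v of low k u & low k v : low k (u + v)
| low_word s m of (k <= size s)%N : low k (vt (xprod s) m).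

Lemma low_sum k (I : Type) (r : seq I) (P : pred I) (F : I -> V) :
  (forall i, P i -> low k (F i)) -> low k (\sum_(i <- r | P i) F i).
Proof. by move=> FP; elim/big_ind: _ => //; [apply: low0|apply: lowD]. Qed.

Lemma lowZ k (c : K) v : low k v -> low k (c%:A *: v).
Proof.
elim=> {v} [|u v _ cu _ cv|s m ks]; first by rewrite scaler0; apply: low0.
  by rewrite scalerDr; apply: lowD.
by rewrite -vtZ; apply: low_word.
Qed.

Lemma lowN k v : low k v -> low k (- v).
Proof. by move/(lowZ (-1)); rewrite !scaleN1r. Qed.

Lemma low_x k t v : low k v -> low k.+1 (x_ t *: v).
Proof.
elim=> {v} [|u v _ cu _ cv|s m ks]; first by rewrite scaler0; apply: low0.
  by rewrite scalerDr; apply: lowD.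
by have := @low_word k.+1 (t :: s) m ks; rewrite big_cons vt_scale.
Qed.

Lemma low_ket m : low 0 (vt 1 m).
Proof. by have := @low_word 0 [::] m isT; rewrite big_nil. Qed.

Lemma lowW k l v : (l <= k)%N -> low k v -> low l v.
Proof.
move=> lk; elim=> {v} [|u v _ cu _ cv|s m ks]; [exact: low0|exact: lowD|].
by apply: low_word; apply: leq_trans lk ks.
Qed.

Lemma low_gg k g v : low k v -> low k (gg K g *: v).
Proof.
elim=> {v} [|u v _ cu _ cv|s m]; first by rewrite scaler0; apply: low0.
  by rewrite scalerDr; apply: lowD.
elim: s k m => [|t s IHs] [|k] m //= ks.
- by rewrite big_nil vt_gg; apply: low_ket.
- rewrite big_cons vt_scale scalerA gg_xx -mulr_algl -!scalerA.
  by apply/lowZ/(lowW (leq0n 1))/low_x/IHs.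
- rewrite big_cons vt_scale scalerA gg_xx -mulr_algl -!scalerA.
  by apply/lowZ/low_x/IHs.
Qed.

Lemma low_dd k h v : low k v -> low k (dd K h *: v).
Proof.
elim=> {v} [|u v _ cu _ cv|s m]; first by rewrite scaler0; apply: low0.
  by rewrite scalerDr; apply: lowD.
elim: s k h m => [|t s IHs] [|k] h m //= ks.
- by rewrite big_nil vt_dd; apply: low_ket.
- rewrite big_cons vt_scale scalerA dd_xx -!scalerA.
  by apply/(lowW (leq0n 1))/low_x/IHs.
- by rewrite big_cons vt_scale scalerA dd_xx -!scalerA; apply/low_x/IHs.
Qed.

(** Each passage of a y beyond an x leaves shorter words on which D(S_3) acts; a y that arrives at
    the top gives zero. *)
Lemma low_yy t v : low 0 v -> low 0 (yy K t *: v).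
Proof.
elim=> {v} [|u v _ cu _ cv|s m _]; first by rewrite scaler0; apply: low0.
  by rewrite scalerDr; apply: lowD.
elim: s t => [|s0 s IHs] t; first by rewrite big_nil vt_yy; apply: low0.
rewrite big_cons vt_scale scalerA.
have [s' [e [g [h [h' ->]]]]] := yy_xx_ex K t s0.
have ls : low 0 (vt (xprod s) m) by apply: low_word.
rewrite !scalerDl scaleNr -!scalerA scalerBl.
apply: lowD; last apply: lowD.
- by apply/lowN/(lowW (leq0n 1))/low_x/IHs.
- by case: e; rewrite ?scale1r ?scale0r //; apply: low0.
- apply: low_gg; apply: lowD; first exact: low_dd.
  by apply/lowN/low_dd.
Qed.

Lemma low_all v : low 0 v.
Proof.
have lowA a u : low 0 u -> low 0 (a *: u).
  elim/D_ind: a u => [t|t|g|h|c|a b IHa IHb|a b IHa IHb] u l0.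
  - exact/(lowW (leq0n 1))/low_x.
  - exact: low_yy.
  - exact: low_gg.
  - exact: low_dd.
  - exact: lowZ.
  - by rewrite scalerDl; apply: lowD; auto.
  - by rewrite -scalerA; auto.
elim/qpiP: v => r; rewrite qpi_vt; apply: low_sum => j _; apply: lowA.
exact: low_ket.
Qed.

Lemma low_long v : low 5 v -> v = 0.
Proof.
elim=> {v} [//|u v _ -> _ ->|s m s5]; first by rewrite addr0.
by rewrite xprod_long // vtE scale0r.
Qed.

Lemma low_split v : exists m l, low 1 l /\ v = vt 1 m + l.
Proof.
elim: (low_all v) => {v} [|u v _ [m [l [ll ->]]] _ [m' [l' [ll' ->]]]|[|t s] m _].
- by exists 0, 0; rewrite vt0 addr0; split; first exact: low0.
- by exists (m + m'), (l + l'); split; [apply: lowD|rewrite vtD addrACA].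
- by exists m, 0; rewrite big_nil addr0; split; first exact: low0.
- by exists 0, (vt (xprod (t :: s)) m); rewrite vt0 add0r; split; first exact: low_word.
Qed.

(* Nakayama: the x's generate a nilpotent ideal. *)
Lemma nakayama (N : submodClosed V) :
  (forall m, exists2 n, n \in N & low 1 (vt 1 m - n)) -> forall v, v \in N.
Proof.
move=> Ntop v.
have Nword s m : exists2 n, n \in N & low (size s).+1 (vt (xprod s) m - n).
  elim: s => [|t s [n nN ln]]; first by rewrite big_nil; apply: Ntop.
  exists (x_ t *: n); first exact: rpredZ.
  by rewrite big_cons vt_scale -scalerBr; apply: low_x.
have Nlow k u : low k u -> exists2 n, n \in N & low k.+1 (u - n).
  elim=> {u} [|u u' _ [n nN ln] _ [n' nN' ln']|s m ks].
  - by exists 0; rewrite ?rpred0 // subr0; apply: low0.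
  - by exists (n + n'); [apply: rpredD|rewrite opprD addrACA; apply: lowD].
  - have [n nN ln] := Nword s m; exists n => //.
    by apply: lowW ln.
(* The approximation of [v] from [N] improves by one level at a time, and level 5 is zero. *)
have {Nlow} Nk k : exists2 n, n \in N & low k (v - n).
  elim: k => [|k [n nN /Nlow[n' nN' l']]].
    by exists 0; [apply: rpred0|apply: low_all].
  by exists (n + n'); [apply: rpredD|rewrite opprD addrA].
have [n nN /low_long /eqP] := Nk 5; by rewrite subr_eq0 => /eqP ->.
Qed.

Definition dsimple := forall P : 'cV[K]_(ddim W) -> Prop,
  (forall c m m', P m -> P m' -> P (c *: m + m')) ->
  (forall g m, P m -> P (actg W g *m m)) -> (forall h m, P m -> P (actd W h *m m)) ->
  (exists2 m, m != 0 & P m) -> forall m, P m.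

Hypothesis Wsimple : dsimple.

(** Modulo [low 1], the elements of [N] cut out a D(S_3)-submodule of [W]. It contains [m], so it is
    all of [W], and [nakayama] applies. *)
Lemma top_generates (N : submodClosed V) m l :
  m != 0 -> low 1 l -> vt 1 m + l \in N -> forall v, v \in N.
Proof.
move=> m0 ll vN; apply: nakayama.
apply: Wsimple => [c u u' [n nN ln] [n' nN' ln']|g u [n nN ln]|h u [n nN ln]|].
- exists (c%:A *: n + n'); first by rewrite rpredD ?rpredZ.
  rewrite vtD vtZ opprD addrACA -scalerBr.
  by apply: lowD => //; apply: lowZ.
- by exists (gg K g *: n); [apply: rpredZ|rewrite -vt_gg -scalerBr; apply: low_gg].
- by exists (dd K h *: n); [apply: rpredZ|rewrite -vt_dd -scalerBr; apply: low_dd].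
- exists m => //; exists (vt 1 m + l) => //.
  by rewrite opprD addrA subrr sub0r; apply: lowN.
Qed.

Lemma proper_low (N : submodClosed V) v : is_proper N -> v \in N -> low 1 v.
Proof.
move=> [w /negP wN] vN; have [m [l [ll vE]]] := low_split v.
have [m0|m0] := eqVneq m 0; first by rewrite vE m0 vt0 add0r.
by case: wN; apply: top_generates m0 ll _ w; rewrite -vE.
Qed.

(** The sum of two proper submodules stays inside [low 1]. Were it everything, all top vectors would
    lie in [low 1], and [nakayama] would make [N] everything too. *)
Lemma maximal_greatest (N : submodClosed V) : maximal N ->
  forall B : submodClosed V, is_proper B -> {subset B <= N}.
Proof.
move=> [pN mN] B pB b bB.
pose P v := exists2 n, n \in N & v - n \in B.
have [||E EP] := @ex_submod _ _ P.
- by exists 0; rewrite ?subr0 rpred0.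
- move=> a u v [n nN uB] [n' nN' vB]; exists (a *: n + n'); first by rewrite rpredD ?rpredZ.
  by rewrite opprD addrACA -scalerBr rpredD ?rpredZ.
have lowE v : v \in E -> low 1 v.
  move/EP=> [n nN vB]; rewrite -(subrK n v).
  by apply: lowD; [exact: proper_low pB vB|exact: proper_low pN nN].
have pE : is_proper E.
  apply: contrapT => /forallNP allE; have [w /negP[]] := pN.
  apply: nakayama => m; exists 0; rewrite ?rpred0 // subr0.
  by apply/lowE/negPn/negP/allE.
apply: (mN E) pE _ _ => [n nN|]; first by apply/EP; exists n; rewrite // subrr rpred0.
by apply/EP; exists 0; rewrite ?rpred0 // subr0.
Qed.

Lemma maximal_unique (M N : submodClosed V) : maximal M -> maximal N -> M =i N.
Proof.
move=> mM mN v; apply/idP/idP; [exact: (maximal_greatest mN mM.1)|].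
exact: (maximal_greatest mM mN.1).
Qed.

Lemma radical_max (N : submodClosed V) : maximal N -> radical (V := V) =i N.
Proof.
move=> mN v; apply/idP/idP => [/asboolP|vN]; first exact.
by apply/asboolP => A mA; rewrite (maximal_unique mA mN).
Qed.

(** The preimage of [B] under the induced map of [Verma W] onto [A] is maximal, because nothing lies
    strictly between [B] and [A]; a maximal submodule is the radical. *)
Lemma highest_weight_head (U : lmodType D) (A B : submodClosed U) (f : 'cV[K]_(ddim W) -> U) :
  (forall c m m', f (c *: m + m') = c%:A *: f m + f m') ->
  (forall g m, f (actg W g *m m) = gg K g *: f m) ->
  (forall h m, f (actd W h *m m) = dd K h *: f m) ->
  (forall t m, yy K t *: f m = 0) ->
  A =i gen (range f) -> {subset B <= A} -> ~ {subset A <= B} ->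
  (forall C : submodClosed U, {subset B <= C} -> {subset C <= A} ->
     ~ {subset C <= B} -> {subset A <= C}) ->
  isomorphic (subquo A B) (L W).
Proof.
move=> fl fg fd fy AE BA AB CP.
have [F FE] := verma_univ fl fg fd fy.
have fA m : f m \in A by rewrite AE; apply: in_gen; exists m.
have FA v : F v \in A.
  elim/qpiP: v => r; rewrite qpi_vt linear_sum rpred_sum // => j _.
  by rewrite linearZ /= FE scale1r; apply/rpredZ/fA.
have Fs u : u \in A -> exists v, F v = u.
  rewrite AE; apply: (@gen_ind _ _ _ (fun u => exists v, F v = u)) u.
  - by exists 0; rewrite linear0.
  - by move=> a _ _ [u <-] [v <-]; exists (a *: u + v); rewrite linearP.
  - by move=> _ [m _ <-]; exists (vt 1 m); rewrite FE scale1r.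
have [||N NE] := @ex_submod _ _ (fun v => F v \in B).
- by rewrite linear0 rpred0.
- by move=> a u v /= uB vB; rewrite linearP rpredD ?rpredZ.
have mN : maximal N.
  split.
    apply: contra_notP AB => /forallNP allN u /Fs[v <-].
    by apply/NE/negPn/negP/allN.
  move=> C NC [w wC] v vC; apply/NE; apply: contrapT => vB.
  have [||E EE] := @ex_submod _ _ (fun u => exists2 v, v \in C & F v = u).
  - by exists 0; rewrite ?rpred0 ?linear0.
  - move=> a _ _ [u uC <-] [u' uC' <-]; exists (a *: u + u').
      by rewrite rpredD ?rpredZ.
    by rewrite linearP.
  have /(_ _ (FA w)) /EE [w' wC' ww'] : {subset A <= E}.
    apply: CP.
    - move=> u uB; have [u' uE] := Fs u (BA _ uB).
      by apply/EE; exists u' => //; apply/NC/NE; rewrite uE.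
    - by move=> u /EE [u' _ <-]; apply: FA.
    - by move=> EB; apply/vB/EB/EE; exists v.
  case/negP: wC; rewrite -(subrK w' w) rpredD // NC //.
  by apply/NE; rewrite linearB ww' subrr rpred0.
apply: (subquo_iso (F := F)) => // v.
by rewrite (radical_max mN); apply: NE.
Qed.

End Filtration.

(** * Integral matrices for M(tau,0) *)

(* The matrix type of MathComp does not reduce, so that matrix identities are
   checked on lists of rows. *)
Definition imx := seq (seq int).
Definition ient (A : imx) (i j : nat) : int := nth 0 (nth [::] A i) j.
Definition imk (m n : nat) (f : nat -> nat -> int) : imx := mkseq (fun i => mkseq (f i) n) m.
(** Zero entries of [A] are skipped, since the matrices are sparse. *)
Definition imul_def (m p n : nat) (A B : imx) : imx :=
  mkseq (fun i =>
    let supp := [seq k <- iota 0 p | ient A i k != 0] in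
    mkseq (fun j => foldr (fun k s => ient A i k * ient B k j + s) 0 supp) n) m.
Definition icomb_def (m n : nat) (a : int) (A : imx) (b : int) (B : imx) : imx :=
  imk m n (fun i j => a * ient A i j + b * ient B i j).
(* Locked, lest unification compute with the matrices. *)
Lemma locked_withE (T : Type) (k : unit) (x : T) : locked_with k x = x.
Proof. by case: k. Qed.

Fact imul_key : unit. Proof. by []. Qed.
Fact icomb_key : unit. Proof. by []. Qed.
Definition imul := locked_with imul_key imul_def.
Definition icomb := locked_with icomb_key icomb_def.

Lemma imulE : imul = imul_def. Proof. exact: locked_withE. Qed.
Lemma icombE : icomb = icomb_def. Proof. exact: locked_withE. Qed.

Definition iid (n : nat) : imx := imk n n (fun i j => (i == j)%:Z).
(** Entries outside the lists default to 0, so that [[::]] serves as the zero matrix of every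
    size. *)
Definition ieq (m n : nat) (A B : imx) : bool :=
  all (fun i => all (fun j => ient A i j == ient B i j) (iota 0 n)) (iota 0 m).

(* A column is a sum of terms [k] standing for the basis vector of index
   [k - 1] and [- k] for its opposite, so that indices start from 1 here. *)
Definition imx_of_cols (m n : nat) (cols : seq (seq int)) : imx :=
  imk m n (fun i j => foldr (fun k s => (k == i.+1%:Z)%:Z - (k == - i.+1%:Z)%:Z + s) 0
                            (nth [::] cols j)).

Section Cast.
Variable K : fieldType.

Definition mx (m n : nat) (A : imx) : 'M[K]_(m, n) := \matrix_(i, j) (ient A i j)%:~R.

Lemma ient_imk m n f i j : (i < m)%N -> (j < n)%N -> ient (imk m n f) i j = f i j.
Proof. by move=> im jn; rewrite /ient !nth_mkseq. Qed.

Lemma mxEk m n f : mx m n (imk m n f) = \matrix_(i, j) (f i j)%:~R.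
Proof. by apply/matrixP => i j; rewrite !mxE ient_imk. Qed.

Lemma mx_mul m p n A B : mx m n (imul m p n A B) = mx m p A *m mx p n B.
Proof.
rewrite imulE; apply/matrixP => i j; rewrite !mxE.
have -> : ient (imul_def m p n A B) i j =
    foldr (fun k s => ient A i k * ient B k j + s) 0 [seq k <- iota 0 p | ient A i k != 0].
  by rewrite {1}/ient !nth_mkseq.
transitivity (\sum_(0 <= k < p) (ient A i k * ient B k j)%:~R : K).
  rewrite unlock /reducebig /index_iota subn0.
  elim: (iota 0 p) => //= k s <-; case: eqVneq => [->|_] /=; last by rewrite rmorphD.
  by rewrite mul0r add0r.
by rewrite big_mkord; apply: eq_bigr => k _; rewrite !mxE intrM.
Qed.

Lemma mx_comb m n a A b B :
  mx m n (icomb m n a A b B) = a%:~R *: mx m n A + b%:~R *: mx m n B.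
Proof. by rewrite icombE mxEk; apply/matrixP => i j; rewrite !mxE intrD !intrM. Qed.

Lemma mx_id n : mx n n (iid n) = 1%:M.
Proof. by rewrite mxEk; apply/matrixP => i j; rewrite !mxE -val_eqE /=; case: eqP. Qed.

Lemma ieqP m n A B : ieq m n A B -> mx m n A = mx m n B.
Proof.
move/allP => AB; apply/matrixP => i j; rewrite !mxE.
have im : val i \in iota 0 m by rewrite mem_iota /=.
have jn : val j \in iota 0 n by rewrite mem_iota /=.
by have /allP/(_ _ jn)/eqP -> := AB _ im.
Qed.

End Cast.

(* The actions of x_(12), y_(12), sigma and tau on M(tau,0), in an integral
   basis of vectors homogeneous for the grading and for the [dd h], adapted to
   the flag S(tau,0) < X(tau,0) < M(tau,0).  It consists of
   - 0-6, a basis of S(tau,0): degree -4 is 0-1, degree -3 is 2-4 and degree -2,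
     which is the span of G, is 5-6;
   - 7-16, which complete it to a basis of X(tau,0): 7-9 are the [jvec],
     10-13 have degree -2 and 14-16 have degree -3;
   - 17-23: 17 and 18 are the kets, 19-21 have degree -1 and 22-23 degree -2.
   See [basis_mx] for the expression of this basis in words. *)
Definition X12_mx : imx := imx_of_cols 24 24 [::
  [::]; [::]; [::]; [:: 1]; [:: -2]; [::]; [:: 3]; [:: 6]; [:: 14]; [:: 11];
  [::]; [:: 5; 17]; [:: 4; -16]; [::]; [::]; [:: 1]; [:: 2]; [:: 9; -20];
  [:: 21]; [:: 14]; [::]; [:: 6; -23]; [::]; [:: 15]]%Z.

Definition Y12_mx : imx := imx_of_cols 24 24 [::
  [:: 4]; [:: -5]; [:: 6; 7; 7]; [::]; [::]; [::]; [::]; [::]; [::]; [::];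
  [:: 10]; [:: -10]; [::]; [:: 9]; [:: 6; 7]; [:: -13]; [:: 11; 12]; [::]; [::];
  [:: -18]; [:: 19]; [::]; [:: 8; -22; -22]; [:: -22]]%Z.

Definition sigma_mx : imx := imx_of_cols 24 24 [::
  [:: 2]; [:: 1]; [:: 3]; [:: 5]; [:: 4]; [:: 6]; [:: -6; -7]; [:: -8];
  [:: -10]; [:: -9]; [:: 14]; [:: -13; -14]; [:: -11; -12]; [:: 11];
  [:: 3; -15]; [:: -17]; [:: -16]; [:: 19]; [:: 18]; [:: -10; 21]; [:: -9; 20];
  [:: -8; 22]; [:: 6; -23]; [:: -7; -23; 24]]%Z.

Definition tau_mx : imx := imx_of_cols 24 24 [::
  [:: 1]; [:: 2]; [:: -4]; [:: 5]; [:: -3]; [:: 7]; [:: -6; -7]; [:: 9];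
  [:: 10]; [:: 8]; [:: 12]; [:: -11; -12]; [:: -13; -14]; [:: 13]; [:: -4; 16];
  [:: 5; 17]; [:: 15]; [:: 18]; [:: 19]; [:: 21]; [:: 22]; [:: 20]; [:: 7; -24];
  [:: -6; 23; -24]]%Z.

(* The h such that [dd h] fixes the basis vector. *)
Definition degs : seq (seq nat) :=
  let t := [:: 1; 2; 0]%N in let tV := [:: 2; 0; 1]%N in let e := [:: 0; 1; 2]%N in
  let a := [:: 1; 0; 2]%N in let b := [:: 0; 2; 1]%N in let c := [:: 2; 1; 0]%N in
  [:: t; tV; a; b; c; e; e; a; b; c; tV; tV; t; t; a; b; c; t; tV; b; c; a; e; e].

Local Notation eqm := (ieq 24 24).

Definition tau2_mx : imx := imul_def 24 24 24 tau_mx tau_mx.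
Definition Gs : seq imx :=
  [:: iid 24; tau_mx; tau2_mx; sigma_mx; imul_def 24 24 24 sigma_mx tau_mx; imul_def 24 24 24 sigma_mx tau2_mx].
(** Conjugation by the even element tau carries (12) to (23) and (23) to (13) with no sign. *)
Definition conjs (A : imx) : seq imx :=
  [:: A; imul_def 24 24 24 (imul_def 24 24 24 tau_mx A) tau2_mx; imul_def 24 24 24 (imul_def 24 24 24 tau2_mx A) tau_mx].
Definition Xs : seq imx := conjs X12_mx.
Definition Ys : seq imx := conjs Y12_mx.

Local Notation mul := (imul 24 24 24).
Definition Gm_def (s : seq nat) : imx := nth [::] Gs (index s codes).
Definition Dm_def (s : seq nat) : imx :=
  imk 24 24 (fun i j => ((i == j) && (nth [::] degs j == s))%:Z).
(** Products with the diagonal matrix [Dm s], on the left here and on the right in [maskr], obtained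
    by selecting rows or columns. *)
Definition maskl (s : seq nat) (A : imx) : imx :=
  imk 24 24 (fun i j => if nth [::] degs i == s then ient A i j else 0).
Definition maskr (s : seq nat) (A : imx) : imx :=
  imk 24 24 (fun i j => if nth [::] degs j == s then ient A i j else 0).
Definition Xm_def (s : seq nat) : imx := nth [::] Xs (index s oddc).
Definition Ym_def (s : seq nat) : imx := nth [::] Ys (index s oddc).
Fact Gm_key : unit. Proof. by []. Qed.
Fact Dm_key : unit. Proof. by []. Qed.
Fact Xm_key : unit. Proof. by []. Qed.
Fact Ym_key : unit. Proof. by []. Qed.
Definition Gm := locked_with Gm_key Gm_def.
Definition Dm := locked_with Dm_key Dm_def.
Definition Xm := locked_with Xm_key Xm_def.
Definition Ym := locked_with Ym_key Ym_def.

Lemma matsE : ((Gm = Gm_def) * (Dm = Dm_def) * (Xm = Xm_def) * (Ym = Ym_def)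
  * (imul = imul_def) * (icomb = icomb_def))%type.
Proof. by do !split; apply: locked_withE. Qed.

Definition sgc (s : seq nat) : int := if s \in oddc then -1 else 1.

Definition all2c (S T : seq (seq nat)) (P : seq nat -> seq nat -> bool) : bool :=
  all (fun s => all (P s) T) S.

Lemma all2cP S T P s t : all2c S T P -> s \in S -> t \in T -> P s t.
Proof. by move=> /allP ST /ST /allP; apply. Qed.

Definition iadd (A B : imx) := icomb 24 24 1 A 1 B.
Definition isub (A B : imx) := icomb 24 24 1 A (-1) B.

Fact Gm1 : Gm [:: 0; 1; 2]%N = iid 24.
Proof. by rewrite matsE. Qed.
Fact check_GG : all2c codes codes (fun s r => eqm (mul (Gm s) (Gm r)) (Gm (cmul s r))).
Proof. by rewrite /iadd /isub !matsE; vm_compute. Qed.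
Fact check_DG : all2c codes codes (fun s r =>
  eqm (maskl r (Gm s)) (maskr (cmul (cmul (cinv s) r) s) (Gm s))).
Proof. by rewrite /iadd /isub !matsE; vm_compute. Qed.
Fact check_DD : all2c codes codes (fun s r =>
  eqm (maskl s (Dm r)) (if s == r then Dm s else [::])).
Proof. by rewrite /iadd /isub !matsE; vm_compute. Qed.
Fact check_GX : all2c codes oddc (fun s t =>
  eqm (mul (Gm s) (Xm t)) (icomb 24 24 (sgc s) (mul (Xm (cconj s t)) (Gm s)) 0 [::])).
Proof. by rewrite /iadd /isub !matsE; vm_compute. Qed.
Fact check_YG : all2c codes oddc (fun s t =>
  eqm (mul (Ym t) (Gm s)) (icomb 24 24 (sgc s) (mul (Gm s) (Ym (cconj (cinv s) t))) 0 [::])).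
Proof. by rewrite /iadd /isub !matsE; vm_compute. Qed.
Fact check_DXY : all2c codes oddc (fun s t =>
  eqm (maskl s (Xm t)) (maskr (cmul t s) (Xm t)) &&
  eqm (maskl s (Ym t)) (maskr (cmul t s) (Ym t))).
Proof. by rewrite /iadd /isub !matsE; vm_compute. Qed.
Fact check_sq : all (fun t => eqm (mul (Xm t) (Xm t)) [::] && eqm (mul (Ym t) (Ym t)) [::]) oddc.
Proof. by rewrite /iadd /isub !matsE; vm_compute. Qed.
Fact check_quad : all (fun ijk => let: (i, j, k) := ijk in
  let t := ctperm i j in let u := ctperm i k in let v := ctperm j k in
  all (fun M => eqm (iadd (iadd (mul (M t) (M u)) (mul (M v) (M t))) (mul (M u) (M v))) [::])
      [:: Xm; Ym])
  [:: (0, 1, 2); (0, 2, 1); (1, 0, 2); (1, 2, 0); (2, 0, 1); (2, 1, 0)]%N.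
Proof. by rewrite /iadd /isub !matsE; vm_compute. Qed.
Fact check_YX : all (fun t =>
  eqm (iadd (mul (Ym t) (Xm t)) (mul (Xm t) (Ym t)))
      (iadd (iid 24) (mul (Gm t) (isub (Dm t) (Dm [:: 0; 1; 2]%N))))) oddc.
Proof. by rewrite /iadd /isub !matsE; vm_compute. Qed.
Fact check_YXoff : all (fun ijk => let: (i, j, k) := ijk in
  let t := ctperm i j in let u := ctperm i k in let v := ctperm j k in
  eqm (iadd (mul (Ym u) (Xm t)) (mul (Xm t) (Ym v)))
      (mul (Gm t) (isub (Dm u) (Dm (cmul u t)))))
  [:: (0, 1, 2); (0, 2, 1); (1, 0, 2); (1, 2, 0); (2, 0, 1); (2, 1, 0)]%N.
Proof. by rewrite /iadd /isub !matsE; vm_compute. Qed.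

(** * The matrix representation of the double *)

Lemma distinct3 (i j k : 'I_3) : i != j -> i != k -> j != k ->
  (val i, val j, val k) \in
    [:: (0, 1, 2); (0, 2, 1); (1, 0, 2); (1, 2, 0); (2, 0, 1); (2, 1, 0)]%N.
Proof.
by case: i => [[|[|[|?]]] ?] //; case: j => [[|[|[|?]]] ?] //; case: k => [[|[|[|?]]] ?].
Qed.

Lemma codes_pcode s : s \in codes -> exists g, pcode g = s.
Proof.
rewrite !inE; case/or4P=> [/eqP->|/eqP->|/eqP->|/or3P[] /eqP->].
- by exists 1%g; rewrite pcode1.
- by exists tau; rewrite pcode_tau.
- by exists (inv3 tau); rewrite pcodeV pcode_tau.
- by exists (val t12); rewrite pcode_t12.
- by exists (val t23); rewrite pcode_t23.
- by exists (val t13); rewrite pcode_t13.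
Qed.

Lemma transp_oddc (t : transp) : pcode (val t) \in oddc.
Proof. by rewrite -pcode_odd; apply: valP t. Qed.

Section Representation.
Variable K : fieldType.
Local Notation D := (DD K).
Local Notation mx := (mx K).

Lemma mx_nil m n : mx m n [::] = 0.
Proof. by apply/matrixP => i j; rewrite !mxE /ient nth_nil nth_nil. Qed.

Lemma mx_maskl s n A : mx 24 n (imk 24 n (fun i j => if nth [::] degs i == s then ient A i j else 0))
  = mx 24 24 (Dm s) *m mx 24 n A.
Proof.
rewrite matsE !mxEk; apply/matrixP => i j; rewrite !mxE (bigD1 i) //= big1 => [|k]; rewrite !mxE.
  by rewrite eqxx addr0 /=; case: eqP; rewrite ?mul1r ?mul0r.
by rewrite eq_sym -val_eqE => /negPf /= ->; rewrite mul0r.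
Qed.

Lemma mx_maskr s A : mx 24 24 (maskr s A) = mx 24 24 A *m mx 24 24 (Dm s).
Proof.
rewrite matsE !mxEk; apply/matrixP => i j; rewrite !mxE (bigD1 j) //= big1 => [|k]; rewrite !mxE.
  by rewrite eqxx addr0 /=; case: eqP; rewrite ?mulr1 ?mulr0.
by rewrite -val_eqE => /negPf /= ->; rewrite mulr0.
Qed.

Lemma sgcE g : (sgc (pcode g))%:~R = (-1) ^+ odd_perm g :> K.
Proof. by rewrite /sgc -pcode_odd; case: (odd_perm g); rewrite ?expr1 ?rmorphN. Qed.

(** Defined on expressions, as D is their quotient; it descends to [rep] because it respects
    [eqv]. *)
Fixpoint eval (u : expr K) : 'M[K]_24 :=
  match u with
  | EX t => mx 24 24 (Xm (pcode (val t)))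
  | EY t => mx 24 24 (Ym (pcode (val t)))
  | EG g => mx 24 24 (Gm (pcode g))
  | ED h => mx 24 24 (Dm (pcode h))
  | EC c => c%:M
  | EAdd u v => eval u + eval v
  | EMul u v => eval u *m eval v
  end.

Lemma scalarN1_mx (A : 'M[K]_24) : (-1)%:M *m A = - A.
Proof. by rewrite mul_scalar_mx scaleN1r. Qed.

Lemma scalar0_mx : 0%:M = 0 :> 'M[K]_24.
Proof. exact: raddf0. Qed.

Lemma mx_add A B : mx 24 24 (iadd A B) = mx 24 24 A + mx 24 24 B.
Proof. by rewrite mx_comb !scale1r. Qed.

Lemma mx_sub A B : mx 24 24 (isub A B) = mx 24 24 A - mx 24 24 B.
Proof. by rewrite mx_comb scale1r rmorphN scaleN1r. Qed.

Lemma mx_scal a A : mx 24 24 (icomb 24 24 a A 0 [::]) = a%:~R *: mx 24 24 A.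
Proof. by rewrite mx_comb scale0r addr0. Qed.

Lemma eval_rel u v : drel u v -> eval u = eval v.
Proof.
case=> [|g h|g h| |g h|t|i j k ij ik jk|t|i j k ij ik jk|g t|h t|h t|g t|t|i j k ij ik jk] /=.
- by rewrite pcode1 Gm1 mx_id.
- rewrite pcodeM -mx_mul; apply: ieqP.
  exact: (all2cP check_GG (pcode_codes g) (pcode_codes h)).
- have := all2cP check_DD (pcode_codes g) (pcode_codes h).
  move/ieqP => /(_ K); rewrite mx_maskl (inj_eq pcode_inj) => ->.
  by case: ifP => //= _; rewrite mx_nil scalar0_mx.
(* Each basis vector is fixed by exactly one [Dm], the one given by its entry in [degs]. *)
- rewrite (big_morph eval (op2 := @EAdd K) (id2 := EC 0) (fun u v => erefl) scalar0_mx) /=.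
  apply/matrixP => i j; rewrite summxE !mxE.
  under eq_bigr => h _ do rewrite matsE mxEk mxE.
  have [->|ij] := eqVneq i j; last first.
    by rewrite big1 // => h _; rewrite val_eqE (negPf ij).
  have [g gE] : exists g, pcode g = nth [::] degs j.
    have /(all_nthP [::]) dC : all [in codes] degs by [].
    exact/codes_pcode/dC/ltn_ord.
  rewrite (bigD1 g) //= eqxx gE eqxx big1 ?addr0 // => h hg.
  by rewrite -gE (inj_eq pcode_inj) eq_sym (negPf hg) andbF.
- have := all2cP check_DG (pcode_codes g) (pcode_codes h).
  by move/ieqP => /(_ K); rewrite mx_maskl mx_maskr !pcodeM pcodeV.
- rewrite -mx_mul scalar0_mx -(mx_nil 24 24); apply: ieqP.
  by have /allP/(_ _ (transp_oddc t))/andP[+ _] := check_sq.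
- rewrite !pcode_tperm -!mx_mul -!mx_add scalar0_mx -(mx_nil 24 24); apply: ieqP.
  by have /allP/(_ _ (distinct3 ij ik jk))/and3P[+ _ _] := check_quad.
- rewrite -mx_mul scalar0_mx -(mx_nil 24 24); apply: ieqP.
  by have /allP/(_ _ (transp_oddc t))/andP[_ +] := check_sq.
- rewrite !pcode_tperm -!mx_mul -!mx_add scalar0_mx -(mx_nil 24 24); apply: ieqP.
  by have /allP/(_ _ (distinct3 ij ik jk))/and3P[_ + _] := check_quad.
- have := all2cP check_GX (pcode_codes g) (transp_oddc t).
  move/ieqP => /(_ K).
  rewrite mx_scal sgcE !mx_mul => ->.
  by rewrite pcode_conj mul_scalar_mx scalemxAl.
- have /andP[+ _] := all2cP check_DXY (pcode_codes h) (transp_oddc t).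
  by move/ieqP => /(_ K); rewrite mx_maskl mx_maskr pcodeM.
- have /andP[_ +] := all2cP check_DXY (pcode_codes h) (transp_oddc t).
  by move/ieqP => /(_ K); rewrite mx_maskl mx_maskr pcodeM.
- have := all2cP check_YG (pcode_codes g) (transp_oddc t).
  move/ieqP => /(_ K).
  rewrite mx_scal sgcE !mx_mul => ->.
  by rewrite pcode_conj pcodeV mul_scalar_mx scalemxAl.
- have /allP/(_ _ (transp_oddc t)) := check_YX.
  move/ieqP => /(_ K); rewrite !mx_add !mx_mul mx_sub mx_id.
  by rewrite pcode1 scalarN1_mx => ->.
- have /allP/(_ _ (distinct3 ij ik jk)) := check_YXoff.
  move/ieqP => /(_ K); rewrite !mx_add !mx_mul mx_sub.
  by rewrite scalarN1_mx !pcodeM !pcode_tperm => ->.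
Qed.

Lemma eval_eqv u v : eqv u v -> eval u = eval v.
Proof.
elim=> {u v} /=; rewrite ?mul1mx //.
- exact: eval_rel.
- by move=> u v w _ -> _ ->.
- by move=> u u' v v' _ -> _ ->.
- by move=> u u' v v' _ -> _ ->.
- by move=> *; rewrite addrA.
- by move=> *; rewrite addrC.
- by move=> *; rewrite scalar0_mx add0r.
- by move=> *; rewrite scalarN1_mx scalar0_mx addNr.
- by move=> *; rewrite mulmxA.
- by move=> *; rewrite mul1mx.
- by move=> *; rewrite mulmx1.
- by move=> *; rewrite mulmxDl.
- by move=> *; rewrite mulmxDr.
- by move=> *; rewrite raddfD.
- by move=> *; rewrite scalar_mxM.
- by move=> *; rewrite scalar_mxC.
Qed.

Definition rep (a : D) : 'M[K]_24 := eval (repr a).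

Lemma rep_cls u : rep (cls u) = eval u.
Proof. exact/eval_eqv/eqv_repr. Qed.

Lemma repD a b : rep (a + b) = rep a + rep b.
Proof. by elim/clsP: a => u; elim/clsP: b => v; rewrite -cls_add !rep_cls. Qed.

Lemma repM a b : rep (a * b) = rep a *m rep b.
Proof. by elim/clsP: a => u; elim/clsP: b => v; rewrite -cls_mul !rep_cls. Qed.

Lemma rep_scal c : rep c%:A = c%:M.
Proof. by rewrite -cls_const rep_cls. Qed.

Lemma repZ c a : rep (c *: a) = c *: rep a.
Proof. by rewrite -mulr_algl repM rep_scal mul_scalar_mx. Qed.

Lemma repN a : rep (- a) = - rep a.
Proof. by rewrite -scaleN1r repZ scaleN1r. Qed.

Lemma rep1 : rep 1 = 1%:M.
Proof. by rewrite -[1]scale1r rep_scal. Qed.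

Lemma rep_xx t : rep (xx K t) = mx 24 24 (Xm (pcode (val t))).
Proof. exact: rep_cls. Qed.
Lemma rep_yy t : rep (yy K t) = mx 24 24 (Ym (pcode (val t))).
Proof. exact: rep_cls. Qed.
Lemma rep_gg g : rep (gg K g) = mx 24 24 (Gm (pcode g)).
Proof. exact: rep_cls. Qed.
Lemma rep_dd h : rep (dd K h) = mx 24 24 (Dm (pcode h)).
Proof. exact: rep_cls. Qed.

(** An alias that receives the D-module structure, so as not to clash with the K-module structure of
    the column space. *)
Definition U24 : Type := 'cV[K]_24.
HB.instance Definition _ := GRing.Zmodule.on U24.

Definition act24 (a : D) (v : U24) : U24 := rep a *m v.
Fact act24A a b v : act24 a (act24 b v) = act24 (a * b) v.
Proof. by rewrite /act24 repM mulmxA. Qed.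
Fact act24_1 : left_id 1 act24.
Proof. by move=> v; rewrite /act24 rep1 mul1mx. Qed.
Fact act24Dr : right_distributive act24 +%R.
Proof. by move=> a u v; rewrite /act24 mulmxDr. Qed.
Fact act24Dl v : {morph act24^~ v : a b / a + b}.
Proof. by move=> a b; rewrite /act24 repD mulmxDl. Qed.
HB.instance Definition _ :=
  GRing.Zmodule_isLmodule.Build D U24 act24A act24_1 act24Dr act24Dl.

End Representation.

(** * Coordinates on M(tau,0) *)

(** Integral counterparts, indexed by codes, of the matrices that define the three weights, so that
    equivariance can be checked by evaluation. *)
Definition class_gm (b : bool) (cs : seq (seq nat)) (s : seq nat) : imx :=
  imk (size cs) (size cs) (fun i j =>
    (if b then sgc s else 1) * (nth [::] cs i == cconj s (nth [::] cs j))%:Z).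
Definition class_dm (cs : seq (seq nat)) (s : seq nat) : imx :=
  imk (size cs) (size cs) (fun i j => ((i == j) && (nth [::] cs j == s))%:Z).
Definition rho_gm (s : seq nat) : imx :=
  imk 2 2 (fun k j => (nth 0%N s j == k)%:Z - (nth 0%N s 2 == k)%:Z).
Definition rho_dm (s : seq nat) : imx := if s == [:: 0; 1; 2]%N then iid 2 else [::].

Definition tau_codes : seq (seq nat) := [:: [:: 1; 2; 0]; [:: 2; 0; 1]]%N.

Definition ketE : imx := imx_of_cols 24 2 [:: [:: 18]; [:: 19]]%Z.
Definition jE : imx := imx_of_cols 24 3 [:: [:: 8]; [:: 9]; [:: 10]]%Z.
(** An equivariant copy of [Merho] in the span of the basis vectors 5 and 6. The base change,
    [rho_e56], has determinant 3: the two lattices differ, but their spans over K agree. *)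
Definition rhoE : imx := imx_of_cols 24 2 [:: [:: -6; 7]; [:: -6; -6; -7]]%Z.

Definition weight_check (n : nat) (E : imx) (aG aD : seq nat -> imx) : bool :=
  all (fun s => ieq 24 n (imul 24 24 n (Gm s) E) (imul 24 n n E (aG s)) &&
                ieq 24 n (imul 24 24 n (Dm s) E) (imul 24 n n E (aD s))) codes &&
  all (fun t => ieq 24 n (imul 24 24 n (Ym t) E) [::]) oddc.

Fact ket_check : weight_check 2 ketE (class_gm false tau_codes) (class_dm tau_codes).
Proof. by rewrite /weight_check !matsE; vm_compute. Qed.
Fact j_check : weight_check 3 jE (class_gm true oddc) (class_dm oddc).
Proof. by rewrite /weight_check !matsE; vm_compute. Qed.
Fact rho_check : weight_check 2 rhoE rho_gm rho_dm.
Proof. by rewrite /weight_check !matsE; vm_compute. Qed.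

Definition Xword (w : seq nat) : imx :=
  foldr (fun i M => mul (Xm (nth [::] oddc i)) M) (iid 24) w.

Definition interleave (cs : seq imx) : imx :=
  imk 24 24 (fun i j => ient (nth [::] cs j./2) i (odd j)).
(* Column j is the word of index j./2 applied to the ket of index odd j. *)
Definition words_mx : imx := interleave [seq imul 24 24 2 (Xword w) ketE | w <- bwords].

(** The inverse of [words_mx]: column k writes the basis vector k in the words applied to the
    kets. *)
Definition basis_mx : imx := imx_of_cols 24 24 [::
  [:: 23]; [:: 24]; [:: 17; 20]; [:: 18; 21]; [:: 19; -22]; [:: 10; 13];
  [:: 11; 16]; [:: 6; 7]; [:: 3; 8]; [:: 4; 5]; [:: 9]; [:: 15]; [:: 12];
  [:: 14]; [:: 20]; [:: 21]; [:: 22]; [:: 1]; [:: 2]; [:: 8]; [:: 4]; [:: 6];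
  [:: 13]; [:: 16]]%Z.

Fact words_basis_check : eqm (mul words_mx basis_mx) (iid 24).
Proof. by rewrite /words_mx /Xword !matsE; vm_compute. Qed.

Section Coordinates.
Variable K : fieldType.
Local Notation D := (DD K).
Local Notation mx := (mx K).

Lemma weight_embed (W : dmodule K) (E : imx) (aG aD : seq nat -> imx)
    (f := fun m : 'cV[K]_(ddim W) => mx 24 (ddim W) E *m m) :
  (forall g, actg W g = mx _ _ (aG (pcode g))) ->
  (forall h, actd W h = mx _ _ (aD (pcode h))) ->
  weight_check (ddim W) E aG aD ->
  [/\ forall g m, f (actg W g *m m) = rep (gg K g) *m f m,
      forall h m, f (actd W h *m m) = rep (dd K h) *m f m &
      forall t m, rep (yy K t) *m f m = 0].
Proof.
move=> aGE aDE /andP[/allP cGD /allP cY]; split=> [g|h|t] m; rewrite /f ?mulmxA.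
- have /andP[+ _] := cGD _ (pcode_codes g); move/ieqP => /(_ K) E1.
  by rewrite aGE rep_gg -!mx_mul E1.
- have /andP[_] := cGD _ (pcode_codes h); move/ieqP => /(_ K) E2.
  by rewrite aDE rep_dd -!mx_mul E2.
- have := cY _ (transp_oddc t); move/ieqP => /(_ K) E3.
  by rewrite rep_yy -mx_mul E3 mx_nil mul0mx.
Qed.

Lemma class_gE b n (d : 'I_n -> 'S_3) cs g : size cs = n ->
  (forall i : 'I_n, pcode (d i) = nth [::] cs i) ->
  class_g K b d g = mx n n (class_gm b cs (pcode g)).
Proof.
move=> csn dE; rewrite /class_gm csn mxEk; apply/matrixP => i j; rewrite !mxE.
rewrite -!dE -pcode_conj (inj_eq pcode_inj) rmorphM /=; congr (_ * _).
by case: b; rewrite ?sgcE.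
Qed.

Lemma class_dE n (d : 'I_n -> 'S_3) cs h : size cs = n ->
  (forall i : 'I_n, pcode (d i) = nth [::] cs i) ->
  class_d K d h = mx n n (class_dm cs (pcode h)).
Proof.
move=> csn dE; rewrite /class_dm csn mxEk; apply/matrixP => i j; rewrite !mxE.
by rewrite -dE (inj_eq pcode_inj) val_eqE.
Qed.

Lemma dtau_codes (i : 'I_2) : pcode (dtau i) = nth [::] tau_codes i.
Proof. by case: (I2P i) => ->; rewrite /dtau /= ?pcodeV pcode_tau. Qed.

Lemma pcode_sigtau i : (i < 3)%N -> pcode (val (sigtau i)) = nth [::] oddc i.
Proof.
have [E0 E1 E2] := sigtauE.
by case: i => [|[|[|//]]] _; rewrite ?E0 ?E1 ?E2 ?pcode_t12 ?pcode_t23 ?pcode_t13.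
Qed.

Lemma dsigma_codes (i : 'I_3) : pcode (dsigma i) = nth [::] oddc i.
Proof. exact: pcode_sigtau. Qed.

Lemma rho_gE g : rho_g K g = mx 2 2 (rho_gm (pcode g)).
Proof.
rewrite mxEk; apply/matrixP => k j; rewrite !mxE.
rewrite (nth_pcode g (w2 j)) (nth_pcode g ord_max) rmorphB /=.
by rewrite -!val_eqE /=; do 2 case: (_ == _).
Qed.

Lemma rho_dE h : rho_d K h = mx 2 2 (rho_dm (pcode h)).
Proof.
rewrite /rho_d /rho_dm -pcode1 (inj_eq pcode_inj).
by case: ifP; rewrite ?mx_id ?mx_nil.
Qed.

Definition ketf (m : 'cV[K]_2) : U24 K := mx 24 2 ketE *m m.

Lemma Phi_exists : exists F : {linear Verma (Mtau K) -> U24 K},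
  forall d m, F (vt (W := Mtau K) d m) = rep d *m ketf m.
Proof.
have cs2 : size tau_codes = 2 by [].
have [fg fd fy] := @weight_embed (Mtau K) _ _ _
  (fun g => class_gE false g cs2 dtau_codes) (fun h => class_dE h cs2 dtau_codes) ket_check.
apply: (@verma_univ K (Mtau K) (U24 K) ketf) => // c m m'.
by rewrite /ketf mulmxDr -scalemxAr -[c%:A *: _]/(rep c%:A *m _) rep_scal mul_scalar_mx.
Qed.

Definition Phi := sval (cid Phi_exists).

Lemma Phi_vt d m : Phi (vt (W := Mtau K) d m) = rep d *m ketf m.
Proof. exact: (svalP (cid Phi_exists)). Qed.

Lemma PhiA d v : Phi (d *: v) = rep d *m Phi v.
Proof. exact: linearZ. Qed.

Definition wvec (j : nat) : Verma (Mtau K) :=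
  vt (W := Mtau K) (xword K (nth [::] bwords j./2)) (delta_mx (inord (odd j)) 0).
Definition wcomb (c : 'cV[K]_24) : Verma (Mtau K) := \sum_(j < 24) (c j 0)%:A *: wvec j.

Lemma rep_xword w : all (fun i => (i < 3)%N) w -> rep (xword K w) = mx 24 24 (Xword w).
Proof.
elim: w => [_|i w IHw /= /andP[i3 /IHw E]]; first by rewrite /xword big_nil rep1 mx_id.
by rewrite /xword big_cons repM E rep_xx mx_mul pcode_sigtau.
Qed.

Lemma Phi_wcomb c : Phi (wcomb c) = mx 24 24 words_mx *m c.
Proof.
rewrite /wcomb linear_sum; apply/matrixP => i k; rewrite ord1 summxE !mxE.
apply: eq_bigr => j _; rewrite PhiA rep_scal mul_scalar_mx !mxE mulrC; congr (_ * _).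
have j12 : (j./2 < size bwords)%N.
  by rewrite ltn_half_double; apply: leq_trans (ltn_ord j) _.
rewrite Phi_vt rep_xword; last first.
  have /allP : all (all (fun i => (i < 3)%N)) bwords by []; apply.
  exact: mem_nth.
rewrite /ketf mulmxA -mx_mul -colE !mxE ient_imk // (nth_map [::]) //.
by rewrite inordK; case: (odd j).
Qed.

Lemma words_basis : mx 24 24 words_mx *m mx 24 24 basis_mx = 1%:M.
Proof. by rewrite -mx_mul (ieqP K words_basis_check) mx_id. Qed.

Lemma wcombD c c' : wcomb (c + c') = wcomb c + wcomb c'.
Proof.
by rewrite -big_split; apply: eq_bigr => j _; rewrite mxE /= scalerDl scalerDl.
Qed.

Lemma wcombZ a c : wcomb (a *: c) = a%:A *: wcomb c.
Proof.
rewrite scaler_sumr; apply: eq_bigr => j _.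
by rewrite mxE scalerA mulr_algl scalerA.
Qed.

(** The spanning half: a word reduces to normal words and [m] to the two kets. Together with
    [words_basis], it makes [Phi] bijective. *)
Lemma wcomb_surj v : exists c, v = wcomb c.
Proof.
have wcomb0 : wcomb 0 = 0 by rewrite -(scale0r 0) wcombZ scale0r scale0r.
elim: (low_all v) => {v} [|_ _ _ [c ->] _ [c' ->]|s m _].
- by exists 0.
- by exists (c + c'); rewrite wcombD.
have wsum (I : Type) (r : seq I) (P : pred I) (F : I -> Verma (Mtau K)) :
    (forall i, P i -> exists c, F i = wcomb c) -> exists c, \sum_(i <- r | P i) F i = wcomb c.
  move=> FP; elim/big_ind: _ => [|_ _ [c ->] [c' ->]|i Pi]; last exact: FP.
    by exists 0.
  by exists (c + c'); rewrite wcombD.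
have [f ->] := wspan_prod K s.
rewrite vtE scaler_suml big_seq_cond; apply: (@wsum) => w /andP[wB _].
rewrite [m]matrix_sum_delta exchange_big big_ord1 /= vt_sum scaler_sumr.
apply: (@wsum) => k _; rewrite vtZ -scal_comm -vtE.
have -> : vt (W := Mtau K) (f w *: xword K w) (delta_mx k 0) =
    (f w)%:A *: vt (W := Mtau K) (xword K w) (delta_mx k 0).
  by rewrite -[f w *: xword K w]mulr_algl vt_scale.
(* Word number i on ket k sits in column 2i + k, as [wvec] decodes it. *)
have jB : ((index w bwords).*2 + k < 24)%N.
  have : ((index w bwords).+1.*2 <= 24)%N.
    by rewrite (leq_double _ 12) -[12%N]/(size bwords) index_mem.
  apply: leq_trans; rewrite doubleS ltnS -[X in (_ <= X)%N]addn1 leq_add2l.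
  exact: (ltn_ord k).
exists (m k 0 *: (f w *: delta_mx (Ordinal jB) 0)); rewrite !wcombZ; congr (_ *: (_ *: _)).
rewrite /wcomb (bigD1 (Ordinal jB)) //= big1 => [|j /negPf jn]; rewrite mxE ?jn ?eqxx ?scale0r //.
rewrite !scale1r addr0 /wvec /=.
have -> : ((index w bwords).*2 + k)./2 = index w bwords.
  by case: (I2P k) => ->; rewrite /= ?addn0 ?addn1 ?doubleK // -[_.+1./2]/(uphalf _) uphalf_double.
rewrite nth_index //; suff -> : inord (odd ((index w bwords).*2 + k)) = k by [].
by case: (I2P k) => ->; apply: val_inj; rewrite /= inordK ?oddD odd_double.
Qed.

Definition Psi (u : 'cV[K]_24) : Verma (Mtau K) := wcomb (mx 24 24 basis_mx *m u).

Lemma PsiK u : Phi (Psi u) = u.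
Proof. by rewrite Phi_wcomb mulmxA words_basis mul1mx. Qed.

Lemma PhiK v : Psi (Phi v) = v.
Proof.
have [c ->] := wcomb_surj v.
by rewrite Phi_wcomb /Psi mulmxA (mulmx1C words_basis) mul1mx.
Qed.

Lemma Phi_inj : injective Phi.
Proof. exact: can_inj PhiK. Qed.

End Coordinates.

Arguments Phi {K}.

(** * Propagation of known coordinates *)

(** The opposites of the degrees of the basis vectors. Each y lowers [ydepth] and each x lowers
    [xdepth], so that repeated application terminates. *)
Definition depths : seq nat :=
  [:: 4; 4; 3; 3; 3; 2; 2; 1; 1; 1; 2; 2; 2; 2; 3; 3; 3; 0; 0; 1; 1; 1; 2; 2]%N.
Definition ydepth (i : nat) : nat := nth 0%N depths i.
Definition xdepth (i : nat) : nat := (4 - ydepth i)%N.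

Definition Xmats : seq imx := [seq Xm t | t <- oddc].
Definition Ymats : seq imx := [seq Ym t | t <- oddc].
(* In degree -2 the y's alone only give vectors or forms such as e + 2f, from
   which tau makes 3e. *)
Definition Ymats2 : seq imx := Ymats ++
  [seq icomb 24 24 2 M 1 (mul (Gm [:: 1; 2; 0]%N) N) | M <- Ymats, N <- Ymats].
Definition allmats : seq imx := [seq Gm s | s <- codes] ++ Xmats ++ Ymats2.

Definition decreasing (lev : nat -> nat) (M : imx) : bool :=
  all (fun i => all (fun j => (ient M i j == 0) || (lev i < lev j)%N) (iota 0 24)) (iota 0 24).
(** Stability under [M] of the span of the first [n] basis vectors. *)
Definition triangular (n : nat) (M : imx) : bool :=
  all (fun i => all (fun j => ient M i j == 0) (iota 0 n)) (iota n (24 - n)).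

Fact X_decreasing : all (decreasing xdepth) Xmats.
Proof. by rewrite /Xmats !matsE; vm_compute. Qed.
Fact Y_decreasing : all (decreasing ydepth) Ymats.
Proof. by rewrite /Ymats !matsE; vm_compute. Qed.
Fact mats_triangular :
  all (fun n => all (triangular n) ([seq Dm s | s <- codes] ++ allmats)) [:: 7; 17]%N.
Proof. by rewrite /allmats /Ymats2 /Xmats /Ymats !matsE; vm_compute. Qed.
Fact X_ket_rows :
  all (fun M => all (fun j => (ient M 17 j == 0) && (ient M 18 j == 0)) (iota 0 24)) Xmats.
Proof. by rewrite /Xmats !matsE; vm_compute. Qed.

(* An item [(g, r)] says that if all indices of [g] are known, then so is the
   last unknown index of the support of [r]. *)
Definition item := (seq nat * seq int)%type.
Definition deduce1 (S : seq nat) (it : item) : seq nat :=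
  if all [in S] it.1 then
    if [seq k <- iota 0 24 | (nth 0 it.2 k != 0) && (k \notin S)] is [:: k]
    then k :: S else S
  else S.
(** Five sweeps suffice for the checks below. *)
Definition deduce (its : seq item) (S : seq nat) : seq nat :=
  iter 5 (fun T => foldl deduce1 T its) S.

(** Here a known index is a coordinate proved to vanish. A row of [M] of index at least [n] is an
    equation, when [M] sends the vector into the span of the first [n] basis vectors. *)
Definition row_items (n : nat) (Ms : seq imx) : seq item :=
  [seq ([::], [seq ient M j k | k <- iota 0 24]) | M <- Ms, j <- iota n (24 - n)].
(** Here a known index is a basis vector proved to lie in a submodule. Its image under [M] lies
    there too, and so does the last unknown term of that image. *)
Definition col_items (Ms : seq imx) : seq item :=
  [seq ([:: k], [seq ient M i k | i <- iota 0 24]) | M <- Ms, k <- iota 0 24].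

Definition covers (T S : seq nat) : bool := all [in S] T.

(* Stated for variables, so that no set to be computed is ever unfolded. *)
Lemma covers_mem T S k : covers T S -> k \in T -> k \in S.
Proof. by move/allP; apply. Qed.

Fact reach_S : all (fun k => covers (iota 0 7) (deduce (col_items allmats) [:: k])) [:: 0; 1]%N.
Proof. by rewrite /allmats /Ymats2 /Xmats /Ymats !matsE; vm_compute. Qed.
Fact reach_X : all (fun k => covers (iota 0 17) (deduce (col_items allmats) (k :: iota 0 7)))
  [:: 7; 8; 9]%N.
Proof. by rewrite /allmats /Ymats2 /Xmats /Ymats !matsE; vm_compute. Qed.
Fact vanish_S : covers (iota 2 22) (deduce (row_items 0 Xmats) [::]).
Proof. by rewrite /Xmats !matsE; vm_compute. Qed.
(** The initial set [iota 17 7] records that the vector lies in X(tau,0). *)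
Fact vanish_X : covers (iota 10 7) (deduce (row_items 7 Ymats) (iota 17 7)).
Proof. by rewrite /Ymats !matsE; vm_compute. Qed.
Fact vanish_V : covers (iota 19 5) (deduce (row_items 17 Ymats2) [::]).
Proof. by rewrite /Ymats2 /Ymats !matsE; vm_compute. Qed.

Section Lattice.
Variable K : fieldType.
Hypothesis charK : [pchar K] =i pred0.
Local Notation D := (DD K).
Local Notation mx := (mx K).
Local Notation V := (Verma (Mtau K)).
Implicit Types (u : 'cV[K]_24) (v : V).

(** Characteristic zero enters here: nonzero pivots of the integral matrices stay invertible over
    K. *)
Lemma int_neq0 (z : int) : z != 0 -> z%:~R != 0 :> K.
Proof.
have h n : (n%:R == 0 :> K) = (n == 0%N) by have /pcharf0P -> := charK.
case: z => n z0; last by rewrite NegzE mulrNz oppr_eq0 -pmulrn h.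
by rewrite -[n%:~R]pmulrn h.
Qed.

(** Soundness of the propagation for an arbitrary property of indices, shared by the vanishing of
    coordinates and the membership of basis vectors. *)
Lemma deduceP (P : nat -> Prop) (its : seq item) S :
  (forall it, it \in its -> (forall k, k \in it.1 -> P k) ->
     forall i, (i < 24)%N -> nth 0 it.2 i != 0 ->
     (forall k, (k < 24)%N -> nth 0 it.2 k != 0 -> k != i -> P k) -> P i) ->
  (forall k, k \in S -> P k) -> forall k, k \in deduce its S -> P k.
Proof.
move=> itP SP; rewrite /deduce; move: 5%N => n; elim: n => [|n] //=.
move: (iter n _ S) => T TP; elim: its itP T TP => //= it its IHits itP T TP.
apply: IHits => [it' its'|k]; first by apply: itP; rewrite inE its' orbT.
rewrite /deduce1; case: allP => [gT|_]; last exact: TP.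
case E: [seq _ <- _ | _] => [|i []]; try exact: TP.
have iE k' : (k' < 24)%N -> nth 0 it.2 k' != 0 -> k' \notin T -> k' = i.
  move=> k24 r0 kT; apply/eqP; rewrite -mem_seq1 -E mem_filter r0 kT mem_iota.
  by rewrite k24.
rewrite inE => /orP[/eqP->|/TP //].
have : i \in [:: i] by rewrite inE.
rewrite -E mem_filter mem_iota => /andP[/andP[ri _] i24].
apply: (itP it) => // [|k' /gT /TP //|k' k24 rk ki]; first by rewrite inE eqxx.
by apply: contraNP ki; case: (boolP (k' \in T)) => [/TP //|/(iE _ k24 rk) -> _]; rewrite eqxx.
Qed.

Lemma decreasingP lev M i j : decreasing lev M -> (i < 24)%N -> (j < 24)%N ->
  ient M i j != 0 -> (lev i < lev j)%N.
Proof.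
move=> /allP dM i24 j24 r0.
have /allP := dM i (etrans (mem_iota 0 24 i) i24).
by move=> /(_ j (etrans (mem_iota 0 24 j) j24)); rewrite (negPf r0).
Qed.

Lemma triangularP n M i j : triangular n M -> (n <= 24)%N -> (i < 24)%N ->
  (n <= i)%N -> (j < n)%N -> ient M i j = 0.
Proof.
move=> /allP tM n24 i24 ni jn.
have /allP : all (fun j => ient M i j == 0) (iota 0 n).
  by apply: tM; rewrite mem_iota ni subnKC.
by move/(_ j)/(_ (etrans (mem_iota 0 n j) jn))/eqP.
Qed.

Definition supp (n : nat) u : Prop := forall i : 'I_24, (n <= i)%N -> u i 0 = 0.

Lemma mx_mulE M u i : (mx 24 24 M *m u) i 0 = \sum_(j < 24) (ient M i j)%:~R * u j 0.
Proof. by rewrite mxE; apply: eq_bigr => j _; rewrite mxE. Qed.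

Lemma nth_ent (f : nat -> int) i : (i < 24)%N -> nth 0 [seq f k | k <- iota 0 24] i = f i.
Proof. by move=> i24; rewrite (nth_map 0%N) ?size_iota // nth_iota. Qed.

Lemma row_itemsP n Ms it : (n <= 24)%N -> it \in row_items n Ms ->
  exists M j, [/\ M \in Ms, (n <= j < 24)%N &
    it = ([::], [seq ient M j k | k <- iota 0 24])].
Proof.
move=> n24 /allpairsP[[M j] [MM jn ->]]; exists M, j; split=> //.
by move: jn; rewrite mem_iota subnKC.
Qed.

Lemma col_itemsP Ms it : it \in col_items Ms ->
  exists M j, [/\ M \in Ms, (j < 24)%N &
    it = ([:: j], [seq ient M i j | i <- iota 0 24])].
Proof.
move=> /allpairsP[[M j] [MM jn ->]]; exists M, j; split=> //.
by have := mem_iota 0 24 j; rewrite jn => /esym.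
Qed.

Lemma vanishP n Ms S u : (n <= 24)%N ->
  (forall M, M \in Ms -> supp n (mx 24 24 M *m u)) ->
  (forall k : 'I_24, val k \in S -> u k 0 = 0) ->
  forall k : 'I_24, val k \in deduce (row_items n Ms) S -> u k 0 = 0.
Proof.
move=> n24 Mu uS k kC; pose P k := forall i : 'I_24, val i = k -> u i 0 = 0.
suff : P (val k) by apply.
apply: deduceP kC => [it /(row_itemsP n24)[M [j [MM /andP[nj jb] ->]]] _ i i24|k' kS i ki]; last first.
  by apply: uS; rewrite ki.
rewrite nth_ent // => r0 Pk i' i'E.
have := Mu M MM (Ordinal jb) nj.
rewrite mx_mulE (bigD1 i') //= big1 => [|l li].
  rewrite addr0 i'E => /eqP; rewrite mulf_eq0 (negPf (int_neq0 r0)) /=.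
  by move/eqP.
have [->|rl] := eqVneq (ient M j l) 0; first by rewrite mul0r.
have r1 := rl; rewrite -(nth_ent _ (ltn_ord l)) in r1.
by rewrite (Pk _ (ltn_ord l) r1) ?mulr0 // -i'E.
Qed.

Lemma reachP Ms S (P : 'cV[K]_24 -> Prop) :
  (forall c u w, P u -> P w -> P (c *: u + w)) ->
  (forall M u, M \in Ms -> P u -> P (mx 24 24 M *m u)) ->
  (forall k : 'I_24, val k \in S -> P (delta_mx k 0)) ->
  forall k : 'I_24, val k \in deduce (col_items Ms) S -> P (delta_mx k 0).
Proof.
move=> PD PM PS k kC; pose Q k := forall i : 'I_24, val i = k -> P (delta_mx i 0).
suff : Q (val k) by apply.
apply: deduceP kC => [it /col_itemsP[M [j [MM jb ->]]] Pj i i24|k' kS i ki]; last first.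
  by apply: PS; rewrite ki.
rewrite (nth_ent (fun k => ient M k j)) // => r0 Pk i' i'E.
have /(PM _ _ MM) : P (delta_mx (Ordinal jb) 0) by apply: (Pj j); rewrite ?inE.
have P0 : P 0 by rewrite -(subrr (delta_mx (Ordinal jb) 0)) -scaleN1r addrC;
  apply: PD; apply: (Pj j); rewrite ?inE.
set w := (_ *m _) => Pw.
have wE : w = (ient M i j)%:~R *: delta_mx i' 0 + \sum_(l | l != i') (ient M l j)%:~R *: delta_mx l 0.
  rewrite -i'E -(bigD1 (P := xpredT) i') //=; apply/matrixP => l o; rewrite ord1 summxE.
  rewrite /w -colE !mxE (bigD1 l) //= big1 => [|o' ol]; rewrite !mxE ?eqxx ?mulr1 ?addr0 //.
  by rewrite eq_sym (negPf ol) mulr0.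
have Ps : P (\sum_(l | l != i') (ient M l j)%:~R *: delta_mx l 0).
  elim/big_ind: _ => // [a b Pa Pb|l li]; first by rewrite -[a]scale1r; apply: PD.
  have [->|rl] := eqVneq (ient M l j) 0; first by rewrite scale0r.
  rewrite -[_ *: _]addr0; apply: PD => //.
  have r1 := rl; rewrite -(nth_ent (fun k => ient M k j) (ltn_ord l)) in r1.
  by apply: (Pk _ (ltn_ord l) r1) => //; rewrite -i'E.
have -> : delta_mx i' 0 = (ient M i j)%:~R^-1 *: (w - \sum_(l | l != i') (ient M l j)%:~R *: delta_mx l 0) + 0.
  by rewrite wE addrK addr0 scalerK // int_neq0.
apply: (PD) => //; rewrite -scaleN1r addrC.
exact: PD.
Qed.

(** As long as some matrix keeps [u] outside [B], [u] is replaced by its image, whose support has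
    lower levels; this stops, as zero lies in [B]. *)
Lemma descend (Ms : seq imx) (lev : nat -> nat) (A B : 'cV[K]_24 -> Prop) :
  all (decreasing lev) Ms -> B 0 ->
  (forall M u, M \in Ms -> A u -> A (mx 24 24 M *m u)) ->
  forall u, A u -> ~ B u ->
  exists u', [/\ A u', ~ B u' & forall M, M \in Ms -> B (mx 24 24 M *m u')].
Proof.
move=> /allP dM B0 AM u.
have [n] : exists n, forall i : 'I_24, (n <= lev i)%N -> u i 0 = 0.
  exists (\max_(i < 24) lev i).+1 => i; rewrite ltnNge.
  by rewrite (leq_bigmax (F := fun i : 'I_24 => lev i) i).
elim: n u => [|n IHn] u un Au Bu.
  by case: Bu; suff -> : u = 0 by []; apply/matrixP => i j; rewrite ord1 un ?mxE.
have [h|] := pselect (forall M, M \in Ms -> B (mx 24 24 M *m u)); first by exists u.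
move=> /existsNP[M /not_implyP[MM BM]].
apply: (IHn _ _ (AM _ _ MM Au) BM) => i ni.
rewrite mx_mulE big1 // => j _.
have [->|r0] := eqVneq (ient M i j) 0; first by rewrite mul0r.
rewrite un ?mulr0 //; apply: leq_ltn_trans ni _.
exact: decreasingP (dM _ MM) (ltn_ord i) (ltn_ord j) r0.
Qed.

End Lattice.

(** * Submodules of M(tau,0) *)

Lemma oddc_transp s : s \in oddc -> exists t : transp, pcode (val t) = s.
Proof.
rewrite !inE => /or3P[]/eqP->; [exists t12|exists t23|exists t13];
  [exact: pcode_t12|exact: pcode_t23|exact: pcode_t13].
Qed.

(** * Irreducibility of the weights over D(S_3) *)

Section Simple.
Variable K : fieldType.

(** The idempotents separate the basis vectors, whose degrees are distinct, so a nonzero [m] yields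
    one of them; transitivity on the degrees yields the others. *)
Lemma class_dsimple b n (d : 'I_n -> 'S_3) (d_inj : injective d)
    (d_conj : forall g i, exists j, d j = conj3 g (d i)) :
  (forall i j, exists g, d j = conj3 g (d i)) -> dsimple (class_module K b d_inj d_conj).
Proof.
move=> trans P PD Pg Pd [m m0 Pm].
have P0 : P 0 by rewrite -(addNr m) -scaleN1r; apply: PD.
have [i mi] : exists i, m i 0 != 0.
  apply: contra_notP (negP m0) => /forallNP mN; apply/eqP/matrixP => i j.
  by rewrite ord1 mxE; apply/eqP/negPn/negP/mN.
have Pi : P (delta_mx i 0).
  have -> : delta_mx i 0 = (m i 0)^-1 *: (class_d K d (d i) *m m) + 0 :> 'cV[K]_n.
    apply/matrixP => j k; rewrite ord1 !mxE addr0 (bigD1 j) //= big1 => [|l lj].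
      rewrite !mxE !eqxx (inj_eq d_inj) addr0 andbT.
      by case: (eqVneq j i) => [->|_] /=; rewrite ?mul1r ?mulVf ?mul0r ?mulr0.
    by rewrite !mxE eq_sym (negPf lj) mul0r.
  by apply: PD => //; apply: Pd.
have Pj j : P (delta_mx j 0).
  have [g jE] := trans i j.
  have -> : delta_mx j 0 = (-1) ^+ (b && odd_perm g) *: (class_g K b d g *m delta_mx i 0) + 0
      :> 'cV[K]_n.
    apply/matrixP => l k; rewrite ord1 addr0 -colE !mxE -jE (inj_eq d_inj) mulrA.
    by rewrite -expr2 sqrr_sign mul1r eqxx andbT.
  by apply: PD => //; apply: Pg.
move=> u; rewrite [u]matrix_sum_delta exchange_big big_ord1 /=.
elim/big_ind: _ => // [v w Pv Pw|j _]; first by rewrite -[v]scale1r; apply: PD.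
by rewrite -[_ *: _]addr0; apply: PD.
Qed.

Lemma Mtau_dsimple : dsimple (Mtau K).
Proof.
apply: class_dsimple => i j.
have [<-|ij] := eqVneq i j.
  by exists 1%g; rewrite /conj3 /mul3 /inv3 invg1 mul1g mulg1.
exists (val t12); apply: pcode_inj; rewrite pcode_conj pcode_t12 !dtau_codes.
by move: ij; case: (I2P i) => ->; case: (I2P j) => ->.
Qed.

Lemma Msigma_dsimple : dsimple (Msigma K).
Proof.
apply: class_dsimple => i j.
have : has (fun s => cconj s (nth [::] oddc i) == nth [::] oddc j) codes.
  by case: i => [[|[|[|?]]] ?] //; case: j => [[|[|[|?]]] ?].
case/hasP=> s /codes_pcode[g <-] /eqP E; exists g.
by apply: pcode_inj; rewrite pcode_conj !dsigma_codes.
Qed.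

Hypothesis charK : [pchar K] =i pred0.

Lemma Merho_dsimple : dsimple (Merho K).
Proof.
move=> P PD Pg _ [m m0 Pm].
have P0 : P 0 by rewrite -(addNr m) -scaleN1r; apply: PD.
have mE (u : 'cV[K]_2) : u = u 0 0 *: delta_mx 0 0 + u 1 0 *: delta_mx 1 0.
  apply/matrixP => i j; rewrite ord1 !mxE.
  by case: (I2P i) => ->; rewrite /= ?mulr1 ?mulr0 ?addr0 ?add0r.
have rE (g : 'S_3) (s : seq nat) (u : 'cV[K]_2) : pcode g = s ->
    rho_g K g *m u = mx K 2 2 (rho_gm s) *m u by move=> <-; rewrite rho_gE.
have mx2 (A : imx) (u : 'cV[K]_2) i : (mx K 2 2 A *m u) i 0 =
    (ient A i 0)%:~R * u 0 0 + (ient A i 1)%:~R * u 1 0.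
  rewrite mxE big_ord_recl big_ord1 !mxE (_ : lift ord0 ord0 = 1) //.
  exact: val_inj.
have s12 (u : 'cV[K]_2) : rho_g K (val t12) *m u = u 1 0 *: delta_mx 0 0 + u 0 0 *: delta_mx 1 0.
  by rewrite (rE _ _ _ pcode_t12) [LHS]mE !mx2 /= !mul0r !mul1r add0r addr0.
have s13 (u : 'cV[K]_2) : rho_g K (val t13) *m u = (- u 0 0 - u 1 0) *: delta_mx 0 0 + u 1 0 *: delta_mx 1 0.
  by rewrite (rE _ _ _ pcode_t13) [LHS]mE !mx2 /= !rmorphN1 !mul0r !mul1r !mulN1r add0r.
(* The vector u - (13)u is a multiple of the first basis vector. *)
have e0 (u : 'cV[K]_2) : P u -> P ((u 0 0 *+ 2 + u 1 0) *: delta_mx 0 0).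
  move=> Pu; have -> : (u 0 0 *+ 2 + u 1 0) *: delta_mx 0 0 = -1 *: (rho_g K (val t13) *m u) + u.
    rewrite s13; apply/matrixP => i j; rewrite ord1 !mxE.
    by case: (I2P i) => ->; rewrite /=; ring.
  by apply: PD => //; apply: (Pg (val t13)).
have swap (u : 'cV[K]_2) : P u -> P (u 1 0 *: delta_mx 0 0 + u 0 0 *: delta_mx 1 0).
  by move=> /(Pg (val t12)); rewrite /= s12.
have Pe0 : P (delta_mx 0 0).
  have key c : c != 0 -> P (c *: delta_mx 0 0) -> P (delta_mx 0 0).
    move=> c0 Pc; rewrite -[delta_mx 0 0](scalerK c0) -[_ *: _]addr0.
    exact: PD.
  (* If the multiples obtained from [m] and from its swap both vanish, then 3 times a coordinate
     vanishes, and [m] is zero. *)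
  have [a0|/key a] := eqVneq (m 0 0 *+ 2 + m 1 0) 0; last by apply/a/e0.
  have Pb := e0 _ (swap _ Pm).
  rewrite !mxE /= !mulr1 !mulr0 addr0 add0r in Pb.
  have [b0|/key] := eqVneq (m 1 0 *+ 2 + m 0 0) 0; last exact.
  have m1 : m 1 0 = - (m 0 0 *+ 2) by apply/eqP; rewrite -addr_eq0 addrC a0.
  have m3 : m 0 0 *+ 3 = 0.
    by rewrite -[RHS]oppr0 -b0 m1; ring.
  have m00 : m 0 0 = 0.
    by move/eqP: m3; rewrite -mulr_natr mulf_eq0 (negPf (int_neq0 charK (z := 3) isT)) orbF => /eqP.
  by case/eqP: m0; rewrite (mE m) m1 m00 mul0rn oppr0 !scale0r addr0.
have Pe1 : P (delta_mx 1 0).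
  have := swap _ Pe0; rewrite !mxE /= scale0r add0r scale1r.
  exact.
by move=> u; rewrite (mE u); apply: (PD) => //; rewrite -[_ *: _]addr0; apply: PD.
Qed.
End Simple.

(** * The layers of the flag S(tau,0) < X(tau,0) < M(tau,0) *)

Section Submodules.
Variable K : fieldType.
Hypothesis charK : [pchar K] =i pred0.
Local Notation D := (DD K).
Local Notation mx := (mx K).
Local Notation V := (Verma (Mtau K)).
Implicit Types (u w : 'cV[K]_24) (v : V) (A : submodClosed V).

Lemma Psi_lin c u w : Psi (c *: u + w) = c%:A *: Psi u + Psi w.
Proof. by rewrite /Psi mulmxDr -scalemxAr wcombD wcombZ. Qed.

Lemma Psi0 : Psi (0 : 'cV[K]_24) = 0.
Proof. by apply: (can_inj (@PhiK K)); rewrite PsiK linear0. Qed.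

Lemma Psi_rep (d : D) u : Psi (rep d *m u) = d *: Psi u.
Proof. by apply: (can_inj (@PhiK K)); rewrite PhiA !PsiK. Qed.

Lemma PsiD_mem A c u w : Psi u \in A -> Psi w \in A -> Psi (c *: u + w) \in A.
Proof. by move=> uA wA; rewrite Psi_lin rpredD ?rpredZ. Qed.

Lemma allmats_rep M : M \in allmats -> exists d : D, rep d = mx 24 24 M.
Proof.
have Yrep N : N \in Ymats -> exists t, rep (yy K t) = mx 24 24 N.
  by case/mapP=> s /oddc_transp[t <-] ->; exists t; rewrite rep_yy.
rewrite mem_cat => /orP[/mapP[s /codes_pcode[g <-] ->]|].
  by exists (gg K g); rewrite rep_gg.
rewrite mem_cat => /orP[/mapP[s /oddc_transp[t <-] ->]|].
  by exists (xx K t); rewrite rep_xx.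
rewrite mem_cat => /orP[/Yrep[t <-]|]; first by exists (yy K t).
move=> /allpairsP[[N N'] /= [/Yrep[t tN] /Yrep[t' tN'] ->]].
exists ((2%:~R : K) *: yy K t + gg K tau * yy K t').
by rewrite repD repZ repM tN tN' rep_gg pcode_tau mx_comb mx_mul scale1r.
Qed.

Lemma Psi_mx_mem A M u : M \in allmats -> Psi u \in A -> Psi (mx 24 24 M *m u) \in A.
Proof. by case/allmats_rep=> d <- uA; rewrite Psi_rep rpredZ. Qed.

Lemma Xmats_all M : M \in Xmats -> M \in allmats.
Proof. by move=> XM; rewrite mem_cat; apply/orP; right; rewrite mem_cat XM. Qed.
Lemma Ymats2_all M : M \in Ymats2 -> M \in allmats.
Proof. by move=> YM; rewrite mem_cat; apply/orP; right; rewrite mem_cat YM orbT. Qed.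
Lemma Ymats_all M : M \in Ymats -> M \in allmats.
Proof. by move=> YM; apply: Ymats2_all; rewrite mem_cat YM. Qed.

Lemma Gm_all s : s \in codes -> Gm s \in allmats.
Proof. by move=> sC; rewrite mem_cat map_f. Qed.

Lemma supp_mx n M u : n \in [:: 7; 17]%N -> M \in [seq Dm s | s <- codes] ++ allmats ->
  supp n u -> supp n (mx 24 24 M *m u).
Proof.
move=> n2 MM un i ni; rewrite mx_mulE big1 // => j _.
have [jn|nj] := ltnP j n; last by rewrite un ?mulr0.
have /allP/(_ _ MM) tM := allP mats_triangular _ n2.
rewrite (triangularP tM _ (ltn_ord i) ni jn) ?mul0r //.
by move: n2; rewrite !inE => /orP[]/eqP->.
Qed.

Lemma suppD n c u w : supp n u -> supp n w -> supp n (c *: u + w).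
Proof. by move=> un wn i ni; rewrite !mxE un ?wn ?mulr0 ?addr0. Qed.

Lemma supp0 n : supp n (0 : 'cV[K]_24).
Proof. by move=> i _; rewrite mxE. Qed.

Lemma supp_rep n (d : D) u : n \in [:: 7; 17]%N -> supp n u -> supp n (rep d *m u).
Proof.
move=> n2; elim/D_ind: d u => [t|t|g|h|c|a b IHa IHb|a b IHa IHb] u un.
- rewrite rep_xx; apply: supp_mx => //; rewrite mem_cat Xmats_all ?orbT //.
  exact/map_f/transp_oddc.
- rewrite rep_yy; apply: supp_mx => //; rewrite mem_cat Ymats_all ?orbT //.
  exact/map_f/transp_oddc.
- rewrite rep_gg; apply: supp_mx => //; rewrite mem_cat.
  by rewrite Gm_all ?orbT ?pcode_codes.
- rewrite rep_dd; apply: supp_mx => //; rewrite mem_cat.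
  by rewrite (map_f _ (pcode_codes h)).
- by rewrite rep_scal mul_scalar_mx -[_ *: _]addr0; apply: suppD => //; apply: supp0.
- by rewrite repD mulmxDl -[rep a *m u]scale1r; apply: suppD; auto.
- by rewrite repM -mulmxA; auto.
Qed.

Lemma supp_submod n : n \in [:: 7; 17]%N ->
  exists A : submodClosed V, forall v, v \in A <-> supp n (Phi v).
Proof.
move=> n2; apply: ex_submod => [|a u v un vn].
  by rewrite linear0; apply: supp0.
rewrite linearD PhiA -[rep a *m _]scale1r.
by apply: suppD => //; apply: supp_rep.
Qed.

Definition unitv (i : 'I_24) : 'cV[K]_24 := delta_mx i 0.

Lemma supp_mem A n : (forall i : 'I_24, (i < n)%N -> Psi (unitv i) \in A) ->
  forall u, supp n u -> Psi u \in A.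
Proof.
move=> eA u un; rewrite [u]matrix_sum_delta exchange_big big_ord1 /=.
elim/big_ind: _ => [|a b aA bA|i _]; first by rewrite Psi0 rpred0.
  by rewrite -[a]scale1r; apply: PsiD_mem.
rewrite -[_ *: _]addr0; have [ni|in_] := leqP n i.
  by rewrite un // scale0r addr0 Psi0 rpred0.
by apply: PsiD_mem; [apply: eA|rewrite Psi0 rpred0].
Qed.

Lemma sum_unitvE (P : pred 'I_24) u k :
  (\sum_(j : 'I_24 | P j) u j 0 *: unitv j) k 0 = if P k then u k 0 else 0.
Proof.
rewrite summxE big_mkcond (bigD1 k) //= big1 => [|j jk].
  by rewrite !mxE !eqxx mulr1 addr0.
by rewrite !mxE eq_sym (negPf jk) mulr0; case: ifP.
Qed.

(** The idempotent [dd h] for the group degree of i keeps only the basis vectors of that degree;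
    those other than i are absent or can be subtracted within [A]. *)
Lemma isolate A u (i : 'I_24) : Psi u \in A -> u i 0 != 0 ->
  (forall j : 'I_24, nth [::] degs j = nth [::] degs i -> j != i ->
     u j 0 = 0 \/ Psi (unitv j) \in A) ->
  Psi (unitv i) \in A.
Proof.
move=> uA ui H.
have [h hE] : exists h, pcode h = nth [::] degs i.
  have /(all_nthP [::]) dC : all [in codes] degs by [].
  exact/codes_pcode/dC/ltn_ord.
pose w := \sum_(j : 'I_24 | (nth [::] degs j == nth [::] degs i) && (j != i)) u j 0 *: unitv j.
have wA : Psi w \in A.
  rewrite /w; elim/big_ind: _ => [|a b aA bA|j /andP[/eqP ji jni]]; first by rewrite Psi0 rpred0.
    by rewrite -[a]scale1r; apply: PsiD_mem.
  rewrite -[_ *: _]addr0; case: (H j ji jni) => [->|eA].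
    by rewrite scale0r addr0 Psi0 rpred0.
  by apply: PsiD_mem; rewrite ?Psi0 ?rpred0.
have E : rep (dd K h) *m u = u i 0 *: unitv i + w.
  transitivity (\sum_(j : 'I_24 | nth [::] degs j == nth [::] degs i) u j 0 *: unitv j); last first.
    by rewrite (bigD1 i) //=.
  apply/matrixP => k l; rewrite ord1 rep_dd matsE mxEk hE mxE.
  rewrite (bigD1 k) //= big1 => [|j jk]; last first.
    by rewrite mxE eq_sym val_eqE (negPf jk) mul0r.
  rewrite mxE eqxx /= addr0 sum_unitvE.
  by case: ifP; rewrite ?mul1r ?mul0r.
have -> : unitv i = (u i 0)^-1 *: (rep (dd K h) *m u + (-1) *: w) + 0.
  by rewrite E scaleN1r addrK scalerK // addr0.
apply: PsiD_mem; last by rewrite Psi0 rpred0.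
by rewrite addrC; apply: PsiD_mem => //; rewrite Psi_rep rpredZ.
Qed.

Lemma reach_mem A T S :
  covers T (deduce (col_items allmats) S) ->
  (forall k : 'I_24, val k \in S -> Psi (unitv k) \in A) ->
  forall k : 'I_24, val k \in T -> Psi (unitv k) \in A.
Proof.
move=> cT SA k /(covers_mem cT) kC.
apply: (@reachP K charK allmats S (fun u => Psi u \in A)) kC => //.
  by move=> c u w; apply: PsiD_mem.
by move=> M u MM; apply: Psi_mx_mem.
Qed.

Lemma socle_min A : is_nonzero A -> forall u, supp 7 u -> Psi u \in A.
Proof.
move=> [v vA v0]; apply: supp_mem.
have cA M u : M \in Xmats -> Psi u \in A -> Psi (mx 24 24 M *m u) \in A.
  by move=> XM; apply/Psi_mx_mem/Xmats_all.
have vA' : Psi (Phi v) \in A by rewrite PhiK.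
have v0' : ~ (Phi v = 0) by move=> E; case/eqP: v0; rewrite -(PhiK v) E Psi0.
have [u [uA u0 Xu]] := descend (B := eq^~ 0) X_decreasing erefl cA vA' v0'.
have uz (k : 'I_24) : (2 <= k)%N -> u k 0 = 0.
  move=> k2; apply: (@vanishP K charK 0 Xmats [::]) => //.
    by move=> M /Xu -> i _; rewrite mxE.
  by apply: (covers_mem vanish_S); rewrite mem_iota k2 ltn_ord.
have [i i2 ui] : exists2 i : 'I_24, (i < 2)%N & u i 0 != 0.
  apply: contrapT => /forall2NP nz; apply: u0; apply/matrixP => i j; rewrite ord1 mxE.
  by case: (nz i) => [/negP|/negP/negPn/eqP //]; rewrite -leqNgt => /uz.
have iA : Psi (unitv i) \in A.
  (* The indices 0 and 1 have the distinct degrees tau and tau^-1. *)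
  apply: (isolate uA ui) => j ji jni; left; apply: uz; rewrite leqNgt; apply/negP => j2.
  move: ji jni i2 j2; case: i {ui} => [[|[|i]] hi] //; case: j => [[|[|j]] hj] //.
move=> k k7; apply: (@reach_mem A (iota 0 7) [:: val i]) => [|j|].
- by apply: (allP reach_S); case: i i2 {ui iA} => [[|[|i]] hi].
- by rewrite inE => /eqP/val_inj ->.
- by rewrite mem_iota.
Qed.

Lemma middle_simple A v : (forall u, supp 7 u -> Psi u \in A) ->
  v \in A -> supp 17 (Phi v) -> ~ supp 7 (Phi v) -> forall u, supp 17 u -> Psi u \in A.
Proof.
move=> SA vA v17 v7; apply: supp_mem.
have cA M u : M \in Ymats -> Psi u \in A /\ supp 17 u ->
    Psi (mx 24 24 M *m u) \in A /\ supp 17 (mx 24 24 M *m u).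
  move=> YM [uA u17]; split; first exact/Psi_mx_mem/uA/Ymats_all.
  by apply: supp_mx; rewrite // mem_cat Ymats_all ?orbT.
have vA' : Psi (Phi v) \in A /\ supp 17 (Phi v) by rewrite PhiK.
have [u [[uA u17] u7 Yu]] := descend Y_decreasing (@supp0 7) cA vA' v7.
have uz (k : 'I_24) : (10 <= k)%N -> u k 0 = 0.
  move=> k10; have [/u17 //|k17] := leqP 17 k.
  apply: (@vanishP K charK 7 Ymats (iota 17 7)) => // [k'|].
    by rewrite mem_iota => /andP[/u17].
  by apply: (covers_mem vanish_X); rewrite mem_iota k10.
have [i i79 ui] : exists2 i : 'I_24, (7 <= i < 10)%N & u i 0 != 0.
  apply: contrapT => /forall2NP nz; apply: u7 => i i7.
  have [/uz //|i10] := leqP 10 i.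
  by case: (nz i) => [/negP|/negP/negPn/eqP //]; rewrite i7 i10.
have unitS (j : 'I_24) : (j < 7)%N -> Psi (unitv j) \in A.
  move=> j7; apply: SA => l l7; rewrite mxE; case: eqP => // lj.
  by move: l7; rewrite lj leqNgt j7.
have iA : Psi (unitv i) \in A.
  apply: (isolate uA ui) => j ji jni.
  (* Other basis vectors of the same degree lie in S(tau,0) or have zero coefficient, since the
     degrees of the indices 7, 8, 9 are distinct. *)
  have [/unitS jA|j7] := ltnP j 7; [by right|left; apply: uz].
  rewrite leqNgt; apply/negP => j10.
  move: ji jni i79 j7 j10; case: i {ui} => [[|[|[|[|[|[|[|[|[|[|i]]]]]]]]]] hi] //;
    by case: j => [[|[|[|[|[|[|[|[|[|[|j]]]]]]]]]] hj].
move=> k k17; apply: (@reach_mem A (iota 0 17) (val i :: iota 0 7)) => [|j|].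
- by apply: (allP reach_X); rewrite -[[:: _; _; _]]/(iota 7 3) mem_iota.
- by rewrite in_cons mem_iota => /orP[/eqP/val_inj -> //|/unitS].
- by have := mem_iota 0 17 k; rewrite add0n k17 => ->.
Qed.

Lemma low_coords v : low 1 v -> forall i : 'I_24, (17 <= i < 19)%N -> Phi v i 0 = 0.
Proof.
elim=> {v} [|u v _ IHu _ IHv|[|t s] m //= _] i i17.
- by rewrite linear0 mxE.
- by rewrite linearD mxE IHu // IHv // addr0.
- rewrite big_cons Phi_vt repM -mulmxA rep_xx mx_mulE big1 // => j _.
  have /allP/(_ j) := allP X_ket_rows _ (map_f Xm (transp_oddc t)).
  rewrite mem_iota /= ltn_ord => /(_ isT) /andP[/eqP r17 /eqP r18].
  have : (val i == 17) || (val i == 18).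
    case/andP: i17 => i17; rewrite ltnS leq_eqVlt => /orP[->|]; first by rewrite orbT.
    by rewrite ltnS => i18; rewrite eqn_leq i17 i18.
  by case/orP=> /eqP ->; rewrite ?r17 ?r18 mul0r.
Qed.

Lemma top_all A v : v \in A -> ~ supp 17 (Phi v) -> forall v', v' \in A.
Proof.
move=> vA v17.
have cA M u : M \in Ymats -> Psi u \in A -> Psi (mx 24 24 M *m u) \in A.
  by move=> YM; apply/Psi_mx_mem/Ymats_all.
have vA' : Psi (Phi v) \in A by rewrite PhiK.
have [u [uA u17 Yu]] := descend Y_decreasing (@supp0 17) cA vA' v17.
have uz (k : 'I_24) : (19 <= k)%N -> u k 0 = 0.
  move=> k19; apply: (@vanishP K charK 17 Ymats2 [::]) => //; last first.
    by apply: (covers_mem vanish_V); rewrite mem_iota k19 ltn_ord.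
  move=> M; rewrite mem_cat => /orP[/Yu //|/allpairsP[[N N'] /= [/Yu Nu /Yu N'u ->]]].
  (* The combinations 2M + tau N also send [u] into X(tau,0), which tau preserves. *)
  rewrite mx_comb mulmxDl -scalemxAl scale1r mx_mul -mulmxA; apply: suppD => //.
  by apply: supp_mx; rewrite // mem_cat Gm_all ?orbT.
have [m [l [ll uE]]] := low_split (Psi u).
have [m0|m0] := eqVneq m 0.
  (* With [m] zero, the ket coordinates 17 and 18 would vanish as well, and [u] would lie in
     X(tau,0). *)
  case: u17 => i i17; have [/uz //|i19] := leqP 19 i.
  rewrite -[u]PsiK uE m0 vt0 add0r low_coords // i17.
  exact: i19.
by apply: (top_generates (@Mtau_dsimple K) m0 ll); rewrite -uE.
Qed.

End Submodules.

(** * The submodules J and G *)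

(** A common frame in which [rhoE], g and sigma g are compared. *)
Definition e56 : imx := imx_of_cols 24 2 [:: [:: 6]; [:: 7]]%Z.
Definition itr (m n : nat) (A : imx) : imx := imk n m (fun i j => ient A j i).
Definition col_supp (n p : nat) (E : imx) : bool :=
  all (fun i => all (fun j => ient E i j == 0) (iota 0 p)) (iota n (24 - n)).

(** The columns are distinct unit vectors, so the transpose is a left inverse; this gives the
    injectivity of [emb]. *)
Fact jE_inv : ieq 3 3 (imul 3 24 3 (itr 24 3 jE) jE) (iid 3).
Proof. by rewrite matsE; vm_compute. Qed.
Fact e56_inv : ieq 2 2 (imul 2 24 2 (itr 24 2 e56) e56) (iid 2).
Proof. by rewrite matsE; vm_compute. Qed.
Fact jE_supp : col_supp 17 3 jE. Proof. by vm_compute. Qed.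
Fact e56_supp : col_supp 7 2 e56. Proof. by vm_compute. Qed.

Definition rho_e56 : imx := [:: [:: -1; -2]; [:: 1; -1]]%Z.
Definition sigma_e56 : imx := [:: [:: 1; -1]; [:: 0; -1]]%Z.
Fact rhoE_e56 : ieq 24 2 rhoE (imul 24 2 2 e56 rho_e56).
Proof. by rewrite matsE; vm_compute. Qed.
Fact sigmaE_e56 : ieq 24 2 (imul 24 24 2 (Gm [:: 1; 0; 2]%N) e56) (imul 24 2 2 e56 sigma_e56).
Proof. by rewrite !matsE; vm_compute. Qed.

Fact jvec_check : all (fun i => all (fun r =>
    ient (imul 24 24 2 (mul (isub (iid 24) (Gm (nth [::] oddc i)))
                            (Xm (nth [::] oddc ((i + 2) %% 3)))) ketE) r 0 == ient jE r i)
  (iota 0 24)) (iota 0 3).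
Proof. by rewrite /isub !matsE; vm_compute. Qed.

Definition ket_word (s t : seq nat) : imx := imul 24 24 2 (mul (Xm s) (Xm t)) ketE.
(** As zeta is not an integer, the coefficients of 1 and of - zeta^2 in g are checked separately; in
    the basis vectors e_5 and e_6 they are - e_5 - e_6 and e_5. *)
Fact gvec_check :
  let a := [:: 1; 0; 2]%N in let b := [:: 0; 2; 1]%N in let c := [:: 2; 1; 0]%N in
  all (fun r =>
    (ient (ket_word c b) r 0 + ient (ket_word c a) r 1 == - ient e56 r 0 - ient e56 r 1) &&
    (ient (ket_word a c) r 0 + ient (ket_word a b) r 1 == ient e56 r 0)) (iota 0 24).
Proof. by rewrite /ket_word !matsE; vm_compute. Qed.

Section Vectors.
Variable K : fieldType.
Hypothesis charK : [pchar K] =i pred0.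
Local Notation D := (DD K).
Local Notation mx := (mx K).
Local Notation V := (Verma (Mtau K)).

Definition emb n (E : imx) (c : 'cV[K]_n) : V := Psi (mx 24 n E *m c).

Lemma emb_lin n E a (c d : 'cV[K]_n) : emb E (a *: c + d) = a%:A *: emb E c + emb E d.
Proof. by rewrite /emb mulmxDr -scalemxAr Psi_lin. Qed.

Lemma emb_inj n E : ieq n n (imul n 24 n (itr 24 n E) E) (iid n) ->
  injective (@emb n E).
Proof.
move/ieqP => /(_ K); rewrite mx_mul mx_id => EE.
apply: (can_inj (g := fun v => mx n 24 (itr 24 n E) *m Phi v)) => c.
by rewrite PsiK mulmxA EE mul1mx.
Qed.

Lemma emb0 n E : emb E (0 : 'cV[K]_n) = 0.
Proof. by rewrite /emb mulmx0 Psi0. Qed.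

Lemma emb_cols n E (M : 'M[K]_n) (c : 'I_n -> K) :
  \sum_i (c i)%:A *: emb E (col i M) = emb E (M *m \col_i c i).
Proof.
have -> : M *m \col_i c i = \sum_i c i *: col i M.
  apply/matrixP => i j; rewrite !mxE summxE; apply: eq_bigr => k _.
  by rewrite !mxE mulrC.
have embD (u v : 'cV[K]_n) : emb E (u + v) = emb E u + emb E v.
  by rewrite -[u]scale1r emb_lin !scale1r.
rewrite (big_morph (emb E) embD (emb0 n E)); apply: eq_bigr => i _.
by have := emb_lin E (c i) (col i M) 0; rewrite emb0 !addr0.
Qed.

Lemma kspan_emb n E (M : 'M[K]_n) (b : 'I_n -> V) : M \in unitmx ->
  (forall i, b i = emb E (col i M)) -> kspan b = range (@emb n E).
Proof.
move=> uM bE; rewrite (funext bE : b = _).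
apply/seteqP; split=> v /=.
  by move=> [c ->]; rewrite emb_cols; exists (M *m \col_i c i).
move=> [c _ <-]; exists (fun i => (invmx M *m c) i 0); rewrite emb_cols.
have -> : \col_i (invmx M *m c) i 0 = invmx M *m c.
  by apply/matrixP => i j; rewrite ord1 mxE.
by rewrite mulKVmx.
Qed.

Lemma kfree_emb n E (M : 'M[K]_n) (b : 'I_n -> V) : injective (@emb n E) ->
  M \in unitmx -> (forall i, b i = emb E (col i M)) -> kfree b.
Proof.
move=> Einj uM bE c; rewrite (funext bE : b = _) emb_cols -(emb0 n E).
move/Einj => /(congr1 (mulmx (invmx M))); rewrite mulKmx // mulmx0.
by move=> /matrixP c0 i; have := c0 i 0; rewrite !mxE.
Qed.

Lemma Phi_ket k : Phi (vt (W := Mtau K) 1 (delta_mx k 0)) = col k (mx 24 2 ketE).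
Proof. by rewrite Phi_vt rep1 mul1mx colE. Qed.

Lemma jvec_emb i : jvec K i = emb jE (delta_mx i 0).
Proof.
apply: (@Phi_inj K); rewrite PsiK /jvec PhiA /ket_tau Phi_ket.
rewrite repM repD repN rep1 rep_gg rep_xx -(sigtau_mod3 (i + 2)).
rewrite !pcode_sigtau ?ltn_mod // -mx_id -mx_sub -mx_mul.
rewrite [X in _ *m X]colE mulmxA -mx_mul -!colE.
apply/matrixP => r l; rewrite !mxE.
have /allP/(_ (val r)) := allP jvec_check i (etrans (mem_iota 0 3 i) (ltn_ord i)).
by rewrite mem_iota ltn_ord => /(_ isT)/eqP ->.
Qed.

Lemma gvec_emb zeta : gvec zeta = emb e56 (\col_(i < 2) (if i == 0 then - 1 - zeta ^+ 2 else -1)).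
Proof.
apply: (@Phi_inj K); rewrite PsiK /gvec linearD !PhiA /ket_tau /ket_tauV !Phi_ket.
have word s t k : rep (xx K s * xx K t) *m col k (mx 24 2 ketE) =
    col k (mx 24 2 (ket_word (pcode (val s)) (pcode (val t)))).
  by rewrite repM !rep_xx -!mx_mul colE mulmxA -mx_mul -colE.
rewrite !repD !repN !repZ !mulmxDl !mulNmx -!scalemxAl !word.
rewrite pcode_t12 pcode_t23 pcode_t13.
apply/matrixP => r l; rewrite ord1 [RHS]mxE big_ord_recl big_ord1 !mxE.
have := mem_iota 0 24 r; rewrite ltn_ord => /(allP gvec_check) /andP[/eqP A1 /eqP A2].
have {A1} := congr1 (intmul (1 : K)) A1; have {A2} := congr1 (intmul (1 : K)) A2.
rewrite !intrD ?mulrNz /= => A2 A1.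
rewrite addrACA -[(1 %% 2)%N]/1%N -opprD -mulrDr A1 A2 -[bump 0 0]/1%N.
ring.
Qed.

Lemma sigma_emb (c : 'cV[K]_2) : gg K sigma *: emb e56 c = emb e56 (mx 2 2 sigma_e56 *m c).
Proof.
rewrite -Psi_rep rep_gg /emb !mulmxA -!mx_mul pcode_t12.
by rewrite (ieqP K sigmaE_e56).
Qed.

Lemma two_by_two (A : 'M[K]_2) : A 0 0 * A 1 1 - A 0 1 * A 1 0 != 0 -> A \in unitmx.
Proof.
have l0 : lift 0 0 = 1 :> 'I_2 by apply: val_inj.
have l1 : lift 1 0 = 0 :> 'I_2 by apply: val_inj.
rewrite unitmxE unitfE (expand_det_row _ 0) !big_ord_recl big_ord0 addr0.
rewrite /cofactor !det_mx11 !mxE /= expr0 expr1 mul1r mulN1r mulrN.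
by rewrite !l0 !l1 (_ : ord0 = 0 :> 'I_2) //; apply: val_inj.
Qed.

End Vectors.

(** * The theorem *)

Section Degrees.
Variables (K : fieldType) (W : dmodule K).
Local Notation V := (Verma W).
Implicit Types v w : V.

Lemma deg_word n (s : seq transp) m : size s = n ->
  Verma_deg (W := W) n (vt (\prod_(t <- s) xx K t) m).
Proof.
move=> sn; have sn' : size s == n by apply/eqP.
by exists [:: (Tuple sn', m)]; rewrite big_seq1.
Qed.

Lemma degD n v w : Verma_deg n v -> Verma_deg n w -> Verma_deg n (v + w).
Proof. by move=> [s ->] [r ->]; exists (s ++ r); rewrite big_cat. Qed.

Lemma deg_ind n (P : V -> Prop) : P 0 -> (forall v w, P v -> P w -> P (v + w)) ->
  (forall (s : seq transp) m, size s = n -> P (vt (\prod_(t <- s) xx K t) m)) ->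
  forall v, Verma_deg n v -> P v.
Proof.
move=> P0 PD Pw _ [s ->]; elim/big_ind: _ => // p _.
by apply: Pw; rewrite size_tuple.
Qed.

Lemma deg0 n : Verma_deg (W := W) n 0.
Proof. by exists [::]; rewrite big_nil. Qed.

Lemma degZ n (c : K) v : Verma_deg n v -> Verma_deg n (c%:A *: v).
Proof.
move: v; apply: deg_ind => [|v w cv cw|s m sn]; first by rewrite scaler0; apply: deg0.
  by rewrite scalerDr; apply: degD.
by rewrite -vtZ; apply: deg_word.
Qed.

Lemma degN n v : Verma_deg n v -> Verma_deg n (- v).
Proof. by move/(degZ (-1)); rewrite !scaleN1r. Qed.

Lemma deg_xx n t v : Verma_deg n v -> Verma_deg n.+1 (xx K t *: v).
Proof.
move: v; apply: deg_ind => [|v w cv cw|s m sn]; first by rewrite scaler0; apply: deg0.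
  by rewrite scalerDr; apply: degD.
have := @deg_word n.+1 (t :: s) m (congr1 S sn).
by rewrite big_cons vt_scale.
Qed.

Lemma deg_ket m : Verma_deg (W := W) 0 (vt 1 m).
Proof. by have := @deg_word 0 [::] m erefl; rewrite big_nil. Qed.

Lemma deg_gg n g v : Verma_deg n v -> Verma_deg n (gg K g *: v).
Proof.
move: v; apply: deg_ind => [|v w cv cw|s m]; first by rewrite scaler0; apply: deg0.
  by rewrite scalerDr; apply: degD.
elim: s n m => [|t s IHs] n m /= <-; first by rewrite big_nil vt_gg; apply: deg_ket.
rewrite big_cons vt_scale scalerA gg_xx -mulr_algl -!scalerA.
exact/degZ/deg_xx/IHs.
Qed.

Lemma deg_kspan n k (b : 'I_k -> V) : (forall i, Verma_deg n (b i)) ->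
  forall v, kspan b v -> Verma_deg n v.
Proof.
move=> bn _ [c ->]; elim/big_ind: _ => [||i _]; [exact: deg0|exact: degD|exact: degZ].
Qed.

End Degrees.

Lemma submod_sub_simple (R : nzRingType) (V : lmodType R) (A : submodClosed V) :
  is_nonzero A -> (forall B : submodClosed V, is_nonzero B -> {subset B <= A} -> {subset A <= B}) ->
  simple_module (submod A).
Proof.
move=> [a aA a0] AB; split.
  by exists (Sub a aA); apply: contraNneq a0 => /(congr1 val); rewrite SubK => /= ->.
move=> C [c cC c0] [v vC].
have [||E EE] := @ex_submod _ _ (fun w => exists2 a : submod A, val a = w & a \in C).
- by exists 0; rewrite ?rpred0 ?linear0.
- by move=> r _ _ [u <- uC] [w <- wC]; exists (r *: u + w); rewrite ?linearP ?rpredD ?rpredZ.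
have /(_ _ (valP v)) /EE [a' av aC] : {subset A <= E}.
  apply: AB => [|w /EE [u <- _]]; last exact: valP.
  exists (val c); first by apply/EE; exists c.
  by apply: contraNneq c0 => c0; apply/eqP/val_inj; rewrite c0 linear0.
by case/negP: vC; rewrite (_ : v = a') //; apply: val_inj.
Qed.

(** * Submodule lattice, socle, highest weights and composition series *)

Section Main.
Variable K : fieldType.
Hypothesis charK : [pchar K] =i pred0.
Variable zeta : K.
Hypothesis zetaP : 3.-primitive_root zeta.
Local Notation D := (DD K).
Local Notation mx := (mx K).
Local Notation V := (Verma (Mtau K)).
Local Notation genJ := (gen (J K) : submodClosed V).
Local Notation genG := (gen (G zeta) : submodClosed V).

(** The columns are g and sigma g in the basis vectors 5 and 6; the determinant is - 1 - 2
    zeta^2. *)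
Definition gmx : 'M[K]_2 := \matrix_(i, j)
  (if j == 0 then if i == 0 then - 1 - zeta ^+ 2 else -1
   else if i == 0 then - zeta ^+ 2 else 1).

Lemma gmx_unit : gmx \in unitmx.
Proof.
apply: two_by_two; rewrite !mxE /=.
have z3 : zeta ^+ 3 = 1 by apply: prim_expr_order.
apply/negP => /eqP d0.
(* A zero determinant means 2 zeta^2 = -1; cubing gives 8 = -1, that is 9 = 0. *)
have z2 : zeta ^+ 2 *+ 2 = -1.
  by apply/eqP; rewrite -subr_eq0 -oppr_eq0 -d0; apply/eqP; ring.
have : (9%:~R : K) = 0.
  have -> : (9%:~R : K) = 8%:R * (zeta ^+ 3) ^+ 2 + 1 by rewrite z3; ring.
  have -> : 8%:R * (zeta ^+ 3) ^+ 2 = (zeta ^+ 2 *+ 2) ^+ 3 by ring.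
  by rewrite z2; ring.
by apply/eqP/int_neq0.
Qed.

Lemma gbasis_emb i : gbasis zeta i = emb e56 (col i gmx).
Proof.
rewrite /gbasis; case: (I2P i) => -> /=; rewrite gvec_emb ?sigma_emb; congr emb.
  by apply/matrixP => r l; rewrite !mxE.
apply/matrixP => r l; rewrite !mxE big_ord_recl big_ord1 !mxE /=.
by case: (I2P r) => -> /=; rewrite /ient /=; ring.
Qed.

Lemma G_range : G zeta = range (@emb K 2 e56).
Proof. exact: kspan_emb gmx_unit gbasis_emb. Qed.

Lemma J_range : J K = range (@emb K 3 jE).
Proof.
apply: (@kspan_emb K 3 jE 1%:M); first exact: unitmx1.
by move=> i; rewrite jvec_emb colE mul1mx.
Qed.

Lemma gbasis_free : kfree (gbasis zeta).
Proof. exact: kfree_emb (emb_inj e56_inv) gmx_unit gbasis_emb. Qed.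

Lemma jvec_free : kfree (jvec K).
Proof.
apply: (kfree_emb (emb_inj jE_inv) (unitmx1 _ _)).
by move=> i; rewrite jvec_emb colE mul1mx.
Qed.

Lemma emb_supp n p E (c : 'cV[K]_p) : col_supp n p E -> (n <= 24)%N ->
  supp n (mx 24 p E *m c).
Proof.
move=> /allP cE n24 i ni; rewrite mxE big1 // => j _.
have : val i \in iota n (24 - n) by rewrite mem_iota ni subnKC //=.
move/cE/allP/(_ (val j)); rewrite mem_iota ltn_ord => /(_ isT) /eqP E0.
by rewrite mxE E0 mul0r.
Qed.

(** The span of the first 7 basis vectors is stable and contains G, which gives one inclusion. For
    the other, [socle_min] puts this span into every nonzero submodule. *)
Lemma genG_supp v : v \in genG <-> supp 7 (Phi v).
Proof.
split=> [vG|v7].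
  have [A AE] := supp_submod K (n := 7) isT.
  apply/AE; move: v vG; apply: gen_sub => v; rewrite G_range => -[c _ <-].
  by apply/AE; rewrite PsiK; apply: emb_supp e56_supp _.
rewrite -(PhiK v); apply: socle_min v7 => //.
exists (emb e56 (delta_mx 0 0 : 'cV[K]_2)).
  by apply: in_gen; rewrite G_range; exists (delta_mx 0 0).
rewrite -(emb0 K 2 e56) (inj_eq (emb_inj e56_inv)).
by apply/eqP => /matrixP /(_ 0 0) /eqP; rewrite !mxE oner_eq0.
Qed.

(** As for G, with [middle_simple] applied to the first [jvec], which lies outside S(tau,0). *)
Lemma genJ_supp v : v \in genJ <-> supp 17 (Phi v).
Proof.
split=> [vJ|v17].
  have [A AE] := supp_submod K (n := 17) isT.
  apply/AE; move: v vJ; apply: gen_sub => v; rewrite J_range => -[c _ <-].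
  by apply/AE; rewrite PsiK; apply: emb_supp jE_supp _.
pose w := emb jE (delta_mx 0 0 : 'cV[K]_3).
have wJ : w \in genJ by apply: in_gen; rewrite J_range; exists (delta_mx 0 0).
have w7 : ~ supp 7 (Phi w).
  pose i7 : 'I_24 := Ordinal (isT : 7 < 24)%N.
  by move/(_ i7 isT); rewrite PsiK -colE !mxE => /eqP; rewrite oner_eq0.
rewrite -(PhiK v); apply: (@middle_simple K charK _ w _ wJ _ w7 _ v17).
  apply: socle_min => //; exists w; first exact: wJ.
  apply/eqP => w0; apply: w7.
  by rewrite w0 linear0; apply: supp0.
by rewrite PsiK; apply: emb_supp jE_supp _.
Qed.

Lemma genGJ : {subset genG <= genJ}.
Proof.
move=> v /genG_supp v7; apply/genJ_supp => i i17; apply: v7.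
exact: leq_trans i17.
Qed.

Lemma supp_unitv n (i : 'I_24) : (n <= i)%N -> ~ supp n (Phi (Psi (unitv K i))).
Proof.
by move=> ni /(_ i ni); rewrite PsiK !mxE !eqxx => /eqP; rewrite oner_eq0.
Qed.

Lemma genJG : ~ {subset genJ <= genG}.
Proof.
pose i7 : 'I_24 := Ordinal (isT : 7 < 24)%N.
move/(_ (Psi (unitv K i7))) => h.
apply: (@supp_unitv 7 i7) => //; apply/genG_supp/h/genJ_supp => i i17.
by rewrite PsiK !mxE; case: eqP => // ii; move: i17; rewrite ii.
Qed.

Lemma genJ_proper : is_proper genJ.
Proof.
pose i17 : 'I_24 := Ordinal (isT : 17 < 24)%N.
by exists (Psi (unitv K i17)); apply/negP => /genJ_supp; apply: supp_unitv.
Qed.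

Lemma genG_min (A : submodClosed V) : is_nonzero A -> {subset genG <= A}.
Proof. by move=> A0 v /genG_supp v7; rewrite -(PhiK v); apply: socle_min. Qed.

Lemma genG_nonzero : is_nonzero genG.
Proof.
pose i0 : 'I_24 := Ordinal (isT : 0 < 24)%N.
exists (Psi (unitv K i0)).
  apply/genG_supp => i i7; rewrite PsiK !mxE; case: eqP => // ii.
  by move: i7; rewrite ii.
by apply/eqP => E; apply: (@supp_unitv 0 i0) => //; rewrite E linear0; apply: supp0.
Qed.

Lemma genJ_min (A : submodClosed V) v : {subset genG <= A} -> v \in A ->
  v \in genJ -> v \notin genG -> {subset genJ <= A}.
Proof.
move=> GA vA /genJ_supp v17 /negP vG w /genJ_supp w17; rewrite -(PhiK w).
apply: (@middle_simple K charK _ v _ vA v17 _ _ w17) => [u u7|v7].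
  by apply/GA/genG_supp; rewrite PsiK.
by apply/vG/genG_supp.
Qed.

Lemma genJ_max (A : submodClosed V) v : v \in A -> v \notin genJ -> forall w, w \in A.
Proof.
move=> vA /negP vJ; apply: (@top_all K charK _ v vA) => v17.
by apply/vJ/genJ_supp.
Qed.

Lemma nonsub_ex (A B : submodClosed V) : ~ {subset A <= B} -> exists2 v, v \in A & v \notin B.
Proof.
move=> AB; apply: contrapT => /forall2NP h; apply: AB => v vA.
by case: (h v) => // /negP/negPn.
Qed.

Lemma submodule_lattice (A : submodClosed V) :
  (is_nonzero A /\ is_proper A) <-> (A =i genG \/ A =i genJ).
Proof.
split=> [[A0 [w wA]]|].
  have GA := genG_min A0.
  have AJ : {subset A <= genJ}.
    move=> v vA; apply: contraNT wA => vJ; exact: genJ_max vA vJ w.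
  have [AG|/nonsub_ex[v vA vG]] := pselect {subset A <= genG}.
    by left=> v; apply/idP/idP => [/AG|/GA].
  by right=> u; apply/idP/idP => [/AJ //|]; apply: (genJ_min GA vA (AJ _ vA) vG).
have [v vG v0] := genG_nonzero; have [w wJ] := genJ_proper.
case=> AE; split.
- by exists v; rewrite ?AE.
- by exists w; rewrite AE; apply: contra wJ => /genGJ.
- by exists v; rewrite ?AE ?genGJ.
- by exists w; rewrite AE.
Qed.

Lemma genJ_unique_maximal : unique_maximal genJ.
Proof.
have mJ : maximal genJ.
  split=> [|B JB [w wB] v vB]; first exact: genJ_proper.
  by apply: contraNT wB => vJ; apply: genJ_max vB vJ w.
by split=> // B mB; apply: (maximal_unique (@Mtau_dsimple K)).
Qed.

(** S(tau,0) is simple, being contained in every nonzero submodule; for the same reason each simple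
    submodule contains it, hence equals it. *)
Lemma socle_genG : socle (V := V) =i genG.
Proof.
move=> v; apply/idP/idP; last first.
  move=> vG; apply: in_gen; exists genG => //.
  by apply: submod_sub_simple genG_nonzero _ => B B0 _; apply: genG_min.
move: v; apply: gen_sub => v [A [[a a0] As] vA].
have A0 : is_nonzero A.
  by exists (val a); [apply: valP|apply: contraNneq a0 => a0; apply/eqP/val_inj; rewrite a0 linear0].
apply: contrapT => /negP vG.
apply: (As (inter (A := A) genG)).
  have [w wG w0] := genG_nonzero; exists (Sub w (genG_min A0 wG)); first exact: wG.
  by apply: contraNneq w0 => /(congr1 val); rewrite SubK => /= ->.
by exists (Sub v vA); exact: vG.
Qed.

Lemma ket_weight : [/\ forall g m, vt (W := Mtau K) 1 (actg (Mtau K) g *m m) = gg K g *: vt 1 m,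
  forall h m, vt (W := Mtau K) 1 (actd (Mtau K) h *m m) = dd K h *: vt 1 m &
  forall t m, yy K t *: vt (W := Mtau K) 1 m = 0].
Proof. by split=> *; rewrite ?vt_gg ?vt_dd ?vt_yy. Qed.

Lemma emb_weight (W : dmodule K) E aG aD :
  (forall g, actg W g = mx _ _ (aG (pcode g))) ->
  (forall h, actd W h = mx _ _ (aD (pcode h))) ->
  weight_check (ddim W) E aG aD ->
  [/\ forall g m, emb E (actg W g *m m) = gg K g *: emb E m,
      forall h m, emb E (actd W h *m m) = dd K h *: emb E m &
      forall t (m : 'cV[K]_(ddim W)), yy K t *: emb E m = 0].
Proof.
move=> aGE aDE /(weight_embed aGE aDE)[fg fd fy].
by split=> *; rewrite /emb ?fg ?fd ?Psi_rep // -Psi_rep fy Psi0.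
Qed.

Lemma j_weight : [/\ forall g m, emb jE (actg (Msigma K) g *m m) = gg K g *: emb jE m,
  forall h m, emb jE (actd (Msigma K) h *m m) = dd K h *: emb jE m &
  forall t (m : 'cV[K]_3), yy K t *: emb jE m = 0].
Proof.
have cs3 : size oddc = 3 by [].
exact: (@emb_weight (Msigma K) _ _ _ (fun g => class_gE K true g cs3 dsigma_codes)
  (fun h => class_dE K h cs3 dsigma_codes) j_check).
Qed.

Lemma rho_weight : [/\ forall g m, emb rhoE (actg (Merho K) g *m m) = gg K g *: emb rhoE m,
  forall h m, emb rhoE (actd (Merho K) h *m m) = dd K h *: emb rhoE m &
  forall t (m : 'cV[K]_2), yy K t *: emb rhoE m = 0].
Proof.
exact: (@emb_weight (Merho K) _ _ _ (rho_gE K) (rho_dE K) rho_check).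
Qed.

Lemma rho_e56_unit : mx 2 2 rho_e56 \in unitmx.
Proof.
apply: two_by_two; rewrite !mxE /ient /=.
have -> : ((-1)%:~R * (-1)%:~R - (-2)%:~R * 1%:~R : K) = 3%:~R by ring.
exact: int_neq0.
Qed.

Lemma emb_rho (m : 'cV[K]_2) : emb rhoE m = emb e56 (mx 2 2 rho_e56 *m m).
Proof. by rewrite /emb (ieqP K rhoE_e56) mx_mul mulmxA. Qed.

Lemma emb_rho_inj : injective (@emb K 2 rhoE).
Proof.
move=> m m'; rewrite !emb_rho => /(emb_inj e56_inv) /(congr1 (mulmx (invmx (mx 2 2 rho_e56)))).
by rewrite !mulKmx ?rho_e56_unit.
Qed.

Lemma rho_range : G zeta = range (@emb K 2 rhoE).
Proof.
rewrite G_range; apply/seteqP; split=> _ [c _ <-].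
  exists (invmx (mx 2 2 rho_e56) *m c) => //.
  by rewrite emb_rho mulKVmx ?rho_e56_unit.
by exists (mx 2 2 rho_e56 *m c) => //; rewrite emb_rho.
Qed.

Lemma J_highest_weight : highest_weight (Msigma K) (J K) genJ.
Proof.
have [fg fd fy] := j_weight; split=> //.
  exists (@emb K 3 jE); split=> //; [exact: emb_lin|exact: emb_inj jE_inv|exact: J_range].
by move=> t v; rewrite J_range => -[m _ <-].
Qed.

Lemma G_highest_weight : highest_weight (Merho K) (G zeta) genG.
Proof.
have [fg fd fy] := rho_weight; split=> //.
  exists (@emb K 2 rhoE); split=> //; [exact: emb_lin|exact: emb_rho_inj|exact: rho_range].
by move=> t v; rewrite rho_range => -[m _ <-].
Qed.

Lemma ket_range : gen [set: V] =i gen (range (vt (W := Mtau K) 1)).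
Proof.
move=> v; apply/idP/idP => _; last exact: in_gen.
elim/qpiP: v => r; rewrite qpi_vt; apply: rpred_sum => j _; apply: rpredZ.
by apply: in_gen; exists (delta_mx j 0).
Qed.

Lemma J_deg v : J K v -> Verma_deg 1 v.
Proof.
apply: deg_kspan => i; rewrite /jvec mulrBl mul1r scalerBl -!scalerA.
apply: degD; first exact/deg_xx/deg_ket.
exact/degN/deg_gg/deg_xx/deg_ket.
Qed.

Lemma G_deg v : G zeta v -> Verma_deg 2 v.
Proof.
have xxk s t m : Verma_deg (W := Mtau K) 2 ((xx K s * xx K t) *: vt 1 m).
  by rewrite -scalerA; apply/deg_xx/deg_xx/deg_ket.
have zE c (d : D) (w : V) : (c *: d) *: w = c%:A *: (d *: w) by rewrite scalerA mulr_algl.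
have g2 : Verma_deg 2 (gvec zeta).
  rewrite /gvec /ket_tau /ket_tauV !scalerBl !(zE _ (xx K _ * xx K _)).
  by apply: degD; (apply: degD; [exact: xxk|exact/degN/degZ/xxk]).
by apply: deg_kspan => i; rewrite /gbasis; case: ifP => // _; apply: deg_gg.
Qed.

Lemma genT v : v \in gen [set: V].
Proof. exact: in_gen. Qed.

Lemma gen_empty v : v \in gen (set0 : set V) -> v = 0.
Proof.
move: v; apply: (@gen_ind _ _ _ (fun v => v = 0)) => // a u v -> ->.
by rewrite scaler0 addr0.
Qed.

Definition series (n : nat) : submodClosed V :=
  match n with
  | 0 => gen set0
  | 1 => genG
  | 2 => genJ
  | _ => gen setT
  end.

Lemma series_composition : composition_factors V
    (fun i : 'I_3 => match val i with
                     | 0%N => L (Mtau K)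
                     | 1%N => L (Msigma K)
                     | _ => L (Merho K)
                     end).
Proof.
(* The series climbs from the socle, so its factors come in the order opposite to the list; the
   transposition exchanges the two ends. *)
exists series, (tperm 0 ord_max).
have s0 : {subset series 0 <= series 1} by move=> v /gen_empty ->; apply: rpred0.
have s2 : {subset series 2 <= series 3} by move=> v _; apply: genT.
have n0 : ~ {subset series 1 <= series 0}.
  by have [v vG /eqP v0] := genG_nonzero; move/(_ v vG)/gen_empty.
have n2 : ~ {subset series 3 <= series 2}.
  by have [v /negP vJ] := genJ_proper; move/(_ v (genT v)).
have c0 (C : submodClosed V) : {subset series 0 <= C} -> {subset C <= series 1} ->
    ~ {subset C <= series 0} -> {subset series 1 <= C}.
  move=> _ _ /nonsub_ex[v vC v0]; apply: genG_min; exists v => //.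
  by apply: contraNneq v0 => ->; apply: rpred0.
have c1 (C : submodClosed V) : {subset series 1 <= C} -> {subset C <= series 2} ->
    ~ {subset C <= series 1} -> {subset series 2 <= C}.
  move=> GC CJ /nonsub_ex[v vC vG].
  exact: genJ_min GC vC (CJ _ vC) vG.
have c2 (C : submodClosed V) : {subset series 2 <= C} -> {subset C <= series 3} ->
    ~ {subset C <= series 2} -> {subset series 3 <= C}.
  by move=> JC _ /nonsub_ex[v vC vJ] w _; apply: genJ_max vC vJ w.
split.
- move=> v; rewrite inE; apply/idP/eqP => [/gen_empty //|->]; exact: rpred0.
- by move=> v; rewrite /series genT.
- by case=> [[|[|[|//]]] i3] /=; [exact: s0|exact: genGJ|exact: s2].
case=> [[|[|[|//]]] i3] /=; split.
- exact: subquo_simple s0 n0 c0.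
- rewrite (_ : Ordinal i3 = 0) ?tpermL /=; last exact: val_inj.
  have [fg fd fy] := rho_weight.
  apply: (highest_weight_head (@Merho_dsimple K charK) (@emb_lin K 2 rhoE) fg fd fy) => //.
  by rewrite -rho_range.
- exact: subquo_simple genGJ genJG c1.
- rewrite tpermD /= -?val_eqE //=.
  have [fg fd fy] := j_weight.
  apply: (highest_weight_head (@Msigma_dsimple K) (@emb_lin K 3 jE) fg fd fy) => //.
  + by rewrite -J_range.
  + exact: genGJ.
  + exact: genJG.
- exact: subquo_simple s2 n2 c2.
- rewrite (_ : Ordinal i3 = ord_max) ?tpermR /=; last exact: val_inj.
  have [fg fd fy] := ket_weight.
  apply: (highest_weight_head (@Mtau_dsimple K) (vt_lin 1) fg fd fy) => //.
  exact: ket_range.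
Qed.

End Main.

Theorem theorem9 (K : closedFieldType) (charK : [pchar K] =i pred0)
    (zeta : K) (zetaP : 3.-primitive_root zeta) :
  (* the lattice of submodules of M(tau,0) *)
  (forall A : submodClosed (Verma (Mtau K)),
     (is_nonzero A /\ is_proper A) <->
     (A =i gen (G zeta) \/ A =i gen (J K))) /\
  ({subset gen (G zeta) <= gen (J K)} /\ ~ {subset gen (J K) <= gen (G zeta)}) /\
  (* J and X(tau,0) *)
  ((forall v, J K v -> Verma_deg 1 v) /\ kfree (jvec K) /\
   unique_maximal (gen (J K)) /\
   highest_weight (Msigma K) (J K) (gen (J K))) /\
  (* G and S(tau,0) *)
  ((forall v, G zeta v -> Verma_deg 2 v) /\ kfree (gbasis zeta) /\
   socle (V := Verma (Mtau K)) =i gen (G zeta) /\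
   highest_weight (Merho K) (G zeta) (gen (G zeta))) /\
  (* composition factors *)
  composition_factors (Verma (Mtau K))
    (fun i : 'I_3 => match val i with
                     | 0%N => L (Mtau K)
                     | 1%N => L (Msigma K)
                     | _ => L (Merho K)
                     end).
Proof.
split; first exact: submodule_lattice.
split; first by split; [exact: (@genGJ _ charK _ zetaP)|exact: (genJG charK zetaP)].
split.
  split; first exact: J_deg.
  split; first exact: jvec_free.
  by split; [exact: genJ_unique_maximal|exact: J_highest_weight].
split; last exact: (series_composition charK zetaP).
split; first exact: G_deg.
split; first exact: gbasis_free.
by split; [exact: socle_genG|exact: G_highest_weight].
Qed.
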